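(* Let $\Lambda\subset(0,\infty)^2$ be a set of parameters $(\epsilon,\delta)$ along which $\delta=o(\sqrt\epsilon)$, i.e. $\delta/\sqrt\epsilon\to0$ as $\epsilon\to0$ with $(\epsilon,\delta)\in\Lambda$, and $\delta\le C\sqrt\epsilon$ on $\Lambda$. For each $(\epsilon,\delta)\in\Lambda$ let $(u^{\epsilon,\delta},p^{\epsilon,\delta},U^{\epsilon,\delta})$ be the solution, with maximal existence time $T_{\epsilon,\delta}\in(0,\infty]$, of the relaxation system with smooth initial data $(u_0^{\epsilon,\delta},p_0^{\epsilon,\delta},U_0^{\epsilon,\delta})$. Assume that, with $C>0$ independent of $(\epsilon,\delta)$, for all $(\epsilon,\delta)\in\Lambda$ $$\|u_0^{\epsilon,\delta}-u_0^{NS}\|_{H^1}+\sqrt\epsilon\,\|p_0^{\epsilon,\delta}-p_0^{NS}\|_{H^1}+(\epsilon+\delta)\|U_0^{\epsilon,\delta}\|_{H^1}\le C(\epsilon+\delta),$$ $$\|\nabla\operatorname{div}u_0^{\epsilon,\delta}\|_{L^2}+\delta\left(\|\Delta p_0^{\epsilon,\delta}\|_{L^2}+\|\nabla\operatorname{div}U_0^{\epsilon,\delta}\|_{L^2}\right)\le C(\epsilon+\delta),$$ and, for some $a>0$ independent of $(\epsilon,\delta)$, $$\|\Delta(u_0^{\epsilon,\delta},p_0^{\epsilon,\delta},U_0^{\epsilon,\delta})\|_{L^2}\le C(\epsilon+\delta)^{-a}.$$ Then for every $T>0$ there exist constants $C_T>0$ and $\eta_T>0$, independent of $(\epsilon,\delta)$,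 such that for all $(\epsilon,\delta)\in\Lambda$ with $\epsilon+\delta\le\eta_T$ and $T<T_{\epsilon,\delta}$, $$\sup_{0<t<T}\|p^{\epsilon,\delta}(t,\cdot)-p^{NS}(t,\cdot)\|_{H^1}\le C_T\left(\sqrt\epsilon+\frac{\delta}{\sqrt\epsilon}\right),$$ and the right-hand side tends to $0$ as $\epsilon\to0$ along $\Lambda$.
   Context: $\mathbb T^2=\mathbb R^2/\mathbb Z^2$. All norms $L^2,L^\infty,H^1$ are over $\mathbb T^2$; matrices use the Frobenius norm; norms of tuples are computed by summing the squares of the components' norms. Conventions: $(\nabla u)_{ij}=\partial_{x_i}u_j$, $\operatorname{div}=\nabla\cdot$, $(\nabla\cdot U)_j=\sum_i\partial_{x_i}U_{ij}$, $(u\otimes v)_{ij}=u_iv_j$. Incompressible Navier-Stokes equations: $(p^{NS},u^{NS}):[0,\infty)\times\mathbb T^2\to\mathbb R\times\mathbb R^2$ is the smooth solution of $$\nabla\cdot u^{NS}=0,\quad \partial_t u^{NS}+\nabla\cdot(u^{NS}\otimes u^{NS})=-\nabla p^{NS}+\Delta u^{NS},\quad u^{NS}(0,\cdot)=u_0^{NS},$$ with smooth initial datum $u_0^{NS}$ (independent of $(\epsilon,\delta)$), normalized by $\int_{\mathbb T^2}p^{NS}(t,x)\,dx=0$ for all $t$; $p_0^{NS}=p^{NS}(0,\cdot)$. Relaxation system, for $\epsilon,\delta>0$, with unknowns $p^{\epsilon,\delta}\in\mathbb R$, $u^{\epsilon,\delta}\in\mathbb R^2$, $U^{\epsilon,\delta}\in\mathbb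 R^{2\times2}$ on $[0,T_{\epsilon,\delta})\times\mathbb T^2$: $$\epsilon\partial_t p^{\epsilon,\delta}+\nabla\cdot u^{\epsilon,\delta}=0,\quad \partial_t u^{\epsilon,\delta}+\nabla\cdot U^{\epsilon,\delta}+\nabla p^{\epsilon,\delta}=0,\quad \delta\partial_tU^{\epsilon,\delta}+\nabla u^{\epsilon,\delta}=u^{\epsilon,\delta}\otimes u^{\epsilon,\delta}-U^{\epsilon,\delta},$$ with $(u^{\epsilon,\delta},p^{\epsilon,\delta},U^{\epsilon,\delta})(0,\cdot)=(u_0^{\epsilon,\delta},p_0^{\epsilon,\delta},U_0^{\epsilon,\delta})$ smooth. This is a symmetrizable hyperbolic system, so a unique local-in-time smooth solution exists; $T_{\epsilon,\delta}$ denotes its maximal existence time. Constants may depend on $u_0^{NS}$ and on the constants in the hypotheses, but not on $(\epsilon,\delta)$. *)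

(* Defs.v *)
From Stdlib Require Import Reals List.
From Coquelicot Require Import Coquelicot.
Import ListNotations.
Open Scope R_scope.

(** A function on the torus T^2 = R^2/Z^2 is encoded as a function on R^2,
    curried, which is 1-periodic in each variable ([smooth_T2]); vector and
    matrix fields are families indexed by the two coordinate directions. *)

Inductive axis := ax1 | ax2.

Definition sum2 (F : axis -> R) : R := F ax1 + F ax2.

Definition sfield := R -> R -> R.
Definition vfield := axis -> sfield.
Definition mfield := axis -> axis -> sfield.

Definition fsub (f g : sfield) : sfield := fun x1 x2 => f x1 x2 - g x1 x2.
Definition vsub (v w : vfield) : vfield := fun i => fsub (v i) (w i).

Definition pd (i : axis) (f : sfield) : sfield := fun x1 x2 =>
  match i with
  | ax1 => Derive (fun s => f s x2) x1
  | ax2 => Derive (fun s => f x1 s) x2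
  end.

Definition ex_pd (i : axis) (f : sfield) (x1 x2 : R) : Prop :=
  match i with
  | ax1 => ex_derive (fun s => f s x2) x1
  | ax2 => ex_derive (fun s => f x1 s) x2
  end.

(** [(vgrad v) i j] is the derivative of [v j] in direction [i], and
    [mdiv U] contracts the first index of [U]. *)
Definition grad (f : sfield) : vfield := fun i => pd i f.
Definition vgrad (v : vfield) : mfield := fun i j => pd i (v j).
Definition div (v : vfield) : sfield := fun x1 x2 => sum2 (fun i => pd i (v i) x1 x2).
Definition mdiv (U : mfield) : vfield := fun j => div (fun i => U i j).
Definition lap (f : sfield) : sfield := div (grad f).
Definition tensor (v w : vfield) : mfield := fun i j x1 x2 => v i x1 x2 * w j x1 x2.

Definition periodic (f : sfield) : Prop :=
  forall x1 x2, f (x1 + 1) x2 = f x1 x2 /\ f x1 (x2 + 1) = f x1 x2.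

Fixpoint iter_pd (l : list axis) (f : sfield) : sfield :=
  match l with
  | [] => f
  | i :: l' => pd i (iter_pd l' f)
  end.

(** C^infinity: every iterated partial derivative exists and is jointly
    continuous. *)
Definition smooth_T2 (f : sfield) : Prop :=
  periodic f /\
  forall (l : list axis) (x1 x2 : R),
    continuous (fun z : R * R => iter_pd l f (fst z) (snd z)) (x1, x2) /\
    forall i, ex_pd i (iter_pd l f) x1 x2.

(** Time derivatives are taken relative to the half-line [0, oo), so that they
    are two-sided for t > 0 and one-sided at t = 0; values at negative times
    are irrelevant.  Replacing the filter by [locally t] gives [is_derive]. *)
Definition is_dt (f : R -> sfield) (t x1 x2 l : R) : Prop :=
  filterdiff (fun s => f s x1 x2) (within (fun s => 0 <= s) (locally t))
             (fun h => scal h l).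

Definition dt (f : R -> sfield) : R -> sfield :=
  fun t x1 x2 => iota (is_dt f t x1 x2).

Inductive direction := Time | Space (i : axis).

Fixpoint iter_D (l : list direction) (f : R -> sfield) : R -> sfield :=
  match l with
  | [] => f
  | Time :: l' => dt (iter_D l' f)
  | Space i :: l' => fun t => pd i (iter_D l' f t)
  end.

(** C^infinity on [0, T) x T^2, up to and including t = 0; T may be infinite. *)
Definition smooth_evol (T : Rbar) (f : R -> sfield) : Prop :=
  forall t : R, 0 <= t -> Rbar_lt t T ->
    periodic (f t) /\
    forall (l : list direction) (x1 x2 : R),
      filterlim (fun z : R * R * R => iter_D l f (fst (fst z)) (snd (fst z)) (snd z))
                (within (fun z : R * R * R => 0 <= fst (fst z)) (locally (t, x1, x2)))
                (locally (iter_D l f t x1 x2)) /\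
      (exists v, is_dt (iter_D l f) t x1 x2 v) /\
      forall i, ex_pd i (iter_D l f t) x1 x2.

(** All functions integrated below are continuous, so the iterated Riemann
    integral is the Lebesgue integral over T^2. *)
Definition int_T2 (f : sfield) : R :=
  RInt (fun x1 => RInt (fun x2 => f x1 x2) 0 1) 0 1.

Definition L2sq (f : sfield) : R := int_T2 (fun x1 x2 => f x1 x2 ^ 2).
Definition H1sq (f : sfield) : R := L2sq f + sum2 (fun i => L2sq (grad f i)).

(** Norms of tuples of scalar fields, given as the list of all components. *)
Definition sumR (l : list R) : R := fold_right Rplus 0 l.
Definition normL2 (fs : list sfield) : R := sqrt (sumR (map L2sq fs)).
Definition normH1 (fs : list sfield) : R := sqrt (sumR (map H1sq fs)).

Definition vcomp (v : vfield) : list sfield := [v ax1; v ax2].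
Definition mcomp (U : mfield) : list sfield :=
  [U ax1 ax1; U ax1 ax2; U ax2 ax1; U ax2 ax2].

Definition NS_solution (u0 : vfield) (u : R -> vfield) (p : R -> sfield) : Prop :=
  (forall i, smooth_evol p_infty (fun t => u t i)) /\
  smooth_evol p_infty p /\
  (forall t x1 x2, 0 <= t ->
     div (u t) x1 x2 = 0 /\
     (forall j, dt (fun s => u s j) t x1 x2 + mdiv (tensor (u t) (u t)) j x1 x2
                = - grad (p t) j x1 x2 + lap (u t j) x1 x2)) /\
  (forall i x1 x2, u 0 i x1 x2 = u0 i x1 x2) /\
  (forall t, 0 <= t -> int_T2 (p t) = 0).

Definition relax_solution (eps delta : R) (u0 : vfield) (p0 : sfield) (U0 : mfield)
    (T : Rbar) (u : R -> vfield) (p : R -> sfield) (U : R -> mfield) : Prop :=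
  (forall i, smooth_evol T (fun t => u t i)) /\
  smooth_evol T p /\
  (forall i j, smooth_evol T (fun t => U t i j)) /\
  (forall t x1 x2, 0 <= t -> Rbar_lt t T ->
     eps * dt p t x1 x2 + div (u t) x1 x2 = 0 /\
     (forall j, dt (fun s => u s j) t x1 x2 + mdiv (U t) j x1 x2
                + grad (p t) j x1 x2 = 0) /\
     (forall i j, delta * dt (fun s => U s i j) t x1 x2 + vgrad (u t) i j x1 x2
                  = tensor (u t) (u t) i j x1 x2 - U t i j x1 x2)) /\
  (forall i x1 x2, u 0 i x1 x2 = u0 i x1 x2) /\
  (forall x1 x2, p 0 x1 x2 = p0 x1 x2) /\
  (forall i j x1 x2, U 0 i j x1 x2 = U0 i j x1 x2).

Definition maximal_relax_solution (eps delta : R)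
    (u0 : vfield) (p0 : sfield) (U0 : mfield)
    (T : Rbar) (u : R -> vfield) (p : R -> sfield) (U : R -> mfield) : Prop :=
  Rbar_lt 0 T /\
  relax_solution eps delta u0 p0 U0 T u p U /\
  (forall T' u' p' U',
     relax_solution eps delta u0 p0 U0 T' u' p' U' -> Rbar_le T' T).

(** [f eps delta -> 0] as [eps -> 0] with [(eps, delta)] in [Lam], where
    [Lam] is a set of pairs with positive entries. *)
Definition vanishes_along (Lam : R -> R -> Prop) (f : R -> R -> R) : Prop :=
  forall r, 0 < r -> exists eta, 0 < eta /\
    forall eps delta, Lam eps delta -> eps < eta -> Rabs (f eps delta) < r.

(* Main.v *)
Require Import Defs.
From Stdlib Require Import Reals List.
From Coquelicot Require Import Coquelicot.
From Stdlib Require Import Lra Lia Psatz ZArith.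
From Stdlib Require Import FunctionalExtensionality ProofIrrelevance ClassicalEpsilon.
Import ListNotations.
Open Scope R_scope.

(** The proof compares the two systems by energy estimates in [H^1].  Write [a],
    [pi] for the Navier-Stokes solution and [s = eps + delta].  Put
    [stress_NS a = a tensor a - grad a]; then
    [dt a + div (stress_NS a) + grad pi = 0], so [(a, pi, stress_NS a)] solves
    the relaxation system up to the residuals [eps dt pi] and
    [delta dt (stress_NS a)].  The relaxation system is symmetric for the energy
    [(eps |p|^2 + |u|^2 + delta |U|^2) / 2], and an error whose energy is [O(s^2)]
    has a pressure of size [s / sqrt eps = sqrt eps + delta / sqrt eps].

    Two effects would spoil this size.  The residual of the pressure equation has
    size [eps] but is tested against a pressure error of which only
    [sqrt eps] times the norm is controlled.  Since [pi] has mean zero,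
    [dt pi = div F] for a smooth [F] ([divergence_potential]), and adding [eps F]
    to the velocity error moves the residual to the other two equations, where it
    is harmless.  Secondly, the initial stress error is only bounded, so that its
    contribution to the energy is [O(delta)].  It is carried by an explicit initial
    layer [exp (- t / delta) W0], which is subtracted; what remains is a force
    [- exp (- t / delta) div W0] in the velocity equation, whose integral in time
    is [O(s)] in [H^1] by the hypotheses on the initial stress
    ([layer_amplitude_le]).  The corrected error satisfies the linear relaxation
    system with small sources and the quadratic source
    [v tensor v + v tensor a + a tensor v], where [v = u - a]
    ([perturbation_system]).

    The quadratic source is controlled in [H^1] as long as [|v| <= 1]
    ([energy1_growth]); Gronwall's lemma then gives an energy [O(s^2)].  In
    dimension two [H^1] does not embed into the bounded functions.  But under
    the same condition the energy of the second derivatives of [(p, u, U)] grows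
    at most by a factor and a summand independent of [s] ([energy2_growth]), so
    that these derivatives stay bounded, like their initial values, by a fixed
    negative power of [s]; and the supremum of [v] is bounded by a product of
    powers of the [H^1] and the [H^2] norm in which the exponent of the latter is
    arbitrarily small ([sup_interpolation]).  For small [s] this yields a bound by
    one ([velocity_error_le_one]), and a continuity argument closes the estimate
    ([pressure_estimate]).

    All fields are elements of a commutative algebra [evol T] of smooth periodic
    fields on the open interval [(0, T)] with bounded derivatives, which is stable
    under derivations and under averages along the axes.  Integrals over the torus
    are iterated averages; integration by parts, Fubini's theorem and
    differentiation under the integral sign are commutation rules for these
    operators.  Sobolev inequalities are proved with smooth majorants in place of
    absolute values, so that they stay inside the algebra. *)

(** * Regular fields on a time interval *)

Section Regularity.
Variable T : R.

Definition dom (t : R) : Prop := 0 < t < T.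

Lemma dom_dec t : {dom t} + {~ dom t}.
Proof.
  unfold dom; destruct (Rlt_dec 0 t), (Rlt_dec t T); auto; right; tauto.
Qed.

Lemma dom_open t : dom t -> locally t dom.
Proof.
  intros [H0 H1].
  apply filter_and; [apply open_gt | apply open_lt]; assumption.
Qed.

Definition line (d : direction) (f : R -> sfield) (t x y : R) : R -> R :=
  match d with
  | Time => fun s => f s x y
  | Space ax1 => fun s => f t s y
  | Space ax2 => fun s => f t x s
  end.

Definition coord (d : direction) (t x y : R) : R :=
  match d with Time => t | Space ax1 => x | Space ax2 => y end.

Definition Der (d : direction) (f : R -> sfield) : R -> sfield :=
  fun t x y => Derive (line d f t x y) (coord d t x y).

Definition eq_dom (f g : R -> sfield) : Prop :=
  forall t x y, dom t -> f t x y = g t x y.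

(** Used instead of an equation on [Der], because it also records
    differentiability. *)
Definition derives (d : direction) (f g : R -> sfield) : Prop :=
  forall t x y, dom t -> is_derive (line d f t x y) (coord d t x y) (g t x y).

Definition bounded_per (f : R -> sfield) : Prop :=
  (exists B, forall t x y, dom t -> Rabs (f t x y) <= B) /\
  (forall t, dom t -> periodic (f t)).

(** The derivatives are taken one direction at a time and are only asked to be
    bounded: continuity of each of them follows from the bounds on the next
    ones. *)
Fixpoint Creg (n : nat) (f : R -> sfield) : Prop :=
  bounded_per f /\
  match n with
  | O => True
  | S m => forall d, derives d f (Der d f) /\ Creg m (Der d f)
  end.

Definition regular (f : R -> sfield) : Prop := forall n, Creg n f.

Lemma derives_ext d f f' g g' :
  eq_dom f f' -> eq_dom g g' -> derives d f g -> derives d f' g'.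
Proof.
  intros Hf Hg H t x y Ht.
  rewrite <- (Hg t x y Ht).
  apply (is_derive_ext_loc (line d f t x y)); [|apply H, Ht].
  destruct d as [|[|]]; simpl.
  - eapply filter_imp; [|apply dom_open, Ht].
    intros s Hs; apply Hf, Hs.
  - apply filter_forall; intros s; apply Hf, Ht.
  - apply filter_forall; intros s; apply Hf, Ht.
Qed.

Lemma derives_unique d f g : derives d f g -> eq_dom (Der d f) g.
Proof. intros H t x y Ht; apply is_derive_unique, H, Ht. Qed.

Lemma bounded_per_ext f g : eq_dom f g -> bounded_per f -> bounded_per g.
Proof.
  intros H [[B HB] P]; split.
  - exists B; intros t x y Ht; rewrite <- H by assumption; auto.
  - intros t Ht x y; destruct (P t Ht x y).
    rewrite <- !H by assumption; auto.
Qed.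

(** Any family of fields that are the derivatives pointwise can serve in place
    of [Der], which is only determined on the time interval. *)
Lemma Creg_intro n f :
  bounded_per f ->
  (forall d, exists g, derives d f g /\ Creg n g) ->
  Creg (S n) f.
Proof.
  revert f; induction n as [|n IH]; intros f Hb H; split; auto; intros d;
    destruct (H d) as [g [Hd Hg]].
  - assert (E : eq_dom g (Der d f)).
    { intros t x y Ht; symmetry; now apply derives_unique. }
    split; [|split; [|exact I]].
    + eapply derives_ext; [intros ? ? ? ?; reflexivity | exact E | exact Hd].
    + eapply bounded_per_ext; [exact E | apply Hg].
  - assert (E : eq_dom g (Der d f)).
    { intros t x y Ht; symmetry; now apply derives_unique. }
    split.
    + eapply derives_ext; [intros ? ? ? ?; reflexivity | exact E | exact Hd].
    + apply IH.
      * eapply bounded_per_ext; [exact E | apply Hg].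
      * intros d'; exists (Der d' g); destruct Hg as [_ Hg]; destruct (Hg d').
        split; auto.
        eapply derives_ext; [exact E | intros ? ? ? ?; reflexivity | assumption].
Qed.

Lemma Creg_bounded_per n f : Creg n f -> bounded_per f.
Proof. destruct n; intros H; apply H. Qed.

Lemma Creg_pred n f : Creg (S n) f -> Creg n f.
Proof.
  revert f; induction n as [|n IH]; intros f [Hb H]; split; auto.
  intros d; destruct (H d) as [H1 H2]; split; auto.
Qed.

Lemma Creg_ext n f g : eq_dom f g -> Creg n f -> Creg n g.
Proof.
  intros E H; destruct n as [|n].
  - split; [|exact I]; eapply bounded_per_ext; [exact E | apply H].
  - apply Creg_intro.
    + eapply bounded_per_ext; [exact E | apply H].
    + intros d; destruct H as [_ H]; destruct (H d) as [H1 H2].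
      exists (Der d f); split; auto.
      eapply derives_ext; [exact E | intros ? ? ? ?; reflexivity | exact H1].
Qed.

Lemma regular_ext f g : eq_dom f g -> regular f -> regular g.
Proof. intros E H n; eapply Creg_ext; eauto. Qed.

Lemma regular_D d f : regular f -> regular (Der d f).
Proof. intros H n; destruct (H (S n)) as [_ H']; apply H'. Qed.

Lemma regular_derives d f : regular f -> derives d f (Der d f).
Proof. intros H; destruct (H 1%nat) as [_ H']; apply H'. Qed.

Lemma Creg_const n c : Creg n (fun _ _ _ => c).
Proof.
  revert c; induction n as [|n IH]; intros c.
  - split; [split|exact I]; [exists (Rabs c); intros; lra | intros t _ x y; auto].
  - apply Creg_intro.
    + split; [exists (Rabs c); intros; lra | intros t _ x y; auto].
    + intros d; exists (fun _ _ _ => 0); split; auto.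
      intros t x y _; destruct d as [|[|]]; apply @is_derive_const.
Qed.

Lemma Creg_plus n f g : Creg n f -> Creg n g ->
  Creg n (fun t x y => f t x y + g t x y).
Proof.
  revert f g; induction n as [|n IH]; intros f g Hf Hg;
  assert (Hb : bounded_per (fun t x y => f t x y + g t x y)).
  1,3: apply Creg_bounded_per in Hf; apply Creg_bounded_per in Hg;
    destruct Hf as [[B HB] Pf]; destruct Hg as [[B' HB'] Pg];
    (split;
      [exists (B + B'); intros t x y Ht;
       specialize (HB t x y Ht); specialize (HB' t x y Ht);
       pose proof (Rabs_triang (f t x y) (g t x y)); lra
      |intros t Ht x y; destruct (Pf t Ht x y) as [-> ->];
       destruct (Pg t Ht x y) as [-> ->]; auto]).
  - now split.
  - apply Creg_intro; auto.
    intros d; exists (fun t x y => Der d f t x y + Der d g t x y).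
    destruct Hf as [_ Hf]; destruct Hg as [_ Hg].
    destruct (Hf d) as [F1 F2]; destruct (Hg d) as [G1 G2].
    split; [|apply IH; auto].
    intros t x y Ht; specialize (F1 t x y Ht); specialize (G1 t x y Ht).
    destruct d as [|[|]]; exact (is_derive_plus _ _ _ _ _ F1 G1).
Qed.

Lemma Creg_mult n f g : Creg n f -> Creg n g ->
  Creg n (fun t x y => f t x y * g t x y).
Proof.
  revert f g; induction n as [|n IH]; intros f g Hf Hg;
  assert (Hb : bounded_per (fun t x y => f t x y * g t x y)).
  1,3: apply Creg_bounded_per in Hf; apply Creg_bounded_per in Hg;
    destruct Hf as [[B HB] Pf]; destruct Hg as [[B' HB'] Pg];
    (split;
      [exists (B * B'); intros t x y Ht;
       specialize (HB t x y Ht); specialize (HB' t x y Ht);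
       rewrite Rabs_mult; apply Rmult_le_compat; auto using Rabs_pos
      |intros t Ht x y; destruct (Pf t Ht x y) as [-> ->];
       destruct (Pg t Ht x y) as [-> ->]; auto]).
  - now split.
  - apply Creg_intro; auto.
    intros d; exists (fun t x y => Der d f t x y * g t x y + f t x y * Der d g t x y).
    pose proof (Creg_pred _ _ Hf) as Hf'; pose proof (Creg_pred _ _ Hg) as Hg'.
    destruct Hf as [_ Hf]; destruct Hg as [_ Hg].
    destruct (Hf d) as [F1 F2]; destruct (Hg d) as [G1 G2].
    split; [|apply Creg_plus; apply IH; auto].
    intros t x y Ht; specialize (F1 t x y Ht); specialize (G1 t x y Ht).
    destruct d as [|[|]]; exact (is_derive_mult _ _ _ _ _ F1 G1 Rmult_comm).
Qed.

(** The mean value theorem in each variable turns the bounds on the first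
    derivatives into joint continuity, the hypothesis of Schwarz's theorem and
    of differentiation under the integral sign. *)
Lemma Creg_lipschitz f : Creg 1 f -> exists B, 0 <= B /\
  forall t t' x x' y y', dom t -> dom t' ->
    Rabs (f t' x' y' - f t x y) <= B * (Rabs (t' - t) + Rabs (x' - x) + Rabs (y' - y)).
Proof.
  intros [_ H].
  assert (L : forall d, exists B, 0 <= B /\ forall t x y s, dom t ->
     (d = Time -> dom s) ->
     Rabs (line d f t x y s - line d f t x y (coord d t x y))
       <= B * Rabs (s - coord d t x y)).
  { intros d; destruct (H d) as [H1 [[[B HB] _] _]].
    exists (Rmax 0 B); split; [apply Rmax_l|].
    intros t x y s Ht Hs.
    pose (dl := fun s => match d with Time => Der d f s x y
                 | Space ax1 => Der d f t s y | Space ax2 => Der d f t x s end).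
    assert (Hder : forall r, Rmin (coord d t x y) s <= r <= Rmax (coord d t x y) s ->
       is_derive (line d f t x y) r (dl r) /\ Rabs (dl r) <= B).
    { intros r Hr; destruct d as [|[|]]; simpl in *.
      - assert (dom r).
        { specialize (Hs eq_refl); unfold dom in *; revert Hr.
          unfold Rmin, Rmax; destruct (Rle_dec t s); lra. }
        split; [apply (H1 r x y) | apply HB]; auto.
      - split; [apply (H1 t r y) | apply HB]; auto.
      - split; [apply (H1 t x r) | apply HB]; auto. }
    destruct (MVT_gen (line d f t x y) (coord d t x y) s dl) as [c [Hc E]].
    - intros r Hr; apply Hder; lra.
    - intros r Hr; apply derivable_continuous_pt.
      exists (dl r); apply is_derive_Reals, Hder, Hr.
    - rewrite E, Rabs_mult; apply Rmult_le_compat_r; [apply Rabs_pos|].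
      eapply Rle_trans; [apply Hder, Hc | apply Rmax_r]. }
  destruct (L Time) as [B0 [P0 L0]]; destruct (L (Space ax1)) as [B1 [P1 L1]];
  destruct (L (Space ax2)) as [B2 [P2 L2]]; simpl in *.
  exists (B0 + B1 + B2); split; [lra|].
  intros t t' x x' y y' Ht Ht'.
  specialize (L0 t x' y' t' Ht (fun _ => Ht')).
  assert (E1 : Rabs (f t x' y' - f t x y') <= B1 * Rabs (x' - x))
    by (apply (L1 t x y'); auto; discriminate).
  assert (E2 : Rabs (f t x y' - f t x y) <= B2 * Rabs (y' - y))
    by (apply (L2 t x y); auto; discriminate).
  replace (f t' x' y' - f t x y) with
    ((f t' x' y' - f t x' y') + (f t x' y' - f t x y') + (f t x y' - f t x y)) by ring.
  eapply Rle_trans; [apply Rabs_triang|].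
  pose proof (Rabs_triang (f t' x' y' - f t x' y') (f t x' y' - f t x y')).
  pose proof (Rabs_pos (t' - t)); pose proof (Rabs_pos (x' - x));
  pose proof (Rabs_pos (y' - y)); nra.
Qed.

Lemma lipschitz_continuity_2d (g : R -> R -> R) B u v eta :
  0 < eta -> 0 <= B ->
  (forall u' v', Rabs (u' - u) < eta -> Rabs (v' - v) < eta ->
     Rabs (g u' v' - g u v) <= B * (Rabs (u' - u) + Rabs (v' - v))) ->
  continuity_2d_pt g u v.
Proof.
  intros He HB H e.
  assert (P : 0 < Rmin eta (e / (2 * B + 1))).
  { apply Rmin_pos; auto; apply Rdiv_lt_0_compat; [apply cond_pos | lra]. }
  exists (mkposreal _ P); simpl; intros u' v' Hu Hv.
  pose proof (Rmin_l eta (e / (2 * B + 1))); pose proof (Rmin_r eta (e / (2 * B + 1))).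
  eapply Rle_lt_trans; [apply H; lra|].
  set (r := e / (2 * B + 1)) in *.
  assert (Er : r * (2 * B + 1) = e) by (unfold r; field; lra).
  assert (0 < r) by (apply Rdiv_lt_0_compat; [apply cond_pos | lra]).
  pose proof (Rabs_pos (u' - u)); pose proof (Rabs_pos (v' - v)); nra.
Qed.

Lemma dom_nbhd t : dom t -> exists eta : posreal, forall s, Rabs (s - t) < eta -> dom s.
Proof. intros H; destruct (dom_open t H) as [eta He]; exists eta; intros; apply He; auto. Qed.

Lemma Creg_continuity_2d f t x y : Creg 1 f -> dom t ->
  continuity_2d_pt (fun t x => f t x y) t x /\
  continuity_2d_pt (fun t y => f t x y) t y /\
  continuity_2d_pt (fun x y => f t x y) x y.
Proof.
  intros Hf Ht; destruct (Creg_lipschitz f Hf) as [B [HB L]].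
  destruct (dom_nbhd t Ht) as [eta He].
  repeat split; apply (lipschitz_continuity_2d _ B _ _ eta); auto using cond_pos;
    intros a b Ha Hb.
  - pose proof (L t a x b y y Ht (He _ Ha)) as E.
    replace (y - y) with 0 in E by ring; rewrite Rabs_R0, Rplus_0_r in E; exact E.
  - pose proof (L t a x x y b Ht (He _ Ha)) as E.
    replace (x - x) with 0 in E by ring; rewrite Rabs_R0, Rplus_0_r in E; exact E.
  - pose proof (L t t x a y b Ht Ht) as E.
    replace (t - t) with 0 in E by ring; rewrite Rabs_R0, Rplus_0_l in E; exact E.
Qed.

Lemma D_comm d d' f : regular f -> eq_dom (Der d (Der d' f)) (Der d' (Der d f)).
Proof.
  intros Hf.
  assert (Hd : forall e g, regular g -> forall t x y, dom t ->
    ex_derive (line e g t x y) (coord e t x y)).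
  { intros e g Hg t x y Ht; eexists; apply (regular_derives e g Hg); auto. }
  assert (TS : forall i t x y, dom t ->
    Der Time (Der (Space i) f) t x y = Der (Space i) (Der Time f) t x y).
  { intros i t x y Ht.
    destruct (dom_nbhd t Ht) as [eta He].
    destruct i.
    - apply (Schwarz (fun t x => f t x y) t x).
      + exists eta; intros u v Hu Hv; specialize (He u Hu).
        repeat split.
        * exact (Hd Time f Hf u v y He).
        * exact (Hd (Space ax1) f Hf u v y He).
        * exact (Hd Time _ (regular_D (Space ax1) f Hf) u v y He).
        * exact (Hd (Space ax1) _ (regular_D Time f Hf) u v y He).
      + exact (proj1 (Creg_continuity_2d _ t x y
           (regular_D Time _ (regular_D (Space ax1) f Hf) 1%nat) Ht)).
      + exact (proj1 (Creg_continuity_2d _ t x y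
           (regular_D (Space ax1) _ (regular_D Time f Hf) 1%nat) Ht)).
    - apply (Schwarz (fun t y => f t x y) t y).
      + exists eta; intros u v Hu Hv; specialize (He u Hu).
        repeat split.
        * exact (Hd Time f Hf u x v He).
        * exact (Hd (Space ax2) f Hf u x v He).
        * exact (Hd Time _ (regular_D (Space ax2) f Hf) u x v He).
        * exact (Hd (Space ax2) _ (regular_D Time f Hf) u x v He).
      + exact (proj1 (proj2 (Creg_continuity_2d _ t x y
           (regular_D Time _ (regular_D (Space ax2) f Hf) 1%nat) Ht))).
      + exact (proj1 (proj2 (Creg_continuity_2d _ t x y
           (regular_D (Space ax2) _ (regular_D Time f Hf) 1%nat) Ht))). }
  assert (SS : forall t x y, dom t ->
    Der (Space ax1) (Der (Space ax2) f) t x y = Der (Space ax2) (Der (Space ax1) f) t x y).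
  { intros t x y Ht.
    apply (Schwarz (fun x y => f t x y) x y).
    - exists (mkposreal 1 Rlt_0_1); intros u v _ _; repeat split.
      + exact (Hd (Space ax1) f Hf t u v Ht).
      + exact (Hd (Space ax2) f Hf t u v Ht).
      + exact (Hd (Space ax1) _ (regular_D (Space ax2) f Hf) t u v Ht).
      + exact (Hd (Space ax2) _ (regular_D (Space ax1) f Hf) t u v Ht).
    - exact (proj2 (proj2 (Creg_continuity_2d _ t x y
         (regular_D (Space ax1) _ (regular_D (Space ax2) f Hf) 1%nat) Ht))).
    - exact (proj2 (proj2 (Creg_continuity_2d _ t x y
         (regular_D (Space ax2) _ (regular_D (Space ax1) f Hf) 1%nat) Ht))). }
  intros t x y Ht; destruct d as [|i], d' as [|j]; auto.
  - symmetry; auto.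
  - destruct i, j; auto; symmetry; auto.
Qed.

End Regularity.

(** * Averages and periodic antiderivatives *)

Section Integrals.
Variable T : R.
Local Notation dom := (dom T).
Local Notation regular := (regular T).
Local Notation Creg := (Creg T).
Local Notation eq_dom := (eq_dom T).

Lemma line_continuous d f t x y :
  regular f -> dom t -> continuous (line d f t x y) (coord d t x y).
Proof.
  intros Hf Ht; apply @ex_derive_continuous.
  eexists; apply (regular_derives T d f Hf t x y Ht).
Qed.

Lemma space_line_continuous i f t x y s :
  regular f -> dom t -> continuous (line (Space i) f t x y) s.
Proof.
  intros Hf Ht; destruct i.
  - exact (line_continuous (Space ax1) f t s y Hf Ht).
  - exact (line_continuous (Space ax2) f t x s Hf Ht).
Qed.

Lemma space_line_ex_RInt i f t x y a b :
  regular f -> dom t -> ex_RInt (line (Space i) f t x y) a b.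
Proof. intros Hf Ht; apply @ex_RInt_continuous; intros; now apply space_line_continuous. Qed.

Definition integ (i : axis) (c : R) (f : R -> sfield) : R -> sfield :=
  fun t x y => RInt (line (Space i) f t x y) 0 c.

Lemma integ_derives i j c f : regular f -> j <> Space i ->
  derives T j (integ i c f) (integ i c (Der j f)).
Proof.
  intros Hf Hj t x y Ht.
  assert (HL : locally t dom) by now apply dom_open.
  assert (Hc : forall t x y, dom t ->
     continuity_2d_pt (fun t x => Der j f t x y) t x /\
     continuity_2d_pt (fun t y => Der j f t x y) t y /\
     continuity_2d_pt (fun x y => Der j f t x y) x y).
  { intros; apply (Creg_continuity_2d T); auto; apply (regular_D T j f Hf). }
  destruct i, j as [|[|]]; try congruence; clear Hj.
  - apply (is_derive_RInt_param (fun s u => f s u y)).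
    + eapply filter_imp; [|exact HL]; intros s Hs u _.
      eexists; apply (regular_derives T Time f Hf s u y Hs).
    + intros u _; apply (Hc t u y Ht).
    + eapply filter_imp; [|exact HL]; intros s Hs.
      now apply (space_line_ex_RInt ax1 f s x y).
  - apply (is_derive_RInt_param (fun s u => f t u s)).
    + apply filter_forall; intros s u _.
      eexists; apply (regular_derives T (Space ax2) f Hf t u s Ht).
    + intros u _; simpl.
      destruct (Hc t u y Ht) as [_ [_ C]].
      intros e; destruct (C e) as [d Hd]; exists d; intros; apply Hd; auto.
    + apply filter_forall; intros s; now apply (space_line_ex_RInt ax1 f t x s).
  - apply (is_derive_RInt_param (fun s u => f s x u)).
    + eapply filter_imp; [|exact HL]; intros s Hs u _.
      eexists; apply (regular_derives T Time f Hf s x u Hs).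
    + intros u _; apply (Hc t x u Ht).
    + eapply filter_imp; [|exact HL]; intros s Hs.
      now apply (space_line_ex_RInt ax2 f s x y).
  - apply (is_derive_RInt_param (fun s u => f t s u)).
    + apply filter_forall; intros s u _.
      eexists; apply (regular_derives T (Space ax1) f Hf t s u Ht).
    + intros u _; apply (Hc t x u Ht).
    + apply filter_forall; intros s; now apply (space_line_ex_RInt ax2 f t s y).
Qed.

Lemma integ_bound i c f B t x y : regular f -> dom t -> 0 <= c <= 1 ->
  (forall x y, Rabs (f t x y) <= B) -> Rabs (integ i c f t x y) <= B.
Proof.
  intros Hf Ht Hc HB.
  assert (0 <= B) by (eapply Rle_trans; [apply Rabs_pos | apply (HB 0 0)]).
  eapply Rle_trans.
  - apply abs_RInt_le_const with (M := B); [lra | now apply space_line_ex_RInt |].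
    intros s _; destruct i; apply HB.
  - nra.
Qed.

Lemma integ_across i c f t x y : regular f -> dom t -> 
  (match i with
   | ax1 => integ i c f t x (y + 1) = integ i c f t x y
   | ax2 => integ i c f t (x + 1) y = integ i c f t x y end).
Proof.
  intros Hf Ht; destruct (Hf 0%nat) as [[_ P] _].
  destruct i; apply RInt_ext; intros s _; simpl; apply (P t Ht).
Qed.

Lemma average_Creg n i f : regular f -> Creg n (integ i 1 f).
Proof.
  revert f; induction n as [|n IH]; intros f Hf.
  all: assert (Hb : bounded_per T (integ i 1 f)).
  1,3: split;
    [ destruct (Hf 0%nat) as [[[B HB] P] _]; exists B; intros t x y Ht;
      apply integ_bound; auto; lra
    | intros t Ht x y; pose proof (integ_across i 1 f t x y Hf Ht);
      destruct i; split; auto ].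
  - split; auto; exact I.
  - apply Creg_intro; auto; intros d.
    destruct d as [|j].
    + exists (integ i 1 (Der Time f)); split; [apply integ_derives; auto; discriminate|].
      apply IH; now apply regular_D.
    + assert (Hj : {j = i} + {j <> i}) by (destruct i, j; auto; right; discriminate).
      destruct Hj as [->|Hj].
      * exists (fun _ _ _ => 0); split; [|apply Creg_const].
        intros t x y Ht; destruct i.
        -- exact (is_derive_const (integ ax1 1 f t x y) x).
        -- exact (is_derive_const (integ ax2 1 f t x y) y).
      * exists (integ i 1 (Der (Space j) f)); split.
        -- apply integ_derives; auto; congruence.
        -- apply IH; now apply regular_D.
Qed.

(** Subtracting the linear function with slope the average over one period
    makes the antiderivative periodic. *)
Definition primitive (i : axis) (f : R -> sfield) : R -> sfield :=
  fun t x y => RInt (line (Space i) f t x y) 0 (coord (Space i) t x y)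
               - coord (Space i) t x y * integ i 1 f t x y.

Lemma RInt_derive_upper (g : R -> R) c :
  (forall s, continuous g s) -> is_derive (fun b => RInt g 0 b) c (g c).
Proof.
  intros Hg; apply (is_derive_RInt g (fun b => RInt g 0 b) 0 c).
  - apply filter_forall; intros b; apply @RInt_correct, @ex_RInt_continuous; auto.
  - auto.
Qed.

Lemma RInt_period (g : R -> R) c :
  (forall s, continuous g s) -> (forall s, g (s + 1) = g s) ->
  RInt g 0 (c + 1) = RInt g 0 c + RInt g 0 1.
Proof.
  intros Hg Hp.
  assert (Hz : forall a b, a < b ->
     RInt g 0 (a + 1) - RInt g 0 a = RInt g 0 (b + 1) - RInt g 0 b).
  { intros a b Hab.
    apply (eq_is_derive (fun c => RInt g 0 (c + 1) - RInt g 0 c) a b); auto.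
    intros t _.
    assert (H1 : is_derive (fun c => RInt g 0 (c + 1)) t (1 * g (t + 1))).
    { apply (is_derive_comp (fun b => RInt g 0 b) (fun c => c + 1)).
      - now apply RInt_derive_upper.
      - auto_derive; auto. }
    pose proof (is_derive_minus _ _ _ _ _ H1 (RInt_derive_upper g t Hg)) as H2.
    rewrite Hp, Rmult_1_l, minus_eq_zero in H2; exact H2. }
  assert (E : RInt g 0 (c + 1) - RInt g 0 c = RInt g 0 (0 + 1) - RInt g 0 0).
  { destruct (Rtotal_order c 0) as [H|[->|H]]; auto.
    symmetry; auto. }
  rewrite RInt_point, Rplus_0_l in E; unfold zero in E; simpl in E; lra.
Qed.

Lemma periodic_representative (x : R) :
  exists r, 0 <= r <= 1 /\
    forall g : R -> R, (forall s, g (s + 1) = g s) -> g x = g r.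
Proof.
  exists (x - IZR (Int_part x)).
  destruct (base_Int_part x) as [H1 H2]; split; [lra|].
  intros g Hg.
  assert (N : forall n z, g (z + INR n) = g z).
  { induction n as [|n IH]; intros z; [now rewrite Rplus_0_r|].
    now rewrite S_INR, <- Rplus_assoc, Hg. }
  assert (Z : forall k z, g (z - IZR k) = g z).
  { intros k z; destruct (Z_le_gt_dec 0 k) as [Hk|Hk].
    - rewrite <- (N (Z.to_nat k) (z - IZR k)).
      rewrite INR_IZR_INZ, Znat.Z2Nat.id by auto; f_equal; ring.
    - rewrite <- (N (Z.to_nat (- k)) z).
      rewrite INR_IZR_INZ, Znat.Z2Nat.id, opp_IZR by lia; f_equal; ring. }
  symmetry; apply Z.
Qed.

Lemma primitive_per i f t : regular f -> dom t -> periodic (primitive i f t).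
Proof.
  intros Hf Ht x y; destruct (Hf 0%nat) as [[_ P] _]; specialize (P t Ht).
  unfold primitive; destruct i; simpl.
  - split.
    + change (integ ax1 1 f t (x + 1) y) with (integ ax1 1 f t x y).
      rewrite RInt_period.
      * unfold integ; simpl; ring.
      * intros s; apply (space_line_continuous ax1 f t x y); auto.
      * intros s; apply P.
    + rewrite (integ_across ax1 1 f t x y) by auto; f_equal.
      exact (integ_across ax1 x f t x y Hf Ht).
  - split.
    + rewrite (integ_across ax2 1 f t x y) by auto; f_equal.
      exact (integ_across ax2 y f t x y Hf Ht).
    + change (integ ax2 1 f t x (y + 1)) with (integ ax2 1 f t x y).
      rewrite RInt_period.
      * unfold integ; simpl; ring.
      * intros s; apply (space_line_continuous ax2 f t x y); auto.
      * intros s; apply P.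
Qed.

Lemma primitive_bounded_per i f : regular f -> bounded_per T (primitive i f).
Proof.
  intros Hf; split; [|intros; now apply primitive_per].
  destruct (Hf 0%nat) as [[[B HB] P] _].
  exists (2 * B); intros t x y Ht.
  assert (HB' : forall x y, Rabs (f t x y) <= B) by (intros; auto).
  assert (H1 : forall x y, 0 <= coord (Space i) t x y <= 1 ->
     Rabs (primitive i f t x y) <= 2 * B).
  { intros x' y' Hc; unfold primitive.
    assert (I1 : Rabs (integ i (coord (Space i) t x' y') f t x' y') <= B)
      by (apply integ_bound; auto).
    assert (I2 : Rabs (integ i 1 f t x' y') <= B) by (apply integ_bound; auto; lra).
    unfold integ at 1 in I1.
    set (c := coord (Space i) t x' y') in *.
    set (a := RInt _ 0 c) in *; set (b := integ i 1 f t x' y') in *.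
    apply Rabs_le_between in I1; apply Rabs_le_between in I2.
    apply Rabs_le_between; nra. }
  destruct i.
  - destruct (periodic_representative x) as [r [Hr E]].
    rewrite (E (fun x => primitive ax1 f t x y)); [now apply H1|].
    intros s; now apply primitive_per.
  - destruct (periodic_representative y) as [r [Hr E]].
    rewrite (E (fun y => primitive ax2 f t x y)); [now apply H1|].
    intros s; now apply primitive_per.
Qed.

Lemma primitive_derives_along i f : regular f ->
  derives T (Space i) (primitive i f) (fun t x y => f t x y - integ i 1 f t x y).
Proof.
  intros Hf t x y Ht; destruct i.
  - assert (H1 := RInt_derive_upper (line (Space ax1) f t x y) x
      (fun s => space_line_continuous ax1 f t x y s Hf Ht)).
    assert (H2 : is_derive (fun s => s * integ ax1 1 f t x y) x (integ ax1 1 f t x y))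
      by (auto_derive; auto; ring).
    exact (is_derive_minus _ _ _ _ _ H1 H2).
  - assert (H1 := RInt_derive_upper (line (Space ax2) f t x y) y
      (fun s => space_line_continuous ax2 f t x y s Hf Ht)).
    assert (H2 : is_derive (fun s => s * integ ax2 1 f t x y) y (integ ax2 1 f t x y))
      by (auto_derive; auto; ring).
    exact (is_derive_minus _ _ _ _ _ H1 H2).
Qed.

Lemma primitive_derives_across i j f : regular f -> j <> Space i ->
  derives T j (primitive i f) (primitive i (Der j f)).
Proof.
  intros Hf Hj t x y Ht.
  pose proof (integ_derives i j (coord (Space i) t x y) f Hf Hj t x y Ht) as H1.
  pose proof (integ_derives i j 1 f Hf Hj t x y Ht) as H2.
  apply (is_derive_scal _ _ (coord (Space i) t x y)) in H2.
  pose proof (is_derive_minus _ _ _ _ _ H1 H2) as H3.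
  destruct i, j as [|[|]]; try congruence; exact H3.
Qed.

Lemma primitive_Creg n i f : regular f -> Creg n (primitive i f).
Proof.
  revert f; induction n as [|n IH]; intros f Hf;
    pose proof (primitive_bounded_per i f Hf) as Hb.
  - split; auto; exact I.
  - apply Creg_intro; auto; intros d.
    assert (Hd : {d = Space i} + {d <> Space i})
      by (destruct d as [|[|]], i; auto; right; discriminate).
    destruct Hd as [->|Hd].
    + eexists; split; [now apply primitive_derives_along|].
      apply (Creg_ext T n (fun t x y => f t x y + (fun _ _ _ => -1) t x y * integ i 1 f t x y)).
      * intros t x y _; ring.
      * apply Creg_plus; [apply Hf|]; apply Creg_mult;
          [apply Creg_const | now apply average_Creg].
    + exists (primitive i (Der d f)); split; [now apply primitive_derives_across|].
      apply IH; now apply regular_D.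
Qed.

End Integrals.

(** * The algebra of evolutions *)

(** Regular fields on the open time interval.  Fixing the value zero at all
    other times makes two fields that agree on the interval equal in the sense
    of Leibniz, so that the rules of calculus become rewriting rules without
    side conditions. *)
Record evol (T : R) := mkEvol {
  val :> R -> sfield;
  val_regular : regular T val;
  val_out : forall t x y, ~ dom T t -> val t x y = 0
}.
Arguments val {T} _ _ _ _.

Declare Scope evol_scope.
Delimit Scope evol_scope with e.
Bind Scope evol_scope with evol.

Section Evolutions.
Variable T : R.
Local Notation dom := (dom T).

Lemma evol_eq (f g : evol T) :
  (forall t x y, dom t -> f t x y = g t x y) -> f = g.
Proof.
  intros H.
  destruct f as [f Hf Of], g as [g Hg Og]; simpl in *.
  assert (f = g).
  { apply functional_extensionality; intros t.
    apply functional_extensionality; intros x.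
    apply functional_extensionality; intros y.
    destruct (dom_dec T t) as [Ht|Ht]; auto.
    now rewrite Of, Og. }
  subst g; f_equal; apply proof_irrelevance.
Qed.

Definition clip (f : R -> sfield) : R -> sfield :=
  fun t x y => if dom_dec T t then f t x y else 0.

Lemma clip_in f : eq_dom T f (clip f).
Proof. intros t x y Ht; unfold clip; destruct (dom_dec T t); tauto. Qed.

Definition restrict (f : R -> sfield) (H : regular T f) : evol T.
Proof.
  refine (mkEvol T (clip f) (regular_ext T _ _ (clip_in f) H) _).
  intros t x y Ht; unfold clip; destruct (dom_dec T t); tauto.
Defined.

Lemma restrictE f H t x y : dom t -> restrict f H t x y = f t x y.
Proof. intros; symmetry; now apply clip_in. Qed.

Lemma val_Creg (f : evol T) n : Creg T n f.
Proof. apply val_regular. Qed.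
Hint Resolve val_Creg val_regular : core.

Definition ecst (c : R) : evol T :=
  restrict (fun _ _ _ => c) (fun n => Creg_const T n c).
Definition eadd (f g : evol T) : evol T.
Proof.
  refine (mkEvol T (fun t x y => f t x y + g t x y) _ _).
  - intros n; apply Creg_plus; auto.
  - intros; rewrite !val_out by auto; ring.
Defined.
Definition emul (f g : evol T) : evol T.
Proof.
  refine (mkEvol T (fun t x y => f t x y * g t x y) _ _).
  - intros n; apply Creg_mult; auto.
  - intros; rewrite !val_out by auto; ring.
Defined.

Definition dd (d : direction) (f : evol T) : evol T :=
  restrict (Der d f) (regular_D T d f (val_regular T f)).
Definition avg (i : axis) (f : evol T) : evol T :=
  restrict (integ i 1 f) (fun n => average_Creg T n i f (val_regular T f)).
Definition prim (i : axis) (f : evol T) : evol T :=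
  restrict (primitive i f) (fun n => primitive_Creg T n i f (val_regular T f)).

Definition eopp (f : evol T) : evol T := emul (ecst (-1)) f.
Definition esub (f g : evol T) : evol T := eadd f (eopp g).

Lemma ecstE c t x y : dom t -> ecst c t x y = c.
Proof. intros; now apply restrictE. Qed.
Lemma eaddE f g t x y : eadd f g t x y = f t x y + g t x y.
Proof. reflexivity. Qed.
Lemma emulE f g t x y : emul f g t x y = f t x y * g t x y.
Proof. reflexivity. Qed.
Lemma eoppE f t x y : eopp f t x y = - f t x y.
Proof.
  unfold eopp; rewrite emulE; destruct (dom_dec T t) as [H|H].
  - rewrite ecstE by auto; ring.
  - rewrite !(val_out T _ _ _ _ H); ring.
Qed.
Lemma esubE f g t x y : esub f g t x y = f t x y - g t x y.
Proof. unfold esub; rewrite eaddE, eoppE; ring. Qed.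

Lemma dd_derives d (f : evol T) : derives T d f (dd d f).
Proof.
  intros t x y Ht; unfold dd; rewrite restrictE by auto.
  apply (regular_derives T d f); auto.
Qed.

Lemma dd_unique d (f g : evol T) : derives T d f g -> dd d f = g.
Proof.
  intros H; apply evol_eq; intros t x y Ht; unfold dd; rewrite restrictE by auto.
  now apply (derives_unique T).
Qed.

Lemma dd_cst d c : dd d (ecst c) = ecst 0.
Proof.
  apply dd_unique.
  eapply derives_ext with (f := fun _ _ _ => c) (g := fun _ _ _ => 0).
  - intros t x y Ht; now rewrite ecstE.
  - intros t x y Ht; now rewrite ecstE.
  - intros t x y _; destruct d as [|[|]]; apply @is_derive_const.
Qed.

Lemma dd_add d f g : dd d (eadd f g) = eadd (dd d f) (dd d g).
Proof.
  apply dd_unique; intros t x y Ht.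
  pose proof (is_derive_plus _ _ _ _ _ (dd_derives d f t x y Ht) (dd_derives d g t x y Ht)).
  destruct d as [|[|]]; exact H.
Qed.

Lemma dd_mul d f g : dd d (emul f g) = eadd (emul (dd d f) g) (emul f (dd d g)).
Proof.
  apply dd_unique; intros t x y Ht.
  pose proof (is_derive_mult _ _ _ _ _ (dd_derives d f t x y Ht)
     (dd_derives d g t x y Ht) Rmult_comm).
  destruct d as [|[|]]; exact H.
Qed.

Lemma dd_opp d f : dd d (eopp f) = eopp (dd d f).
Proof.
  unfold eopp; rewrite dd_mul, dd_cst; apply evol_eq; intros.
  rewrite !eaddE, !emulE, !ecstE by auto; ring.
Qed.

Lemma dd_sub d f g : dd d (esub f g) = esub (dd d f) (dd d g).
Proof. unfold esub; now rewrite dd_add, dd_opp. Qed.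

Lemma Der_dd d (f : evol T) : eq_dom T (Der d f) (dd d f).
Proof. intros t x y Ht; unfold dd; now rewrite restrictE. Qed.

Lemma Der_ext d f g : regular T f -> eq_dom T f g -> eq_dom T (Der d f) (Der d g).
Proof.
  intros Hf E t x y Ht; symmetry; apply (derives_unique T); auto.
  apply (derives_ext T d f g (Der d f) (Der d f)); auto.
  - intros ? ? ? ?; reflexivity.
  - now apply regular_derives.
Qed.

Lemma dd_comm d d' f : dd d (dd d' f) = dd d' (dd d f).
Proof.
  apply evol_eq; intros t x y Ht; rewrite <- !Der_dd by auto.
  rewrite <- (Der_ext d (Der d' f) (dd d' f)) by auto using regular_D, Der_dd.
  rewrite <- (Der_ext d' (Der d f) (dd d f)) by auto using regular_D, Der_dd.
  apply (D_comm T); auto.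
Qed.

Lemma avgE i f t x y : dom t -> avg i f t x y = integ i 1 f t x y.
Proof. apply restrictE. Qed.

Lemma avg_line i f t x y s :
  line (Space i) (avg i f) t x y s = avg i f t x y.
Proof.
  destruct (dom_dec T t) as [H|H].
  - destruct i; cbn [line]; rewrite !avgE by auto; reflexivity.
  - destruct i; cbn [line]; now rewrite !val_out.
Qed.

Lemma integ_ext i c f g t x y : eq_dom T f g -> dom t -> 
  integ i c f t x y = integ i c g t x y.
Proof. intros H Ht; apply RInt_ext; intros s _; destruct i; apply H, Ht. Qed.

Lemma dd_avg_across i j f : j <> Space i -> dd j (avg i f) = avg i (dd j f).
Proof.
  intros Hj; apply dd_unique.
  eapply derives_ext; [apply clip_in | | apply integ_derives; auto].
  intros t x y Ht; rewrite avgE by auto; apply integ_ext; auto using Der_dd.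
Qed.

Lemma ex_RInt_line (f : evol T) i t x y a b : dom t -> ex_RInt (line (Space i) f t x y) a b.
Proof. intros; apply (space_line_ex_RInt T); auto. Qed.

Lemma avg_dd_along i f : avg i (dd (Space i) f) = ecst 0.
Proof.
  apply evol_eq; intros t x y Ht; rewrite avgE, ecstE by auto.
  assert (E : integ i 1 (dd (Space i) f) t x y
      = line (Space i) f t x y 1 - line (Space i) f t x y 0).
  { apply is_RInt_unique.
    apply (is_RInt_derive (line (Space i) f t x y)
             (line (Space i) (dd (Space i) f) t x y)).
    - intros s _; destruct i.
      + apply (dd_derives (Space ax1) f t s y Ht).
      + apply (dd_derives (Space ax2) f t x s Ht).
    - intros s _; apply (space_line_continuous T); auto. }
  rewrite E; destruct (val_Creg f 0) as [[_ P] _]; specialize (P t Ht).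
  destruct i; cbn [line].
  - destruct (P 0 y) as [P1 _]; rewrite Rplus_0_l in P1; rewrite P1; ring.
  - destruct (P x 0) as [_ P1]; rewrite Rplus_0_l in P1; rewrite P1; ring.
Qed.

Lemma avg_add i f g : avg i (eadd f g) = eadd (avg i f) (avg i g).
Proof.
  apply evol_eq; intros t x y Ht; rewrite eaddE, !avgE by auto.
  etransitivity; [|apply (@RInt_plus R_CompleteNormedModule); now apply ex_RInt_line].
  apply RInt_ext; intros s _; destruct i; reflexivity.
Qed.

Lemma avg_pull i (c f : evol T) :
  (forall t x y s, dom t -> line (Space i) c t x y s = c t x y) ->
  avg i (emul c f) = emul c (avg i f).
Proof.
  intros H; apply evol_eq; intros t x y Ht; rewrite emulE, !avgE by auto.
  etransitivity; [|apply (@RInt_scal R_CompleteNormedModule); now apply ex_RInt_line].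
  apply RInt_ext; intros s _; specialize (H t x y s Ht).
  destruct i; cbn [line] in *; rewrite emulE, H; reflexivity.
Qed.

Lemma avg_cst_mul i c f : avg i (emul (ecst c) f) = emul (ecst c) (avg i f).
Proof. apply avg_pull; intros; destruct i; cbn [line]; now rewrite !ecstE. Qed.

Lemma avg_avg_mul i g f : avg i (emul (avg i g) f) = emul (avg i g) (avg i f).
Proof. apply avg_pull; intros; apply avg_line. Qed.

Lemma avg_cst i c : avg i (ecst c) = ecst c.
Proof.
  apply evol_eq; intros t x y Ht; rewrite avgE, ecstE by auto.
  transitivity (RInt (fun _ => c) 0 1).
  - apply RInt_ext; intros s _; destruct i; cbn [line]; now rewrite ecstE.
  - rewrite RInt_const; unfold scal; simpl; unfold mult; simpl; ring.
Qed.

Lemma avg_invariant i (f : evol T) :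
  (forall t x y s, dom t -> line (Space i) f t x y s = f t x y) -> avg i f = f.
Proof.
  intros H; replace f with (emul f (ecst 1)) at 1.
  - rewrite avg_pull, avg_cst by auto; apply evol_eq; intros.
    rewrite emulE, ecstE by auto; ring.
  - apply evol_eq; intros; rewrite emulE, ecstE by auto; ring.
Qed.

Lemma prim_along i f : dd (Space i) (prim i f) = esub f (avg i f).
Proof.
  apply dd_unique.
  eapply derives_ext; [apply clip_in | | apply primitive_derives_along; auto].
  intros t x y Ht; rewrite esubE, avgE; auto.
Qed.

Lemma avg_opp i f : avg i (eopp f) = eopp (avg i f).
Proof. apply avg_cst_mul. Qed.

Lemma avg_sub i f g : avg i (esub f g) = esub (avg i f) (avg i g).
Proof. unfold esub; now rewrite avg_add, avg_opp. Qed.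

(** Fubini's theorem for iterated averages.  Since [f - avg ax1 f] is an
    [x1]-derivative, its iterated average vanishes, and [avg ax2 (avg ax1 f)]
    does not depend on [x1]. *)
Lemma avg_comm f : avg ax1 (avg ax2 f) = avg ax2 (avg ax1 f).
Proof.
  assert (E : avg ax1 (avg ax2 (esub f (avg ax1 f))) = ecst 0).
  { rewrite <- prim_along, <- dd_avg_across, avg_dd_along by discriminate; auto. }
  rewrite !avg_sub in E.
  rewrite (avg_invariant ax1 (avg ax2 (avg ax1 f))) in E.
  - apply evol_eq; intros t x y Ht.
    apply (f_equal (fun g => val g t x y)) in E.
    rewrite esubE, ecstE in E by auto; lra.
  - intros t x y s Ht; cbn [line]; rewrite !avgE by auto.
    apply RInt_ext; intros u _; apply (avg_line ax1 f t x u).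
Qed.

Lemma avg_mono i (f g : evol T) t x y : dom t ->
  (forall x y, f t x y <= g t x y) -> avg i f t x y <= avg i g t x y.
Proof.
  intros Ht H; rewrite !avgE by auto.
  apply RInt_le; [lra | now apply ex_RInt_line .. | intros s _; destruct i; apply H].
Qed.

Definition Int (f : evol T) (t : R) : R := avg ax1 (avg ax2 f) t 0 0.

Lemma Int_const_field f t x y : avg ax1 (avg ax2 f) t x y = Int f t.
Proof.
  unfold Int.
  transitivity (avg ax1 (avg ax2 f) t 0 y); [symmetry; exact (avg_line ax1 _ t x y 0)|].
  rewrite avg_comm; symmetry; exact (avg_line ax2 _ t 0 y 0).
Qed.

Lemma Int_int_T2 f t : dom t -> Int f t = int_T2 (f t).
Proof.
  intros Ht; unfold Int; rewrite avgE by auto; apply RInt_ext; intros s _.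
  cbn [line]; rewrite avgE by auto; reflexivity.
Qed.

Lemma Int_add f g t : Int (eadd f g) t = Int f t + Int g t.
Proof. unfold Int; now rewrite !avg_add. Qed.

Lemma Int_cst_mul c f t : Int (emul (ecst c) f) t = c * Int f t.
Proof.
  unfold Int; rewrite !avg_cst_mul, emulE.
  destruct (dom_dec T t); [now rewrite ecstE | rewrite !val_out by auto; ring].
Qed.

Lemma Int_opp f t : Int (eopp f) t = - Int f t.
Proof. unfold eopp; rewrite Int_cst_mul; ring. Qed.

Lemma Int_sub f g t : Int (esub f g) t = Int f t - Int g t.
Proof. unfold esub; rewrite Int_add, Int_opp; ring. Qed.

Lemma Int_cst c t : dom t -> Int (ecst c) t = c.
Proof. intros; unfold Int; rewrite !avg_cst, ecstE; auto. Qed.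

Lemma Int_mono (f g : evol T) t : dom t ->
  (forall x y, f t x y <= g t x y) -> Int f t <= Int g t.
Proof.
  intros Ht H; unfold Int; apply avg_mono; [exact Ht|].
  intros x y; apply avg_mono; [exact Ht | exact H].
Qed.

Lemma Int_nonneg (f : evol T) t : dom t -> (forall x y, 0 <= f t x y) -> 0 <= Int f t.
Proof.
  intros Ht H; rewrite <- (Int_cst 0 t Ht); apply Int_mono; auto.
  intros; rewrite ecstE; auto.
Qed.

Lemma Int_dd_space i f t : dom t -> Int (dd (Space i) f) t = 0.
Proof.
  intros Ht; unfold Int; destruct i.
  - rewrite <- dd_avg_across, avg_dd_along, ecstE by (auto; discriminate); auto.
  - rewrite avg_dd_along, avg_cst, ecstE; auto.
Qed.

Lemma Int_derive f t : dom t -> is_derive (Int f) t (Int (dd Time f) t).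
Proof.
  intros Ht; unfold Int at 2.
  rewrite <- !dd_avg_across by discriminate.
  apply (dd_derives Time (avg ax1 (avg ax2 f)) t 0 0 Ht).
Qed.

End Evolutions.

Arguments ecst {T}. Arguments eadd {T}. Arguments emul {T}. Arguments eopp {T}.
Arguments esub {T}. Arguments dd {T}. Arguments avg {T}. Arguments prim {T}.
Arguments Int {T}. Arguments restrict {T}.
#[global] Opaque ecst eadd emul eopp esub dd avg prim Int restrict.
Notation "f + g" := (eadd f g) : evol_scope.
Notation "f - g" := (esub f g) : evol_scope.
Notation "f * g" := (emul f g) : evol_scope.
Notation "- f" := (eopp f) : evol_scope.
Notation "c *: f" := (emul (ecst c%R) f) (at level 40, left associativity) : evol_scope.
Notation dx i f := (dd (Space i) f).
(** The square of the norm. *)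
Notation L2 f := (Int (emul f f)).

Ltac evE := rewrite ?esubE, ?eaddE, ?emulE, ?eoppE; repeat rewrite ?esubE, ?eaddE, ?emulE, ?eoppE;
  rewrite ?ecstE by assumption.
Ltac IntE := repeat rewrite ?Int_sub, ?Int_add, ?Int_cst_mul, ?Int_opp;
  rewrite ?Int_cst by assumption.

(** * Sobolev inequalities on the torus *)

Section Inequalities.
Variable T : R.
Local Notation dom := (dom T).

Lemma increment_le_RInt (g dg m : R -> R) a b :
  (forall s, is_derive g s (dg s)) -> (forall s, Rabs (dg s) <= m s) ->
  (forall s, continuous m s) -> 0 <= a <= b -> b <= 1 ->
  Rabs (g b - g a) <= RInt m 0 1.
Proof.
  intros Hg Hm Cm Hab Hb.
  pose (M := fun s => RInt m 0 s).
  assert (HM : forall s, is_derive M s (m s)) by (intros; now apply RInt_derive_upper).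
  assert (incr : forall h dh, (forall s, is_derive h s (dh s)) -> (forall s, 0 <= dh s) ->
     forall r s, r <= s -> h r <= h s).
  { intros h dh H1 H2 r s Hrs.
    destruct (MVT_gen h r s dh) as [c [_ E]].
    - intros; apply H1.
    - intros; apply derivable_continuous_pt; exists (dh x); apply is_derive_Reals, H1.
    - assert (0 <= dh c * (s - r)) by (apply Rmult_le_pos; [auto | lra]); lra. }
  assert (M0 : M 0 = 0) by apply @RInt_point.
  assert (MM : forall r s, r <= s -> M r <= M s).
  { apply (incr M m); auto; intros s; eapply Rle_trans; [apply Rabs_pos | apply Hm]. }
  assert (I1 : M a - g a <= M b - g b).
  { apply (incr (fun s => M s - g s) (fun s => m s - dg s)); [| |lra].
    - intros s; exact (is_derive_minus _ _ _ _ _ (HM s) (Hg s)).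
    - intros s; specialize (Hm s); apply Rabs_le_between in Hm; lra. }
  assert (I2 : M a + g a <= M b + g b).
  { apply (incr (fun s => M s + g s) (fun s => m s + dg s)); [| |lra].
    - intros s; exact (is_derive_plus _ _ _ _ _ (HM s) (Hg s)).
    - intros s; specialize (Hm s); apply Rabs_le_between in Hm; lra. }
  pose proof (MM 0 a (proj1 Hab)); pose proof (MM b 1 Hb).
  change (RInt m 0 1) with (M 1); apply Rabs_le_between; lra.
Qed.

(** On a circle of length one, a function differs from any of its values by at
    most the integral of the modulus of its derivative; averaging over the
    comparison point gives the claim.  Majorants [n] and [m] replace the moduli,
    which are not differentiable. *)
Lemma abs_le_avg i (G n m : evol T) t : dom t ->
  (forall x y, Rabs (G t x y) <= n t x y) ->
  (forall x y, Rabs (dx i G t x y) <= m t x y) ->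
  forall x y, Rabs (G t x y) <= avg i (n + m)%e t x y.
Proof.
  intros Ht Hn Hm.
  assert (Hosc : forall x y a b, 0 <= a <= 1 -> 0 <= b <= 1 ->
     Rabs (line (Space i) G t x y b - line (Space i) G t x y a) <= avg i m t x y).
  { intros x y a b Ha Hb; rewrite avgE by auto.
    assert (W : forall a b, 0 <= a <= b -> b <= 1 ->
      Rabs (line (Space i) G t x y b - line (Space i) G t x y a) <= integ i 1 m t x y).
    { intros a' b' Hab Hb'.
      apply (increment_le_RInt _ (line (Space i) (dx i G) t x y)); auto.
      - intros s; destruct i.
        + apply (dd_derives T (Space ax1) G t s y Ht).
        + apply (dd_derives T (Space ax2) G t x s Ht).
      - intros s; destruct i; apply Hm.
      - intros s; apply (space_line_continuous T); auto; apply val_regular. }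
    destruct (Rle_dec a b); [apply W; lra | rewrite Rabs_minus_sym; apply W; lra]. }
  assert (Hin : forall x y r, 0 <= r <= 1 ->
     Rabs (line (Space i) G t x y r) <= avg i (n + m)%e t x y).
  { intros x y r Hr.
    rewrite avg_add; evE; rewrite (avgE T i n) by auto.
    set (M := avg i m t x y).
    apply Rle_trans with (RInt (fun _ => Rabs (line (Space i) G t x y r) - M) 0 1 + M).
    - rewrite RInt_const; unfold scal; simpl; unfold mult; simpl; lra.
    - apply Rplus_le_compat_r, RInt_le; [lra | apply ex_RInt_const | now apply ex_RInt_line |].
      intros s Hs; specialize (Hosc x y s r ltac:(lra) Hr).
      assert (Rabs (line (Space i) G t x y s) <= line (Space i) n t x y s)
        by (destruct i; apply Hn).
      pose proof (Rabs_triang (line (Space i) G t x y r - line (Space i) G t x y s)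
        (line (Space i) G t x y s)).
      replace (line (Space i) G t x y r - line (Space i) G t x y s
        + line (Space i) G t x y s) with (line (Space i) G t x y r) in H0 by ring.
      unfold M; lra. }
  intros x y.
  destruct (val_Creg T G 0) as [[_ P] _]; specialize (P t Ht).
  destruct i.
  - destruct (periodic_representative x) as [r [Hr E]].
    rewrite (E (fun x => G t x y)) by (intros s; apply P).
    exact (Hin x y r Hr).
  - destruct (periodic_representative y) as [r [Hr E]].
    rewrite (E (fun y => G t x y)) by (intros s; apply P).
    exact (Hin x y r Hr).
Qed.

(** The left factor does not depend on [x1] and the right one not on [x2]. *)
Lemma Int_avg_mul_avg (P Q : evol T) t : Int (avg ax1 P * avg ax2 Q)%e t = Int P t * Int Q t.
Proof.
  assert (C : forall f g : evol T, (f * g = g * f)%e)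
    by (intros; apply evol_eq; intros; evE; ring).
  rewrite <- (Int_const_field T (_ * _)%e t 0 0).
  rewrite <- (Int_const_field T P t 0 0), <- (Int_const_field T Q t 0 0).
  rewrite (C (avg ax1 P)), avg_avg_mul, <- avg_comm, C, avg_avg_mul; evE; ring.
Qed.

(** The embedding of W^{1,1} into L^2 in dimension two, by Gagliardo's argument:
    one factor [|G|] is bounded by an average in [x1], the other by an average
    in [x2], and the integral of the product factorises. *)
Lemma L2_le_majorants (G n m1 m2 : evol T) t : dom t ->
  (forall x y, Rabs (G t x y) <= n t x y) ->
  (forall x y, Rabs (dx ax1 G t x y) <= m1 t x y) ->
  (forall x y, Rabs (dx ax2 G t x y) <= m2 t x y) ->
  L2 G t <= Int (n + m1)%e t * Int (n + m2)%e t.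
Proof.
  intros Ht Hn H1 H2; rewrite <- Int_avg_mul_avg; apply Int_mono; auto.
  intros x y; evE.
  pose proof (abs_le_avg ax1 G n m1 t Ht Hn H1 x y).
  pose proof (abs_le_avg ax2 G n m2 t Ht Hn H2 x y).
  rewrite <- (Rabs_right (G t x y * G t x y)) by nra.
  rewrite Rabs_mult; apply Rmult_le_compat; auto using Rabs_pos.
Qed.

(** The embedding of functions with integrable mixed second derivative into the
    bounded functions: [abs_le_avg] in [x2] for [G] and for its [x1]-derivative,
    then in [x1]. *)
Lemma abs_le_majorants (G n m1 m2 m12 : evol T) t : dom t ->
  (forall x y, Rabs (G t x y) <= n t x y) ->
  (forall x y, Rabs (dx ax1 G t x y) <= m1 t x y) ->
  (forall x y, Rabs (dx ax2 G t x y) <= m2 t x y) ->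
  (forall x y, Rabs (dx ax2 (dx ax1 G) t x y) <= m12 t x y) ->
  forall x y, Rabs (G t x y) <= Int n t + Int m1 t + Int m2 t + Int m12 t.
Proof.
  intros Ht Hn H1 H2 H12 x y.
  pose proof (abs_le_avg ax1 G (avg ax2 (n + m2)%e) (avg ax2 (m1 + m12)%e) t Ht
    (abs_le_avg ax2 G n m2 t Ht Hn H2) (abs_le_avg ax2 (dx ax1 G) m1 m12 t Ht H1 H12) x y) as H.
  rewrite <- avg_add, Int_const_field in H; revert H; IntE; lra.
Qed.

Lemma young_abs a b l : 0 < l -> Rabs (a * b) <= / 2 * (l * (a * a) + / l * (b * b)).
Proof.
  intros Hl.
  assert (0 < / (2 * l)) by (apply Rinv_0_lt_compat; lra).
  assert (E : / 2 * (l * (a * a) + / l * (b * b)) - a * b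
    = / (2 * l) * Rsqr (l * a - b)) by (unfold Rsqr; field; lra).
  assert (E' : / 2 * (l * (a * a) + / l * (b * b)) + a * b
    = / (2 * l) * Rsqr (l * a + b)) by (unfold Rsqr; field; lra).
  assert (0 <= / (2 * l) * Rsqr (l * a - b)) by (apply Rmult_le_pos; [lra | apply Rle_0_sqr]).
  assert (0 <= / (2 * l) * Rsqr (l * a + b)) by (apply Rmult_le_pos; [lra | apply Rle_0_sqr]).
  apply Rabs_le_between; lra.
Qed.

(** A regular majorant of [|a b|].  With the weight [l] chosen as in
    [Int_majorant_le], its integral is as good as the Cauchy-Schwarz bound. *)
Definition majorant (l : R) (a b : evol T) : evol T :=
  (/ 2 *: (l *: (a * a) + / l *: (b * b)))%e.

Lemma majorant_spec l (a b : evol T) t x y : dom t -> 0 < l ->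
  Rabs (a t x y * b t x y) <= majorant l a b t x y.
Proof. intros Ht Hl; unfold majorant; evE; now apply young_abs. Qed.

Lemma Int_majorant l (a b : evol T) t : Int (majorant l a b) t = / 2 * (l * L2 a t + / l * L2 b t).
Proof. unfold majorant; now IntE. Qed.

Lemma Int_majorant_le (a b : evol T) c d t : 0 < c -> 0 < d ->
  L2 a t <= c * c -> L2 b t <= d * d -> Int (majorant (d / c) a b) t <= c * d.
Proof.
  intros Hc Hd Ha Hb; rewrite Int_majorant.
  assert (0 < d / c) by (apply Rdiv_lt_0_compat; auto).
  assert (0 < / (d / c)) by (apply Rinv_0_lt_compat; auto).
  assert (d / c * L2 a t <= d / c * (c * c)) by (apply Rmult_le_compat_l; lra).
  assert (/ (d / c) * L2 b t <= / (d / c) * (d * d)) by (apply Rmult_le_compat_l; lra).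
  replace (d / c * (c * c)) with (c * d) in * by (field; lra).
  replace (/ (d / c) * (d * d)) with (c * d) in * by (field; lra).
  lra.
Qed.

(** Ladyzhenskaya's inequality for a product.  It is linear in the bound [k] for
    the higher norm, which keeps the second-order energy estimate linear. *)
Lemma L2_mul_le (a b : evol T) h k t : dom t -> 0 < h -> 0 < k ->
  L2 a t <= h * h -> L2 b t <= h * h ->
  (forall i, L2 (dx i a) t <= k * k) -> (forall i, L2 (dx i b) t <= k * k) ->
  L2 (a * b)%e t <= (h * (h + 2 * k)) * (h * (h + 2 * k)).
Proof.
  intros Ht Hh Hk Ha Hb Hda Hdb.
  pose (n := majorant (h / h) a b).
  pose (m := fun i => (majorant (k / h) b (dx i a) + majorant (k / h) a (dx i b))%e).
  assert (Hl : 0 < k / h) by (apply Rdiv_lt_0_compat; auto).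
  assert (Hl' : 0 < h / h) by (apply Rdiv_lt_0_compat; auto).
  assert (HI : forall i, Int (n + m i)%e t <= h * (h + 2 * k)).
  { intros i; unfold n, m; rewrite !Int_add.
    pose proof (Int_majorant_le a b h h t Hh Hh Ha Hb).
    pose proof (Int_majorant_le b (dx i a) h k t Hh Hk Hb (Hda i)).
    pose proof (Int_majorant_le a (dx i b) h k t Hh Hk Ha (Hdb i)). lra. }
  assert (Hm : forall i x y, Rabs (dx i (a * b)%e t x y) <= m i t x y).
  { intros i x y; unfold m; rewrite dd_mul; evE.
    pose proof (majorant_spec (k / h) b (dx i a) t x y Ht Hl).
    pose proof (majorant_spec (k / h) a (dx i b) t x y Ht Hl).
    eapply Rle_trans; [apply Rabs_triang|].
    rewrite (Rmult_comm (dx i a t x y)); lra. }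
  assert (Hn : forall x y, Rabs ((a * b)%e t x y) <= n t x y)
    by (intros; evE; now apply majorant_spec).
  assert (Hpos : forall i, 0 <= Int (n + m i)%e t).
  { intros i; apply Int_nonneg; auto; intros x y; evE.
    pose proof (Rabs_pos ((a * b)%e t x y)); pose proof (Rabs_pos (dx i (a * b)%e t x y)).
    specialize (Hn x y); specialize (Hm i x y); lra. }
  eapply Rle_trans; [apply (L2_le_majorants _ n (m ax1) (m ax2)); auto|].
  apply Rmult_le_compat; auto.
Qed.

Fixpoint epow (f : evol T) (j : nat) : evol T :=
  match j with O => ecst 1 | S j' => (epow f j' * f)%e end.

Lemma epowE f j t x y : dom t -> epow f j t x y = f t x y ^ j.
Proof.
  intros Ht; induction j as [|j IH]; simpl; evE; auto.
  rewrite IH; ring.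
Qed.

Lemma dd_epow d f j : dd d (epow f (S j)) = (INR (S j) *: (epow f j * dd d f))%e.
Proof.
  induction j as [|j IH].
  - simpl epow; rewrite dd_mul, dd_cst; apply evol_eq; intros; evE; simpl; ring.
  - change (epow f (S (S j))) with (epow f (S j) * f)%e.
    rewrite dd_mul, IH, (S_INR (S j)).
    apply evol_eq; intros; change (epow f (S j)) with (epow f j * f)%e; evE; ring.
Qed.

(** Powers of a function with [H^1] norm at most [h] have [L^2] norm at most a
    constant times the same power of [h]: the embedding of W^{1,1} into L^2
    applied to [f ^ (j + 2) = f ^ (j + 1) f]. *)
Lemma L2_epow_le j : exists c, 0 < c /\ forall (f : evol T) h t,
  dom t -> 0 < h -> L2 f t <= h * h -> (forall i, L2 (dx i f) t <= h * h) ->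
  L2 (epow f (S j)) t <= c * h ^ S j * (c * h ^ S j).
Proof.
  induction j as [|j [c [Hc IH]]].
  - exists 1; split; [lra|]; intros f h t Ht Hh H0 _.
    replace (epow f 1) with f; [simpl; lra|].
    apply evol_eq; intros; simpl; evE; ring.
  - pose (N := INR (S (S j))).
    assert (HN : 0 < N) by (apply lt_0_INR; lia).
    exists ((1 + N) * c); split; [nra|].
    intros f h t Ht Hh H0 H1.
    specialize (IH f h t Ht Hh H0 H1).
    set (P := epow f (S j)) in *.
    set (l := h / (c * h ^ S j)).
    assert (Hp : 0 < c * h ^ S j) by (apply Rmult_lt_0_compat; auto; now apply pow_lt).
    assert (Hl : 0 < l) by (apply Rdiv_lt_0_compat; auto).
    pose (n := majorant l P f).
    pose (m := fun i => (N *: majorant l P (dx i f))%e).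
    assert (HI : forall i, Int (n + m i)%e t <= (1 + N) * c * h ^ S (S j)).
    { intros i; unfold n, m; IntE.
      pose proof (Int_majorant_le P f _ h t Hp Hh IH H0) as E1.
      pose proof (Int_majorant_le P (dx i f) _ h t Hp Hh IH (H1 i)) as E2.
      fold l in E1, E2.
      replace ((1 + N) * c * h ^ S (S j)) with (c * h ^ S j * h + N * (c * h ^ S j * h))
        by (simpl; ring).
      apply Rplus_le_compat; auto; apply Rmult_le_compat_l; lra. }
    assert (Hn : forall x y, Rabs ((epow f (S (S j))) t x y) <= n t x y).
    { intros; change (epow f (S (S j))) with (P * f)%e; evE; now apply majorant_spec. }
    assert (Hm : forall i x y, Rabs (dx i (epow f (S (S j))) t x y) <= m i t x y).
    { intros i x y; rewrite dd_epow; fold P; fold N; unfold m; evE.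
      rewrite Rabs_mult, (Rabs_right N) by lra.
      apply Rmult_le_compat_l; [lra | now apply majorant_spec]. }
    assert (Hpos : forall i, 0 <= Int (n + m i)%e t).
    { intros i; apply Int_nonneg; auto; intros x y; evE.
      pose proof (Rabs_pos (epow f (S (S j)) t x y)).
      pose proof (Rabs_pos (dx i (epow f (S (S j))) t x y)).
      specialize (Hn x y); specialize (Hm i x y); lra. }
    eapply Rle_trans; [apply (L2_le_majorants _ n (m ax1) (m ax2)); auto|].
    apply Rmult_le_compat; auto.
Qed.

(** A substitute for the Brezis-Gallouet inequality, obtained by applying
    [abs_le_majorants] to a high power of [f].  Taking roots, the supremum is
    bounded by a product of powers of the [H^1] and [H^2] bounds in which the
    exponent [1 / (3 + j)] of the latter is as small as one likes. *)
Lemma sup_interpolation j : exists c, 0 < c /\ forall (f : evol T) h k t,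
  dom t -> 0 < h -> 0 < k ->
  L2 f t <= h * h -> (forall i, L2 (dx i f) t <= h * h) ->
  (forall i i', L2 (dx i (dx i' f)) t <= k * k) ->
  forall x y, Rabs (f t x y) ^ (3 + j) <= c * h ^ (2 + j) * (h + k).
Proof.
  destruct (L2_epow_le j) as [c1 [Hc1 B1]].
  destruct (L2_epow_le (S j)) as [c2 [Hc2 B2]].
  pose (M := INR (3 + j)); pose (N := INR (2 + j)).
  assert (HM : 0 < M) by (apply lt_0_INR; lia).
  assert (HN : 0 < N) by (apply lt_0_INR; lia).
  assert (HMN : 0 < M * N) by nra.
  exists (c2 * (1 + 3 * M) + 2 * (M * N * c1)); split; [nra|].
  intros f h k t Ht Hh Hk H0 H1 H2 x y.
  specialize (B1 f h t Ht Hh H0 H1); specialize (B2 f h t Ht Hh H0 H1).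
  set (Q := epow f (S j)) in *; set (P := epow f (S (S j))) in *.
  assert (Hh1 : 0 < h ^ S j) by now apply pow_lt.
  assert (Hp1 : 0 < c1 * h ^ S j) by (apply Rmult_lt_0_compat; auto).
  assert (Hp2 : 0 < c2 * h ^ S (S j)) by (apply Rmult_lt_0_compat; auto; now apply pow_lt).
  assert (HR : forall i i', L2 (dx i f * dx i' f)%e t <= h * (h + 2 * k) * (h * (h + 2 * k)))
    by (intros; apply L2_mul_le; auto).
  assert (Hr : 0 < h * (h + 2 * k)) by nra.
  set (l := h / (c2 * h ^ S (S j))).
  set (mu := k / (c2 * h ^ S (S j))).
  set (nu := h * (h + 2 * k) / (c1 * h ^ S j)).
  assert (Hl : 0 < l) by (apply Rdiv_lt_0_compat; auto).
  assert (Hmu : 0 < mu) by (apply Rdiv_lt_0_compat; auto).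
  assert (Hnu : 0 < nu) by (apply Rdiv_lt_0_compat; auto).
  pose (n := majorant l P f).
  pose (m := fun i => (M *: majorant l P (dx i f))%e).
  pose (m12 := (M *: (N *: majorant nu Q (dx ax1 f * dx ax2 f)
                        + majorant mu P (dx ax2 (dx ax1 f))))%e).
  assert (E : epow f (3 + j) = (P * f)%e) by reflexivity.
  assert (E' : forall i, dx i (epow f (3 + j)) = (M *: (P * dx i f))%e).
  { intros i; apply dd_epow. }
  rewrite RPow_abs, <- (epowE f (3 + j) t x y Ht).
  assert (I0 : Int n t <= c2 * h ^ S (S j) * h) by now apply Int_majorant_le.
  assert (I1 : forall i, Int (m i) t <= M * (c2 * h ^ S (S j) * h)).
  { intros i; unfold m; IntE; apply Rmult_le_compat_l; [lra|]; now apply Int_majorant_le. }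
  assert (I2 : Int m12 t <= M * (N * (c1 * h ^ S j * (h * (h + 2 * k)))
                  + c2 * h ^ S (S j) * k)).
  { unfold m12; IntE; apply Rmult_le_compat_l; [lra|].
    apply Rplus_le_compat; [apply Rmult_le_compat_l; [lra|]|]; now apply Int_majorant_le. }
  eapply Rle_trans.
  - apply (abs_le_majorants _ n (m ax1) (m ax2) m12 t Ht).
    + intros u v; rewrite E; evE; now apply majorant_spec.
    + intros u v; rewrite E'; unfold m; evE; rewrite Rabs_mult, (Rabs_right M) by lra.
      apply Rmult_le_compat_l; [lra | now apply majorant_spec].
    + intros u v; rewrite E'; unfold m; evE; rewrite Rabs_mult, (Rabs_right M) by lra.
      apply Rmult_le_compat_l; [lra | now apply majorant_spec].
    + intros u v; rewrite E', dd_mul, dd_cst, dd_mul.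
      replace (dx ax2 P) with (N *: (Q * dx ax2 f))%e by (symmetry; apply dd_epow).
      unfold m12; evE.
      pose proof (majorant_spec nu Q (dx ax1 f * dx ax2 f)%e t u v Ht Hnu) as Y1.
      pose proof (majorant_spec mu P (dx ax2 (dx ax1 f)) t u v Ht Hmu) as Y2.
      rewrite emulE in Y1.
      match goal with |- Rabs ?e <= _ => replace e with
        (M * (N * (Q t u v * (dx ax1 f t u v * dx ax2 f t u v))
               + P t u v * dx ax2 (dx ax1 f) t u v)) by ring end.
      rewrite Rabs_mult, (Rabs_right M) by lra.
      apply Rmult_le_compat_l; [lra|].
      eapply Rle_trans; [apply Rabs_triang|].
      apply Rplus_le_compat; auto.
      rewrite Rabs_mult, (Rabs_right N) by lra.
      apply Rmult_le_compat_l; [lra | exact Y1].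
  - pose proof (I1 ax1) as I3; pose proof (I1 ax2) as I4.
    change (h ^ (2 + j)) with (h * h ^ S j).
    change (h ^ S (S j)) with (h * h ^ S j) in *.
    set (z := h * h ^ S j) in *.
    assert (Hz : 0 < z) by (unfold z; apply Rmult_lt_0_compat; auto).
    replace (c1 * h ^ S j * (h * (h + 2 * k))) with (c1 * z * (h + 2 * k)) in I2
      by (unfold z; ring).
    apply Rle_trans with (c2 * z * h + M * (c2 * z * h) + M * (c2 * z * h)
      + M * (N * (c1 * z * (h + 2 * k)) + c2 * z * k)); [lra|].
    assert (0 < c1 * z) by nra. assert (0 < c2 * z) by nra.
    assert (0 < c2 * z * M) by (apply Rmult_lt_0_compat; auto).
    assert (0 < M * N * (c1 * z)) by (apply Rmult_lt_0_compat; auto).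
    assert (0 < M * N * (c1 * z) * h) by (apply Rmult_lt_0_compat; auto).
    assert (0 < c2 * z * M * k) by (apply Rmult_lt_0_compat; auto).
    assert (0 < c2 * z * k) by (apply Rmult_lt_0_compat; auto).
    assert (0 < c2 * z * M * h) by (apply Rmult_lt_0_compat; auto).
    assert (0 < M * N * (c1 * z) * k) by (apply Rmult_lt_0_compat; auto).
    lra.
Qed.

End Inequalities.

(** * Energy identity, Gronwall's lemma and the continuity method *)

Section LinearSystem.
Variable T : R.
Local Notation dom := (dom T).

Definition esum (F : axis -> evol T) : evol T := (F ax1 + F ax2)%e.

Lemma esumE F t x y : esum F t x y = sum2 (fun i => F i t x y).
Proof. unfold esum, sum2; now evE. Qed.

Lemma dd_esum d F : dd d (esum F) = esum (fun i => dd d (F i)).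
Proof. apply dd_add. Qed.

Lemma Int_esum F t : Int (esum F) t = sum2 (fun i => Int (F i) t).
Proof. apply Int_add. Qed.

(** The relaxation system with sources [G] and [S] in the last two equations;
    the quadratic flux is counted as a source. *)
Definition linear_system (eps delta : R) (q : evol T) (w : axis -> evol T)
    (V : axis -> axis -> evol T) (G : axis -> evol T) (S : axis -> axis -> evol T) : Prop :=
  (eps *: dd Time q + esum (fun i => dx i (w i)))%e = ecst 0 /\
  (forall j, (dd Time (w j) + esum (fun i => dx i (V i j)) + dx j q)%e = G j) /\
  (forall i j, (delta *: dd Time (V i j) + dx i (w j) + V i j)%e = S i j).

Lemma dd_cst_mul d c (f : evol T) : dd d (c *: f)%e = (c *: dd d f)%e.
Proof. rewrite dd_mul, dd_cst; apply evol_eq; intros; evE; ring. Qed.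

(** The coefficients are constant, so energy estimates for derivatives are
    those of the system itself with differentiated sources. *)
Lemma linear_system_dd d eps delta q w V G S :
  linear_system eps delta q w V G S ->
  linear_system eps delta (dd d q) (fun i => dd d (w i)) (fun i j => dd d (V i j))
    (fun i => dd d (G i)) (fun i j => dd d (S i j)).
Proof.
  intros (H1 & H2 & H3); repeat split.
  - apply (f_equal (dd d)) in H1; rewrite dd_add, dd_cst_mul, dd_esum, dd_cst in H1.
    rewrite <- H1; unfold esum; now rewrite !(dd_comm T d).
  - intros j; rewrite <- H2, !dd_add, dd_esum; unfold esum; now rewrite !(dd_comm T d).
  - intros i j; rewrite <- H3, !dd_add, dd_cst_mul; now rewrite !(dd_comm T d).
Qed.

Definition energy (eps delta : R) (q : evol T) (w : axis -> evol T)
    (V : axis -> axis -> evol T) : evol T :=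
  (/ 2 *: (eps *: (q * q) + esum (fun i => w i * w i)
           + delta *: esum (fun i => esum (fun j => V i j * V i j))))%e.

Lemma Int_energy eps delta q w V t :
  Int (energy eps delta q w V) t =
  / 2 * (eps * L2 q t + sum2 (fun i => L2 (w i) t)
         + delta * sum2 (fun i => sum2 (fun j => L2 (V i j) t))).
Proof. unfold energy, esum, sum2; now IntE. Qed.

(** The first-order part of the system is antisymmetric: it contributes the
    divergence of the flux [q w + V w], which has integral zero. *)
Lemma energy_derive eps delta q w V G S t : dom t ->
  linear_system eps delta q w V G S ->
  is_derive (Int (energy eps delta q w V)) t
    (Int (esum (fun i => w i * G i)
          + esum (fun i => esum (fun j => V i j * S i j - V i j * V i j)))%e t).
Proof.
  intros Ht (H1 & H2 & H3).
  pose (flux := fun i => (q * w i + esum (fun j => V i j * w j))%e).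
  assert (E : dd Time (energy eps delta q w V) =
    (esum (fun i => w i * G i) + esum (fun i => esum (fun j => V i j * S i j - V i j * V i j))
     - esum (fun i => dx i (flux i)))%e).
  { unfold energy, flux, esum in *.
    rewrite dd_cst_mul, !dd_add, !dd_cst_mul, !dd_add, !dd_mul.
    apply evol_eq; intros s x y Hs.
    apply (f_equal (fun g => val g s x y)) in H1.
    assert (H2' := fun j => f_equal (fun g => val g s x y) (H2 j)).
    assert (H3' := fun i j => f_equal (fun g => val g s x y) (H3 i j)).
    pose proof (H2' ax1) as A1; pose proof (H2' ax2) as A2.
    pose proof (H3' ax1 ax1) as B1; pose proof (H3' ax1 ax2) as B2.
    pose proof (H3' ax2 ax1) as B3; pose proof (H3' ax2 ax2) as B4.
    clear H2' H3'; cbv beta in *.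
    rewrite ?esubE, ?eaddE, ?emulE, ?ecstE in * by assumption.
    repeat rewrite ?esubE, ?eaddE, ?emulE, ?ecstE in * by assumption.
    rewrite <- A1, <- A2, <- B1, <- B2, <- B3, <- B4.
    apply Rminus_diag_uniq.
    match type of H1 with ?l = 0 =>
      match goal with |- ?a - ?b = 0 => transitivity (q s x y * l) end end;
      [field | rewrite H1; ring]. }
  assert (I : Int (dd Time (energy eps delta q w V)) t =
    Int (esum (fun i => w i * G i)
          + esum (fun i => esum (fun j => V i j * S i j - V i j * V i j)))%e t).
  { rewrite E, Int_sub, (Int_esum (fun i => dx i (flux i))); unfold sum2.
    rewrite !Int_dd_space by auto; ring. }
  rewrite <- I; now apply Int_derive.
Qed.

Lemma sum2_nonneg (X : axis -> R) : (forall i, 0 <= X i) -> 0 <= sum2 X.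
Proof. intros H; apply Rplus_le_le_0_compat; apply H. Qed.

Lemma L2_nonneg (f : evol T) t : dom t -> 0 <= L2 f t.
Proof. intros; apply Int_nonneg; auto; intros; evE; apply Rle_0_sqr. Qed.

Lemma energy_nonneg eps delta q w V t : dom t -> 0 <= eps -> 0 <= delta ->
  0 <= Int (energy eps delta q w V) t.
Proof.
  intros Ht He Hd; rewrite Int_energy; unfold sum2.
  repeat match goal with
  | |- 0 <= _ + _ => apply Rplus_le_le_0_compat
  | |- 0 <= _ * _ => apply Rmult_le_pos
  end; auto using L2_nonneg; lra.
Qed.

(** Two integrations by parts; the determinant of the Hessian is a divergence. *)
Lemma hessian_identity (f : evol T) t : dom t ->
  sum2 (fun i => sum2 (fun j => L2 (dx i (dx j f)) t)) = L2 (esum (fun i => dx i (dx i f))) t.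
Proof.
  intros Ht; unfold sum2, esum.
  set (f11 := dx ax1 (dx ax1 f)); set (f22 := dx ax2 (dx ax2 f)).
  rewrite (dd_comm T (Space ax2) (Space ax1)); set (f12 := dx ax1 (dx ax2 f)).
  assert (E : (f12 * f12 - f11 * f22 = dx ax1 (dx ax2 f * f12) - dx ax2 (dx ax2 f * f11))%e).
  { rewrite !dd_mul; fold f12 f22; unfold f11, f12.
    rewrite (dd_comm T (Space ax2) (Space ax1) (dx ax1 f)).
    rewrite (dd_comm T (Space ax2) (Space ax1) f).
    apply evol_eq; intros; evE; ring. }
  apply (f_equal (fun g => Int g t)) in E; revert E.
  rewrite !Int_sub, !Int_dd_space by auto; intros E.
  assert (E' : ((f11 + f22) * (f11 + f22) = f11 * f11 + 2 *: (f11 * f22) + f22 * f22)%e)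
    by (apply evol_eq; intros; evE; ring).
  rewrite E'; IntE; lra.
Qed.

End LinearSystem.
Arguments esum {T}. Arguments linear_system {T}. Arguments energy {T}.

Lemma nonincreasing_of_derive (f df : R -> R) a b : 
  (forall t, a < t < b -> is_derive f t (df t)) ->
  (forall t, a < t < b -> df t <= 0) ->
  forall r s, a < r -> r <= s -> s < b -> f s <= f r.
Proof.
  intros H1 H2 r s Hr Hrs Hs.
  destruct (MVT_gen f r s df) as [c [Hc E]].
  - intros x; rewrite Rmin_left, Rmax_right by lra; intros; apply H1; lra.
  - intros x; rewrite Rmin_left, Rmax_right by lra; intros.
    apply derivable_continuous_pt; exists (df x); apply is_derive_Reals, H1; lra.
  - rewrite Rmin_left, Rmax_right in Hc by lra.
    assert (df c * (s - r) <= 0) by (specialize (H2 c ltac:(lra)); nra).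
    lra.
Qed.

(** Gronwall's lemma in the presence of an initial layer of width [delta].  The
    coefficient [exp (- t / delta) / delta] has integral at most one and costs a
    factor [exp 1]; the source [exp (- t / delta) * c] has integral at most
    [c * delta].
    The function is only known near time zero through an upper bound. *)
Lemma gronwall_layer (E : R -> R) tau delta K b c E0 L :
  0 < delta -> 0 <= K -> 0 <= b -> 0 <= c -> 0 <= E0 -> 0 <= L ->
  (forall t, 0 < t < tau -> exists dE, is_derive E t dE /\
     dE <= (K + exp (- t / delta) / delta) * E t + b + exp (- t / delta) * c) ->
  (forall t, 0 < t < tau -> E t <= E0 + L * t) ->
  forall t, 0 < t < tau -> E t <= exp (K * t + 1) * (E0 + b * t + c * delta).
Proof.
  intros Hd HK Hb Hc HE0 HL HEx H0 t Ht.
  pose (dE := Derive E).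
  assert (HD : forall t, 0 < t < tau -> is_derive E t (dE t)).
  { intros s Hs; destruct (HEx s Hs) as [l [Hl _]].
    apply Derive_correct; eexists; exact Hl. }
  assert (HI : forall t, 0 < t < tau ->
     dE t <= (K + exp (- t / delta) / delta) * E t + b + exp (- t / delta) * c).
  { intros s Hs; destruct (HEx s Hs) as [l [Hl H]].
    unfold dE; now rewrite (is_derive_unique _ _ _ Hl). }
  (* [mu] is the integrating factor; [Phi] is nonincreasing. *)
  pose (om := fun t => exp (- t / delta)).
  pose (mu := fun t => exp (- K * t + om t)).
  pose (Phi := fun t => mu t * E t - exp 1 * (b * t - c * delta * om t)).
  pose (dPhi := fun t => mu t * (- K - om t / delta) * E t + mu t * dE t
                 - exp 1 * (b + c * om t)).
  assert (Hom : forall s, 0 < om s) by (intros; apply exp_pos).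
  assert (Hom1 : forall s, 0 < s -> om s <= 1).
  { intros s Hs; rewrite <- exp_0; unfold om.
    left; apply exp_increasing; unfold Rdiv.
    assert (0 < / delta) by now apply Rinv_0_lt_compat. nra. }
  assert (Hmu : forall s, 0 < mu s) by (intros; apply exp_pos).
  assert (Hmu1 : forall s, 0 < s -> mu s <= exp 1).
  { intros s Hs; unfold mu; specialize (Hom1 s Hs).
    destruct (Rle_lt_or_eq_dec (- K * s + om s) 1) as [H|H]; [nra | left; now apply exp_increasing | rewrite H; lra]. }
  assert (HPhi : forall s, 0 < s < tau -> is_derive Phi s (dPhi s)).
  { intros s Hs; specialize (HD s Hs).
    assert (M : is_derive mu s (mu s * (- K - om s / delta))).
    { unfold mu, om; auto_derive; auto.
      unfold Rdiv; ring. }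
    assert (O : is_derive (fun t => exp 1 * (b * t - c * delta * om t)) s (exp 1 * (b + c * om s))).
    { unfold om, Rdiv; auto_derive; auto; unfold Rdiv; field; lra. }
    pose proof (is_derive_mult _ _ _ _ _ M HD Rmult_comm) as M'.
    exact (is_derive_minus _ _ _ _ _ M' O). }
  assert (Hneg : forall s, 0 < s < tau -> dPhi s <= 0).
  { intros s Hs; unfold dPhi.
    specialize (HI s Hs); fold (om s) in HI.
    assert (mu s * dE s <= mu s * ((K + om s / delta) * E s + b + om s * c))
      by (apply Rmult_le_compat_l; auto; left; auto).
    assert (mu s * (b + om s * c) <= exp 1 * (b + om s * c)).
    { apply Rmult_le_compat_r; [|apply Hmu1; lra].
      specialize (Hom s); nra. }
    nra. }
  assert (Hmono := nonincreasing_of_derive Phi dPhi 0 tau HPhi Hneg).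
  assert (Hr : forall r, 0 < r <= t -> Phi t <= exp 1 * (E0 + c * delta) + exp 1 * L * r).
  { intros r Hr; eapply Rle_trans; [apply (Hmono r t); lra|].
    unfold Phi.
    assert (mu r * E r <= exp 1 * (E0 + L * r)).
    { apply Rle_trans with (mu r * (E0 + L * r)).
      - apply Rmult_le_compat_l; [left; auto | apply H0; lra].
      - apply Rmult_le_compat_r; [nra | apply Hmu1; lra]. }
    pose proof (exp_pos 1).
    assert (c * delta * om r <= c * delta * 1)
      by (apply Rmult_le_compat_l; [nra | apply Hom1; lra]).
    assert (0 <= exp 1 * (b * r)) by (apply Rmult_le_pos; nra).
    assert (exp 1 * (c * delta * om r) <= exp 1 * (c * delta * 1))
      by (apply Rmult_le_compat_l; lra).
    nra. }
  assert (HP : Phi t <= exp 1 * (E0 + c * delta)).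
  { apply Rnot_lt_le; intros Hlt.
    set (d := Phi t - exp 1 * (E0 + c * delta)) in *.
    assert (0 < d) by (unfold d; lra).
    pose proof (exp_pos 1).
    assert (HL' : 0 <= exp 1 * L) by (apply Rmult_le_pos; lra).
    set (r := Rmin t (d / (2 * (exp 1 * L + 1)))).
    assert (0 < d / (2 * (exp 1 * L + 1))) by (apply Rdiv_lt_0_compat; lra).
    assert (r <= t) by apply Rmin_l.
    assert (r <= d / (2 * (exp 1 * L + 1))) by apply Rmin_r.
    assert (0 < r) by (apply Rmin_pos; lra).
    specialize (Hr r ltac:(lra)).
    assert (exp 1 * L * r <= (exp 1 * L + 1) * (d / (2 * (exp 1 * L + 1)))).
    { apply Rmult_le_compat; lra. }
    replace ((exp 1 * L + 1) * (d / (2 * (exp 1 * L + 1)))) with (d / 2) in * by (field; lra).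
    unfold d in *; lra. }
  unfold Phi in HP.
  assert (HE : mu t * E t <= exp 1 * (E0 + b * t + c * delta)).
  { pose proof (exp_pos 1).
    assert (0 <= exp 1 * (c * delta * om t)).
    { apply Rmult_le_pos; [lra|]; apply Rmult_le_pos; [nra | left; auto]. }
    lra. }
  assert (Hinv : 1 <= exp (K * t) * mu t).
  { unfold mu; rewrite <- exp_plus, <- exp_0.
    replace (K * t + (- K * t + om t)) with (om t) by ring.
    left; apply exp_increasing; auto. }
  rewrite exp_plus.
  assert (HR : 0 <= E0 + b * t + c * delta).
  { assert (0 <= b * t) by nra. assert (0 <= c * delta) by nra. lra. }
  destruct (Rle_dec 0 (E t)) as [P|P].
  - apply Rle_trans with (exp (K * t) * mu t * E t); [nra|].
    rewrite !Rmult_assoc; apply Rmult_le_compat_l; [left; apply exp_pos | exact HE].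
  - apply Rle_trans with 0; [lra|].
    apply Rmult_le_pos; auto; left; apply Rmult_lt_0_compat; apply exp_pos.
Qed.

(** Continuity method: a bound by one that improves itself to a bound by one half
    never fails. *)
Lemma bootstrap (phi : R -> R) T L : 0 <= L ->
  (forall t, 0 < t < T -> continuous phi t) ->
  (forall t, 0 < t < T -> phi t <= / 2 + L * t) ->
  (forall tau, tau <= T -> (forall s, 0 < s < tau -> phi s <= 1) ->
     forall s, 0 < s < tau -> phi s <= / 2) ->
  forall t, 0 < t < T -> phi t <= 1.
Proof.
  intros HL Hcont Hinit Hboot t1 Ht1.
  apply Rnot_lt_le; intros Hgt.
  pose (S := fun tau => tau <= t1 /\ forall s, 0 < s < tau -> phi s <= 1).
  destruct (completeness S) as [ts [Hub Hlub]].
  { exists t1; intros s [Hs _]; auto. }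
  { exists 0; split; [lra | intros; lra]. }
  assert (Hts1 : ts <= t1) by (apply Hlub; intros s [Hs _]; auto).
  assert (H1 : forall s, 0 < s < ts -> phi s <= 1).
  { intros s Hs; apply Rnot_lt_le; intros Hlt.
    assert (ts <= s); [|lra].
    apply Hlub; intros tau [Htau Hb].
    apply Rnot_lt_le; intros Hc; specialize (Hb s ltac:(lra)); lra. }
  assert (Hpos : 0 < ts).
  { set (r := Rmin t1 (/ (2 * (L + 1)))).
    assert (0 < / (2 * (L + 1))) by (apply Rinv_0_lt_compat; lra).
    assert (0 < r) by (apply Rmin_pos; lra).
    apply Rlt_le_trans with r; auto.
    assert (r <= t1) by apply Rmin_l.
    assert (r <= / (2 * (L + 1))) by apply Rmin_r.
    apply Hub; split; auto.
    intros s Hs; eapply Rle_trans; [apply Hinit; lra|].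
    assert (L * s <= (L + 1) * / (2 * (L + 1))) by (apply Rmult_le_compat; lra).
    replace ((L + 1) * / (2 * (L + 1))) with (/ 2) in * by (field; lra).
    lra. }
  assert (H2 : forall s, 0 < s < ts -> phi s <= / 2) by (apply Hboot; auto; lra).
  assert (Hnb : locally (phi ts) (fun z => Rabs (z - phi ts) < / 4)).
  { exists (mkposreal (/ 4) ltac:(lra)); intros z Hz; exact Hz. }
  destruct (Hcont ts ltac:(lra) _ Hnb) as [eta Heta].
  assert (Hn : forall s, Rabs (s - ts) < eta -> Rabs (phi s - phi ts) < / 4)
    by (intros s Hs; apply (Heta s Hs)).
  pose proof (cond_pos eta).
  assert (Hphi : phi ts <= 3 / 4).
  { set (s := Rmax (ts / 2) (ts - eta / 2)).
    assert (ts / 2 <= s) by apply Rmax_l.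
    assert (ts - eta / 2 <= s) by apply Rmax_r.
    assert (s < ts) by (apply Rmax_lub_lt; lra).
    specialize (H2 s ltac:(lra)).
    assert (Hs : Rabs (s - ts) < eta) by (apply Rabs_def1; lra).
    specialize (Hn s Hs); apply Rabs_def2 in Hn; lra. }
  destruct (Req_dec ts t1) as [->|Hne]; [lra|].
  assert (Hlt : ts < Rmin t1 (ts + eta / 2)) by (apply Rmin_glb_lt; lra).
  assert (Rmin t1 (ts + eta / 2) <= ts); [|lra].
  apply Hub; split; [apply Rmin_l|].
  intros s Hs; destruct (Rlt_dec s ts) as [Hl|Hl]; [apply H1; lra|].
  pose proof (Rmin_r t1 (ts + eta / 2)).
  assert (Hs' : Rabs (s - ts) < eta) by (apply Rabs_def1; lra).
  specialize (Hn s Hs'); apply Rabs_def2 in Hn; lra.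
Qed.

(** * Smooth solutions and initial values *)

Definition half_nbhd (z : R * R * R) : ((R * R * R) -> Prop) -> Prop :=
  within (fun z : R * R * R => 0 <= fst (fst z)) (locally z).

(** Compactness of the box.  The covering radius at a point is also chosen below
    the inverse of [|g| + 1] there, so that the uniform lower bound on the radii
    of the points used bounds the values of [g] at these points. *)
Lemma bounded_on_box (g : R -> sfield) T :
  (forall t x y, 0 <= t <= T ->
     filterlim (fun z : R * R * R => g (fst (fst z)) (snd (fst z)) (snd z))
       (half_nbhd (t, x, y)) (locally (g t x y))) ->
  exists B, forall t x y, 0 <= t <= T -> 0 <= x <= 1 -> 0 <= y <= 1 ->
    Rabs (g t x y) <= B.
Proof.
  intros H.
  assert (Hr : forall z : R * R * R, exists r : posreal,
    0 <= fst (fst z) <= T -> forall t x y, Rabs (t - fst (fst z)) < r ->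
    Rabs (x - snd (fst z)) < r -> Rabs (y - snd z) < r -> 0 <= t ->
    Rabs (g t x y - g (fst (fst z)) (snd (fst z)) (snd z)) < 1).
  { intros [[t x] y]; simpl.
    destruct (excluded_middle_informative (0 <= t <= T)) as [Ht|Ht];
      [|exists (mkposreal 1 Rlt_0_1); tauto].
    assert (N : locally (g t x y) (fun v => Rabs (v - g t x y) < 1))
      by (exists (mkposreal 1 Rlt_0_1); intros v Hv; exact Hv).
    destruct (H t x y Ht _ N) as [r Hr]; exists r; intros _ t' x' y' H1 H2 H3 H4.
    apply (Hr (t', x', y')); simpl; auto; repeat split; assumption. }
  pose (rad := fun z => proj1_sig (constructive_indefinite_description _ (Hr z))).
  assert (Hrad := fun z => proj2_sig (constructive_indefinite_description _ (Hr z))).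
  fold rad in Hrad.
  pose (G := fun z : R * R * R => g (fst (fst z)) (snd (fst z)) (snd z)).
  assert (Hpos : forall z, 0 < Rmin (rad z) (/ (Rabs (G z) + 1))).
  { intros z; apply Rmin_pos; [apply cond_pos|].
    apply Rinv_0_lt_compat; pose proof (Rabs_pos (G z)); lra. }
  pose (conv := fun w : Compactness.Tn 3 R => match w with (t, (x, (y, _))) => (t, x, y) end).
  destruct (compactness_value 3 (0, (0, (0, tt))) (T, (1, (1, tt)))
    (fun w => mkposreal _ (Hpos (conv w)))) as [d Hd].
  exists (/ d + 1); intros t x y Ht Hx Hy.
  apply Rnot_lt_le; intros Hlt.
  apply (Hd (t, (x, (y, tt)))); [simpl; tauto|].
  intros [[t' [x' [y' []]]] [Hb [Hc Hm]]]; simpl in Hb, Hc, Hm.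
  set (z := (t', x', y')) in *.
  pose proof (Rmin_l (rad z) (/ (Rabs (G z) + 1))).
  pose proof (Rmin_r (rad z) (/ (Rabs (G z) + 1))).
  assert (E : Rabs (g t x y - G z) < 1).
  { destruct Hc as (C1 & C2 & C3 & _).
    apply (Hrad z); [unfold z; simpl; tauto | | | | lra];
      (eapply Rlt_le_trans; [eassumption | apply Rmin_l]). }
  assert (Hi : Rabs (G z) + 1 <= / d).
  { pose proof (Rabs_pos (G z)); pose proof (cond_pos d).
    rewrite <- (Rinv_inv (Rabs (G z) + 1)); apply Rinv_le_contravar; lra. }
  pose proof (Rabs_triang (g t x y - G z) (G z)).
  replace (g t x y - G z + G z) with (g t x y) in H2 by ring; lra.
Qed.

Section FromSmooth.
Variable T : R.
Local Notation dom := (dom T).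

(** Periodicity is recorded at interior times only: in this form the class is
    stable under time differentiation without a discussion of the one-sided
    derivative at time zero. *)
Definition smooth_upto (f : R -> sfield) : Prop :=
  (forall t, 0 <= t <= T -> forall (l : list direction) x y,
     filterlim (fun z : R * R * R => iter_D l f (fst (fst z)) (snd (fst z)) (snd z))
       (half_nbhd (t, x, y)) (locally (iter_D l f t x y)) /\
     (exists v, is_dt (iter_D l f) t x y v) /\
     forall i, ex_pd i (iter_D l f t) x y) /\
  (forall t, dom t -> periodic (f t)).

Lemma smooth_evol_upto Tm f : Rbar_lt T Tm -> smooth_evol Tm f -> smooth_upto f.
Proof.
  intros HT H; split.
  - intros t Ht; apply H; [lra|].
    eapply Rbar_le_lt_trans; [|exact HT]; simpl; lra.
  - intros t [H0 H1]; apply H; [lra|].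
    eapply Rbar_lt_trans; [|exact HT]; simpl; lra.
Qed.

Lemma iter_D_app l d f : iter_D (l ++ [d]) f = iter_D l (iter_D [d] f).
Proof.
  induction l as [|e l IH]; [reflexivity|].
  simpl app; destruct e; simpl; rewrite IH; reflexivity.
Qed.

Lemma is_dt_is_derive f t x y v : 0 < t -> is_dt f t x y v ->
  is_derive (fun s => f s x y) t v.
Proof.
  intros Ht [H1 H2]; split; auto.
  intros z Hz e.
  assert (Hz' : is_filter_lim (within (fun s => 0 <= s) (locally t)) z).
  { intros P HP; specialize (Hz P HP); apply filter_le_within; auto. }
  specialize (H2 z Hz' e); unfold within in H2.
  assert (Hp : locally t (fun s => 0 < s)) by (apply open_gt; auto).
  generalize (filter_and _ _ Hp H2); apply filter_imp.
  intros s [S1 S2]; apply S2; lra.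
Qed.

Lemma dt_is_derive f t x y : 0 < t -> (exists v, is_dt f t x y v) ->
  is_derive (fun s => f s x y) t (dt f t x y).
Proof.
  intros Ht [v Hv].
  assert (E : dt f t x y = v).
  { unfold dt; apply (@iota_unique R_AbsRing R_CompleteNormedModule); auto; intros v' Hv'.
    apply is_dt_is_derive in Hv; apply is_dt_is_derive in Hv'; auto.
    now rewrite <- (is_derive_unique _ _ _ Hv), <- (is_derive_unique _ _ _ Hv'). }
  rewrite E; now apply is_dt_is_derive.
Qed.

Lemma smooth_upto_derives d f : smooth_upto f -> derives T d f (iter_D [d] f).
Proof.
  intros [H _] t x y Ht.
  assert (Ht' : 0 <= t <= T) by (destruct Ht; lra).
  destruct (H t Ht' [] x y) as [_ [Hdt Hpd]]; destruct d as [|i].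
  - apply dt_is_derive; [apply Ht | exact Hdt].
  - specialize (Hpd i); destruct i; exact (Derive_correct _ _ Hpd).
Qed.

Lemma periodic_deriv d f g : derives T d f g ->
  (forall t, dom t -> periodic (f t)) -> forall t, dom t -> periodic (g t).
Proof.
  intros Hd P t Ht x y.
  assert (HL := dom_open T t Ht).
  assert (Sh : forall (h : R -> R) z l, is_derive h (z + 1) l ->
     (forall s, h (s + 1) = h s) -> is_derive h z l).
  { intros h z l Hh Hp.
    apply (is_derive_ext (fun s => h (s + 1))); auto.
    replace l with (1 * l) by ring.
    apply (is_derive_comp h (fun s => s + 1)); auto; auto_derive; auto. }
  assert (Px : is_derive (line d f t x y) (coord d t x y) (g t (x + 1) y)).
  { pose proof (Hd t (x + 1) y Ht) as H1; destruct d as [|[|]]; simpl in *.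
    - eapply is_derive_ext_loc; [|exact H1].
      eapply filter_imp; [|exact HL]; intros s Hs; apply P, Hs.
    - apply Sh; auto; intros s; apply P, Ht.
    - eapply is_derive_ext; [|exact H1]; intros s; apply P, Ht. }
  assert (Py : is_derive (line d f t x y) (coord d t x y) (g t x (y + 1))).
  { pose proof (Hd t x (y + 1) Ht) as H1; destruct d as [|[|]]; simpl in *.
    - eapply is_derive_ext_loc; [|exact H1].
      eapply filter_imp; [|exact HL]; intros s Hs; apply P, Hs.
    - eapply is_derive_ext; [|exact H1]; intros s; apply P, Ht.
    - apply Sh; auto; intros s; apply P, Ht. }
  pose proof (is_derive_unique _ _ _ (Hd t x y Ht)) as E.
  split; [rewrite <- (is_derive_unique _ _ _ Px) | rewrite <- (is_derive_unique _ _ _ Py)];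
    exact E.
Qed.

Lemma smooth_upto_iter d f : smooth_upto f -> smooth_upto (iter_D [d] f).
Proof.
  intros Hf; split.
  - intros t Ht l; rewrite <- iter_D_app; apply Hf, Ht.
  - apply (periodic_deriv d f); [now apply smooth_upto_derives | apply Hf].
Qed.

Lemma smooth_upto_bounded_per f : smooth_upto f -> bounded_per T f.
Proof.
  intros [H P]; split; auto.
  destruct (bounded_on_box f T) as [B HB].
  { intros t x y Ht; apply (H t Ht [] x y). }
  exists B; intros t x y Ht.
  destruct (periodic_representative x) as [r [Hr E]].
  rewrite (E (fun x => f t x y)) by (intros; apply P, Ht).
  destruct (periodic_representative y) as [r' [Hr' E']].
  rewrite (E' (fun y => f t r y)) by (intros; apply P, Ht).
  apply HB; auto; destruct Ht; lra.
Qed.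

Lemma smooth_upto_regular f : smooth_upto f -> regular T f.
Proof.
  intros Hf n; revert f Hf; induction n as [|n IH]; intros f Hf.
  - split; [now apply smooth_upto_bounded_per | exact I].
  - apply Creg_intro; [now apply smooth_upto_bounded_per|].
    intros d; exists (iter_D [d] f); split; [now apply smooth_upto_derives|].
    now apply IH, smooth_upto_iter.
Qed.

Definition of_smooth f (H : smooth_upto f) : evol T := restrict f (smooth_upto_regular f H).

Lemma of_smoothE f H t x y : dom t -> of_smooth f H t x y = f t x y.
Proof. apply restrictE. Qed.

Lemma dd_of_smooth d f H :
  dd d (of_smooth f H) = of_smooth (iter_D [d] f) (smooth_upto_iter d f H).
Proof.
  apply dd_unique.
  eapply derives_ext; [| |apply smooth_upto_derives, H].
  - intros t x y Ht; now rewrite of_smoothE.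
  - intros t x y Ht; now rewrite of_smoothE.
Qed.

Lemma smooth_T2_pd i f : smooth_T2 f -> smooth_T2 (pd i f).
Proof.
  assert (App : forall l f, iter_pd (l ++ [i]) f = iter_pd l (pd i f)).
  { induction l as [|e l IH]; intros g; [reflexivity|]; simpl; now rewrite IH. }
  intros [P H]; split.
  - assert (Q : forall z w l : R, is_derive (fun s => f s w) z l -> is_derive (fun s => f s w) (z + 1) l).
    { intros z w l Hh.
      apply (is_derive_ext (fun s => (fun s => f s w) (s - 1))).
      { intros s; destruct (P (s - 1) w) as [<- _]; f_equal; ring. }
      replace l with (1 * l) by ring.
      apply (is_derive_comp (fun s => f s w) (fun s => s - 1)); [|auto_derive; auto].
      now replace (z + 1 - 1) with z by ring. }
    assert (Q' : forall z w l : R, is_derive (fun s => f w s) z l -> is_derive (fun s => f w s) (z + 1) l).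
    { intros z w l Hh.
      apply (is_derive_ext (fun s => (fun s => f w s) (s - 1))).
      { intros s; destruct (P w (s - 1)) as [_ <-]; f_equal; ring. }
      replace l with (1 * l) by ring.
      apply (is_derive_comp (fun s => f w s) (fun s => s - 1)); [|auto_derive; auto].
      now replace (z + 1 - 1) with z by ring. }
    intros x y; destruct (H [] x y) as [_ Hex]; specialize (Hex i).
    destruct i; simpl in *; split.
    + apply is_derive_unique, Q, Derive_correct, Hex.
    + apply Derive_ext; intros s; apply P.
    + apply Derive_ext; intros s; apply P.
    + apply is_derive_unique, Q', Derive_correct, Hex.
  - intros l x y; rewrite <- App; apply H.
Qed.

Lemma smooth_T2_regular f : smooth_T2 f -> regular T (fun _ => f).
Proof.
  intros Hf n; revert f Hf; induction n as [|n IH]; intros f Hf;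
    assert (Hb : bounded_per T (fun _ => f)).
  1,3: destruct Hf as [P H]; split; [|intros; apply P];
    destruct (bounded_on_box (fun _ => f) 0) as [B HB];
    [ intros t x y _; destruct (H [] x y) as [Hc _];
      intros Q HQ; destruct (Hc Q HQ) as [e He]; exists e;
      intros [[t' x'] y'] [[_ Hx] Hy] _; apply (He (x', y')); split; assumption
    | exists B; intros t x y _;
      destruct (periodic_representative x) as [r [Hr E]];
      rewrite (E (fun x => f x y)) by (intros; apply P);
      destruct (periodic_representative y) as [r' [Hr' E']];
      rewrite (E' (fun y => f r y)) by (intros; apply P);
      apply (HB 0); auto; lra ].
  - split; auto; exact I.
  - apply Creg_intro; auto; intros [|i].
    + exists (fun _ _ _ => 0); split; [|apply Creg_const].
      intros t x y _; exact (is_derive_const (f x y) t).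
    + exists (fun _ => pd i f); split; [|now apply IH, smooth_T2_pd].
      intros t x y _; destruct Hf as [_ H]; destruct (H [] x y) as [_ Hex].
      specialize (Hex i); destruct i; exact (Derive_correct _ _ Hex).
Qed.

Definition static f (H : smooth_T2 f) : evol T := restrict (fun _ => f) (smooth_T2_regular f H).

Lemma staticE f H t x y : dom t -> static f H t x y = f x y.
Proof. apply (restrictE T (fun _ => f)). Qed.

Lemma dx_static i f H : dx i (static f H) = static (pd i f) (smooth_T2_pd i f H).
Proof.
  apply evol_eq; intros t x y Ht; rewrite <- Der_dd, staticE by auto.
  destruct i; apply Derive_ext; intros s; cbn [line]; now rewrite staticE.
Qed.

Lemma smooth_T2_initial Tm f : Rbar_lt 0 Tm -> smooth_evol Tm f -> smooth_T2 (f 0).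
Proof.
  intros HT H; destruct (H 0 ltac:(lra) HT) as [P Hl]; split; auto.
  intros l x y.
  assert (E : iter_pd l (f 0) = iter_D (map Space l) f 0).
  { clear -l; induction l as [|i l IH]; [reflexivity|]; simpl; now rewrite IH. }
  rewrite E; destruct (Hl (map Space l) x y) as [Hc [_ Hex]]; split; auto.
  intros Q HQ; destruct (Hc Q HQ) as [e He]; exists e.
  intros [x' y'] [Hx Hy]; apply (He (0, x', y')); [|simpl; lra].
  split; auto; split; auto; apply ball_center.
Qed.

(** For regular fields the linear rate is automatic once there is convergence to
    zero, and it gives uniformity in space. *)
Definition small (h : evol T) : Prop :=
  exists B, 0 <= B /\ forall t x y, dom t -> Rabs (h t x y) <= B * t.

Fixpoint flat_upto (n : nat) (h : evol T) : Prop :=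
  small h /\ match n with O => True | S m => forall i, flat_upto m (dx i h) end.

(** Evolutions carry no information at time zero; that [f] starts from the initial
    value of [g] is expressed by [flat (f - g)]. *)
Definition flat (h : evol T) : Prop := forall n, flat_upto n h.

Lemma evol_bounded (f : evol T) :
  exists B, 0 <= B /\ forall t x y, dom t -> Rabs (f t x y) <= B.
Proof.
  destruct (val_Creg T f 0) as [[[B HB] _] _]; exists (Rmax 0 B); split; [apply Rmax_l|].
  intros; eapply Rle_trans; [apply HB; auto | apply Rmax_r].
Qed.

Lemma small_add f g : small f -> small g -> small (f + g)%e.
Proof.
  intros [B [P HB]] [B' [P' HB']]; exists (B + B'); split; [lra|]; intros t x y Ht; evE.
  eapply Rle_trans; [apply Rabs_triang|].
  specialize (HB t x y Ht); specialize (HB' t x y Ht); lra.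
Qed.

Lemma small_mul f g : small g -> small (f * g)%e.
Proof.
  intros [B [P HB]]; destruct (evol_bounded f) as [A [PA HA]].
  exists (A * B); split; [nra|]; intros t x y Ht; evE; rewrite Rabs_mult, Rmult_assoc.
  apply Rmult_le_compat; auto using Rabs_pos.
Qed.

Lemma flat_small h : flat h -> small h.
Proof. intros H; apply (H 0%nat). Qed.

Lemma flat_dx i h : flat h -> flat (dx i h).
Proof. intros H n; apply (H (S n)). Qed.

Lemma flat_add f g : flat f -> flat g -> flat (f + g)%e.
Proof.
  intros Hf Hg n; specialize (Hf n); specialize (Hg n); revert f g Hf Hg.
  induction n as [|n IH]; intros f g [F1 F2] [G1 G2]; split; auto using small_add.
  intros i; rewrite dd_add; auto.
Qed.

Lemma flat_mul f g : flat g -> flat (f * g)%e.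
Proof.
  intros Hg n; revert f g Hg; induction n as [|n IH]; intros f g Hg.
  - split; auto; apply small_mul; now apply flat_small.
  - split; [apply small_mul; now apply flat_small|].
    intros i; rewrite dd_mul.
    assert (A : forall m f g, flat_upto m f -> flat_upto m g -> flat_upto m (f + g)%e).
    { clear; induction m as [|m IH]; intros f g [F1 F2] [G1 G2]; split;
        auto using small_add; intros i; rewrite dd_add; auto. }
    apply A; apply IH; auto using flat_dx.
Qed.

Lemma flat_sub f g : flat f -> flat g -> flat (f - g)%e.
Proof.
  intros Hf Hg; replace (f - g)%e with (f + -1 *: g)%e.
  - apply flat_add; auto; now apply flat_mul.
  - apply evol_eq; intros; evE; ring.
Qed.

(** A bounded time derivative gives the linear rate on the open interval, and
    continuity at time zero identifies the limit. *)
Lemma flat_initial f f0 Hf H0 : (forall x y, f 0 x y = f0 x y) -> 0 < T ->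
  flat (of_smooth f Hf - static f0 H0)%e.
Proof.
  intros E HT n; revert f f0 Hf H0 E; induction n as [|n IH]; intros f f0 Hf H0 E.
  all: assert (Hs : small (of_smooth f Hf - static f0 H0)%e).
  1,3: destruct (Creg_lipschitz T f (smooth_upto_regular f Hf 1%nat)) as [B [PB HB]];
    exists B; split; auto; intros t x y Ht; evE; rewrite of_smoothE, staticE, <- E by auto;
    apply Rnot_lt_le; intros Hlt;
    set (e := Rabs (f t x y - f 0 x y) - B * t) in *;
    assert (He : 0 < e) by (unfold e; lra);
    destruct Hf as [Hf _]; destruct (Hf 0 ltac:(lra) [] x y) as [Hc _];
    assert (N : locally (f 0 x y) (fun v => Rabs (v - f 0 x y) < e))
      by (exists (mkposreal e He); intros v Hv; exact Hv);
    destruct (Hc _ N) as [r Hr];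
    set (s := Rmin (r / 2) t);
    assert (Hs : 0 < s <= t) by (pose proof (cond_pos r); destruct Ht; split;
      [apply Rmin_pos; lra | apply Rmin_r]);
    assert (Hsr : s < r) by (pose proof (cond_pos r); pose proof (Rmin_l (r / 2) t);
      fold s in H0; unfold s in *; lra);
    assert (K1 : Rabs (f s x y - f 0 x y) < e)
      by (apply (Hr (s, x, y)); [|simpl; lra];
          (split; [split|]; simpl; [|apply ball_center|apply ball_center]);
          change (Rabs (s - 0) < r); rewrite Rminus_0_r, Rabs_right; lra);
    assert (K2 : Rabs (f t x y - f s x y) <= B * (t - s))
      by (assert (Ds : dom s) by (destruct Ht; split; lra);
          pose proof (HB s t x x y y Ds Ht) as K;
          replace (x - x) with 0 in K by ring; replace (y - y) with 0 in K by ring;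
          rewrite Rabs_R0, !Rplus_0_r, (Rabs_right (t - s)) in K by lra; exact K);
    pose proof (Rabs_triang (f t x y - f s x y) (f s x y - f 0 x y)) as K3;
    replace (f t x y - f s x y + (f s x y - f 0 x y)) with (f t x y - f 0 x y) in K3 by ring;
    unfold e in *; nra.
  - split; auto.
  - split; auto; intros i; rewrite dd_sub, dd_of_smooth, dx_static; apply IH.
    intros x y; destruct i; apply Derive_ext; intros s; apply E.
Qed.

Lemma L2_near_initial (f g : evol T) : small (f - g)%e ->
  exists L, 0 <= L /\ forall t, dom t -> L2 f t <= L2 g t + L * t.
Proof.
  intros [B [PB HB]]; destruct (evol_bounded g) as [A [PA HA]].
  destruct (evol_bounded f) as [A' [PA' HA']].
  exists ((A + A') * B); split; [nra|]; intros t Ht.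
  apply Rle_trans with (Int (g * g + ecst ((A + A') * B * t))%e t).
  - apply Int_mono; auto; intros x y; evE.
    specialize (HB t x y Ht); specialize (HA t x y Ht); specialize (HA' t x y Ht).
    rewrite esubE in HB.
    replace (f t x y * f t x y) with (g t x y * g t x y
      + (f t x y + g t x y) * (f t x y - g t x y)) by ring.
    apply Rplus_le_compat_l; eapply Rle_trans; [apply Rle_abs|].
    rewrite Rabs_mult, Rmult_assoc; apply Rmult_le_compat; auto using Rabs_pos.
    eapply Rle_trans; [apply Rabs_triang | lra].
  - IntE; lra.
Qed.

Definition slice (f : evol T) (t : R) (g : sfield) : Prop := forall x y, f t x y = g x y.

Lemma slice_dx i f t g : dom t -> slice f t g -> slice (dx i f) t (pd i g).
Proof.
  intros Ht H x y; rewrite <- Der_dd by auto.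
  destruct i; apply Derive_ext; intros s; apply H.
Qed.

Lemma slice_L2 f t g : dom t -> slice f t g -> L2 f t = L2sq g.
Proof.
  intros Ht H; rewrite Int_int_T2 by auto.
  assert (E : (f * f)%e t = (fun x1 x2 => g x1 x2 ^ 2)).
  { apply functional_extensionality; intros x; apply functional_extensionality; intros y.
    rewrite emulE, (H x y); ring. }
  unfold L2sq; now rewrite E.
Qed.

Lemma slice_H1 f t g : dom t -> slice f t g ->
  L2 f t + sum2 (fun i => L2 (dx i f) t) = H1sq g.
Proof.
  intros Ht H; unfold H1sq, grad, sum2; rewrite (slice_L2 f t g) by auto.
  now rewrite !(slice_L2 (dx _ f) t (pd _ g)) by (auto using slice_dx).
Qed.

End FromSmooth.

Arguments of_smooth {T}. Arguments static {T}. Arguments flat {T}. Arguments small {T}.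
Arguments slice {T}.
#[global] Opaque of_smooth static.

(** * Growth of the energies *)

Section Growth.
Variable T : R.
Local Notation dom := (dom T).

Definition bounded_by (A : R) (f : evol T) : Prop :=
  forall t x y, dom t -> Rabs (f t x y) <= A.

Fixpoint cbound (A : R) (n : nat) (f : evol T) : Prop :=
  bounded_by A f /\ match n with O => True | S m => forall d, cbound A m (dd d f) end.

Lemma cbound_mono A A' n f : A <= A' -> cbound A n f -> cbound A' n f.
Proof.
  intros HA; revert f; induction n as [|n IH]; intros f [H1 H2]; split; auto;
    intros t x y Ht; specialize (H1 t x y Ht); lra.
Qed.

Lemma cbound0 A n f t x y : cbound A n f -> dom t -> Rabs (f t x y) <= A.
Proof. intros H Ht; destruct n; apply (proj1 H); exact Ht. Qed.

Lemma cbound1 A n d f t x y : cbound A (S n) f -> dom t -> Rabs (dd d f t x y) <= A.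
Proof. intros H; exact (cbound0 A n _ t x y (proj2 H d)). Qed.

Lemma cbound2 A n d d' f t x y : cbound A (S (S n)) f -> dom t ->
  Rabs (dd d (dd d' f) t x y) <= A.
Proof. intros H; exact (cbound1 A n d _ t x y (proj2 H d')). Qed.

Lemma cbound_exists n f : exists A, cbound A n f.
Proof.
  revert f; induction n as [|n IH]; intros f;
    destruct (evol_bounded T f) as [B [_ HB]].
  - exists B; split; auto; exact HB.
  - destruct (IH (dd Time f)) as [A0 H0], (IH (dx ax1 f)) as [A1 H1], (IH (dx ax2 f)) as [A2 H2].
    exists (Rmax B (Rmax A0 (Rmax A1 A2))); split.
    + intros t x y Ht; eapply Rle_trans; [apply HB; auto | apply Rmax_l].
    + intros [|[|]]; (eapply cbound_mono; [|eassumption]);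
      eauto using Rle_trans, Rmax_l, Rmax_r.
Qed.

Lemma cbound_family n (f : axis -> evol T) : exists A, forall i, cbound A n (f i).
Proof.
  destruct (cbound_exists n (f ax1)) as [A1 H1], (cbound_exists n (f ax2)) as [A2 H2].
  exists (Rmax A1 A2); intros [|]; (eapply cbound_mono; [|eassumption]);
    auto using Rmax_l, Rmax_r.
Qed.

Lemma regular_layer delta : regular T (fun t _ _ => exp (- t / delta)).
Proof.
  assert (H : forall n c, Creg T n (fun t _ _ => c * exp (- t / delta))).
  { induction n as [|n IH]; intros c.
    all: assert (Hb : bounded_per T (fun t _ _ => c * exp (- t / delta))).
    1,3: split; [|intros t _ x y; auto];
      exists (Rabs c * exp (T * Rabs (/ delta))); intros t x y [H0 H1];
      rewrite Rabs_mult, (Rabs_right (exp _)) by (left; apply exp_pos);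
      (apply Rmult_le_compat_l; [apply Rabs_pos|]);
      pose proof (Rle_abs (- / delta)) as H2; rewrite Rabs_Ropp in H2;
      pose proof (Rabs_pos (/ delta));
      assert (H3 : - t / delta <= T * Rabs (/ delta)) by (unfold Rdiv; nra);
      destruct H3 as [H3|H3]; [left; now apply exp_increasing | rewrite H3; lra].
    - split; auto; exact I.
    - apply Creg_intro; auto; intros d; destruct d as [|i].
      + exists (fun t _ _ => (- c / delta) * exp (- t / delta)); split; auto.
        intros t x y Ht; simpl; auto_derive; auto; unfold Rdiv; ring.
      + exists (fun _ _ _ => 0); split; [|apply Creg_const].
        intros t x y Ht; destruct i; apply @is_derive_const. }
  intros n; eapply Creg_ext; [|apply (H n 1)]; intros t x y _; ring.
Qed.

(** The profile of the initial layer: the relaxation equation alone makes the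
    stress decay like [exp (- t / delta)] to its equilibrium. *)
Definition layer (delta : R) : evol T := restrict _ (regular_layer delta).

Lemma layerE delta t x y : dom t -> layer delta t x y = exp (- t / delta).
Proof. apply (restrictE T (fun t _ _ => exp (- t / delta))). Qed.

Lemma dt_layer delta : dd Time (layer delta) = (- / delta *: layer delta)%e.
Proof.
  apply dd_unique; intros t x y Ht; evE; rewrite layerE by auto; simpl.
  apply (is_derive_ext_loc (fun s => exp (- s / delta))).
  { eapply filter_imp; [|apply (dom_open T t Ht)].
    intros s Hs; now rewrite layerE. }
  auto_derive; auto; unfold Rdiv; ring.
Qed.

Lemma dx_layer i delta : dx i (layer delta) = ecst 0.
Proof.
  apply evol_eq; intros t x y Ht; rewrite <- Der_dd by auto; evE.
  apply is_derive_unique.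
  apply (is_derive_ext (fun _ => exp (- t / delta))).
  - intros s; destruct i; cbn [line]; now rewrite layerE.
  - apply @is_derive_const.
Qed.

Lemma layer_bounds delta t : 0 < delta -> 0 < t -> 0 < exp (- t / delta) <= 1.
Proof.
  intros Hd Ht; split; [apply exp_pos|].
  rewrite <- exp_0; left; apply exp_increasing; unfold Rdiv.
  assert (0 < / delta) by now apply Rinv_0_lt_compat. nra.
Qed.

Lemma layer_small delta : 0 < delta -> small (layer delta - ecst 1)%e.
Proof.
  intros Hd; exists (/ delta); split; [left; now apply Rinv_0_lt_compat|].
  intros t x y Ht; evE; rewrite layerE by auto.
  pose proof (layer_bounds delta t Hd (proj1 Ht)).
  pose proof (exp_ineq1_le (- t / delta)).
  unfold Rdiv in *; apply Rabs_le_between; split; [|destruct Ht; pose proof (Rinv_0_lt_compat _ Hd); nra].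
  lra.
Qed.

Lemma layer_flat delta : 0 < delta -> flat (layer delta - ecst 1)%e.
Proof.
  assert (Hz : forall m, flat_upto T m (ecst 0)).
  { induction m as [|m IH]; split; auto;
      try (exists 0; split; [lra|]; intros t x y Ht; evE; rewrite Rabs_R0; lra).
    intros i; now rewrite dd_cst. }
  intros Hd [|n]; split; auto using layer_small.
  intros i; rewrite dd_sub, dx_layer, dd_cst.
  replace (ecst 0 - ecst 0)%e with (@ecst T 0); auto.
  apply evol_eq; intros; evE; ring.
Qed.

(** The term with [z] is split with the weight [delta], so that its coefficient in
    front of the energy is integrable in time uniformly in [delta]. *)
Lemma Int_source_le (w G g z : evol T) (delta b : R) t : dom t -> 0 < delta ->
  (forall x y, G t x y = g t x y - exp (- t / delta) * z t x y) ->
  (forall x y, Rabs (g t x y) <= b) ->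
  Int (w * G)%e t <= / 2 * (1 + exp (- t / delta) / delta) * L2 w t + / 2 * (b * b)
    + exp (- t / delta) * (delta / 2 * L2 z t).
Proof.
  intros Ht Hd HG Hg; set (om := exp (- t / delta)) in *.
  assert (Hom : 0 < om) by apply exp_pos.
  apply Rle_trans with (Int (/ 2 * (1 + om / delta) *: (w * w) + ecst (/ 2 * (b * b))
    + om * (delta / 2) *: (z * z))%e t).
  - apply Int_mono; auto; intros x y; evE; rewrite HG.
    specialize (Hg x y); apply Rabs_le_between in Hg.
    set (W := w t x y); set (Z := z t x y); set (g' := g t x y) in *.
    assert (E1 : W * g' <= / 2 * (W * W) + / 2 * (b * b)).
    { pose proof (Rle_0_sqr (W - g')); unfold Rsqr in *; nra. }
    assert (E2 : - (W * Z) <= / 2 * / delta * (W * W) + delta / 2 * (Z * Z)).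
    { replace (/ 2 * / delta * (W * W) + delta / 2 * (Z * Z))
        with (/ 2 * / delta * Rsqr (W + delta * Z) - W * Z) by (unfold Rsqr; field; lra).
      assert (0 <= / 2 * / delta * Rsqr (W + delta * Z)); [|lra].
      apply Rmult_le_pos; [|apply Rle_0_sqr].
      pose proof (Rinv_0_lt_compat _ Hd); lra. }
    apply (Rmult_le_compat_l om) in E2; [|lra].
    unfold Rdiv in *; nra.
  - IntE; unfold Rdiv; lra.
Qed.

(** The damping absorbs the factor [V] of the source. *)
Lemma Int_relaxation_le (V S N Q : evol T) (b : R) t : dom t ->
  (forall x y, S t x y = N t x y + Q t x y) ->
  (forall x y, Rabs (Q t x y) <= b) ->
  Int (V * S - V * V)%e t <= / 2 * L2 N t + / 2 * (b * b).
Proof.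
  intros Ht HS HR.
  apply Rle_trans with (Int (/ 2 *: (N * N) + ecst (/ 2 * (b * b)))%e t).
  - apply Int_mono; auto; intros x y; evE; rewrite HS.
    specialize (HR x y); apply Rabs_le_between in HR.
    set (v := V t x y); set (n := N t x y); set (r := Q t x y) in *.
    pose proof (Rle_0_sqr (v - / 2 * (n + r))); pose proof (Rle_0_sqr (n - r)).
    unfold Rsqr in *; nra.
  - IntE; lra.
Qed.

Lemma energy_ge_velocity eps delta (q : evol T) (w : axis -> evol T) (V : axis -> axis -> evol T) t : dom t -> 0 <= eps -> 0 <= delta ->
  sum2 (fun i => L2 (w i) t) <= 2 * Int (energy eps delta q w V) t.
Proof.
  intros Ht He Hd; rewrite Int_energy.
  assert (0 <= eps * L2 q t) by (apply Rmult_le_pos; auto using L2_nonneg).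
  assert (0 <= delta * sum2 (fun i => sum2 (fun j => L2 (V i j) t))).
  { apply Rmult_le_pos; auto; unfold sum2.
    repeat apply Rplus_le_le_0_compat; auto using L2_nonneg. }
  lra.
Qed.

Lemma energy_step eps delta (q : evol T) (w : axis -> evol T) (V : axis -> axis -> evol T)
    (G g z : axis -> evol T) (S N Q : axis -> axis -> evol T) b t :
  dom t -> 0 < eps -> 0 < delta ->
  linear_system eps delta q w V G S ->
  (forall i x y, G i t x y = g i t x y - exp (- t / delta) * z i t x y) ->
  (forall i x y, Rabs (g i t x y) <= b) ->
  (forall i j x y, S i j t x y = N i j t x y + Q i j t x y) ->
  (forall i j x y, Rabs (Q i j t x y) <= b) ->
  exists dE, is_derive (Int (energy eps delta q w V)) t dE /\
    dE <= (1 + exp (- t / delta) / delta) * Int (energy eps delta q w V) t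
      + 3 * (b * b) + exp (- t / delta) * (delta / 2 * sum2 (fun i => L2 (z i) t))
      + / 2 * sum2 (fun i => sum2 (fun j => L2 (N i j) t)).
Proof.
  intros Ht He Hd HL HG Hg HS HR; eexists; split; [apply (energy_derive T _ _ _ _ _ G S); auto|].
  rewrite Int_add, !Int_esum; unfold sum2 at 2; rewrite !Int_esum.
  pose proof (energy_ge_velocity eps delta q w V t Ht ltac:(lra) ltac:(lra)) as EW.
  set (om := exp (- t / delta)) in *.
  assert (Hom : 0 < om / delta) by (apply Rdiv_lt_0_compat; auto; apply exp_pos).
  assert (W := fun i => Int_source_le (w i) (G i) (g i) (z i) delta b t Ht Hd (HG i) (Hg i)).
  assert (X := fun i j => Int_relaxation_le (V i j) (S i j) (N i j) (Q i j) b t Ht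
                 (HS i j) (HR i j)).
  fold om in W; unfold sum2 in *.
  pose proof (W ax1); pose proof (W ax2).
  pose proof (X ax1 ax1); pose proof (X ax1 ax2); pose proof (X ax2 ax1); pose proof (X ax2 ax2).
  clear W X.
  assert (/ 2 * (1 + om / delta) * (L2 (w ax1) t + L2 (w ax2) t)
    <= / 2 * (1 + om / delta) * (2 * Int (energy eps delta q w V) t)).
  { apply Rmult_le_compat_l; lra. }
  lra.
Qed.

(** The square of the norm. *)
Definition H1n (f : evol T) (t : R) : R := L2 f t + sum2 (fun k => L2 (dx k f) t).

Definition energy1 eps delta (q : evol T) (w : axis -> evol T) (V : axis -> axis -> evol T) t : R :=
  Int (energy eps delta q w V) t
  + sum2 (fun k => Int (energy eps delta (dx k q) (fun i => dx k (w i))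
                          (fun i j => dx k (V i j))) t).

Lemma energy1_ge_velocity eps delta q w V t : dom t -> 0 <= eps -> 0 <= delta ->
  sum2 (fun i => H1n (w i) t) <= 2 * energy1 eps delta q w V t.
Proof.
  intros Ht He Hd; unfold energy1, H1n.
  pose proof (energy_ge_velocity eps delta q w V t Ht He Hd).
  assert (Y := fun k => energy_ge_velocity eps delta (dx k q) (fun i => dx k (w i))
     (fun i j => dx k (V i j)) t Ht He Hd).
  pose proof (Y ax1); pose proof (Y ax2); unfold sum2 in *; lra.
Qed.

(** The difference of the quadratic fluxes of [a + v] and [a]. *)
Definition quadratic (v a : axis -> evol T) (i j : axis) : evol T :=
  (v i * v j + v i * a j + a i * v j)%e.

Lemma quadratic_L2_le A b (v w a : axis -> evol T) t : dom t -> 0 <= A -> 0 <= b ->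
  (forall i x y, Rabs (v i t x y) <= 1) -> (forall i x y, Rabs (a i t x y) <= A) ->
  (forall i x y, Rabs (w i t x y - v i t x y) <= b) ->
  forall i j, L2 (quadratic v a i j) t
    <= 4 * ((1 + A) * (1 + A)) * (sum2 (fun i => L2 (w i) t) * 2 + 2 * (b * b)).
Proof.
  intros Ht HA Hb Hv Ha Hw i j.
  apply Rle_trans with (Int (4 * ((1 + A) * (1 + A)) *: (w i * w i + w j * w j + ecst (2 * (b * b))))%e t).
  - apply Int_mono; auto; intros x y; unfold quadratic; evE.
    pose proof (Hv i x y) as V1; pose proof (Hv j x y) as V2.
    pose proof (Ha i x y) as A1; pose proof (Ha j x y) as A2.
    pose proof (Hw i x y) as W1; pose proof (Hw j x y) as W2.
    apply Rabs_le_between in W1; apply Rabs_le_between in W2.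
    apply Rabs_le_between in V1; apply Rabs_le_between in V2.
    apply Rabs_le_between in A1; apply Rabs_le_between in A2.
    set (vi := v i t x y) in *; set (vj := v j t x y) in *.
    set (wi := w i t x y) in *; set (wj := w j t x y) in *.
    set (p := a i t x y) in *; set (r := a j t x y) in *.
    assert (S1 : vi * vi <= 2 * (wi * wi) + 2 * (b * b)).
    { pose proof (Rle_0_sqr (wi + (wi - vi))); unfold Rsqr in *; nra. }
    assert (S2 : vj * vj <= 2 * (wj * wj) + 2 * (b * b)).
    { pose proof (Rle_0_sqr (wj + (wj - vj))); unfold Rsqr in *; nra. }
    assert (S3 : (vj + r) * (vj + r) <= (1 + A) * (1 + A)) by nra.
    assert (S4 : p * p <= (1 + A) * (1 + A)) by nra.
    assert (S5 : (vi * vj + vi * r + p * vj) * (vi * vj + vi * r + p * vj)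
      <= 2 * ((vi * vi) * ((vj + r) * (vj + r))) + 2 * ((p * p) * (vj * vj))).
    { pose proof (Rle_0_sqr (vi * (vj + r) - p * vj)); unfold Rsqr in *; nra. }
    assert (S6 : (vi * vi) * ((vj + r) * (vj + r)) <= (vi * vi) * ((1 + A) * (1 + A)))
      by (apply Rmult_le_compat_l; nra).
    assert (S7 : (p * p) * (vj * vj) <= ((1 + A) * (1 + A)) * (vj * vj))
      by (apply Rmult_le_compat_r; nra).
    set (K := (1 + A) * (1 + A)) in *; assert (0 <= K) by (unfold K; nra).
    assert (K * (vi * vi) <= K * (2 * (wi * wi) + 2 * (b * b))) by (apply Rmult_le_compat_l; lra).
    assert (K * (vj * vj) <= K * (2 * (wj * wj) + 2 * (b * b))) by (apply Rmult_le_compat_l; lra).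
    lra.
  - IntE; apply Rmult_le_compat_l; [nra|]; unfold sum2.
    pose proof (L2_nonneg T (w ax1) t Ht); pose proof (L2_nonneg T (w ax2) t Ht).
    destruct i, j; lra.
Qed.

Lemma sqr4_le a b c d : (a + b + c + d) * (a + b + c + d)
  <= 4 * (a * a + b * b + c * c + d * d).
Proof.
  pose proof (Rle_0_sqr (a - b)); pose proof (Rle_0_sqr (a - c)); pose proof (Rle_0_sqr (a - d)).
  pose proof (Rle_0_sqr (b - c)); pose proof (Rle_0_sqr (b - d)); pose proof (Rle_0_sqr (c - d)).
  unfold Rsqr in *; lra.
Qed.

Lemma mul_sqr_le a b K : a * a <= K -> (b * a) * (b * a) <= K * (b * b).
Proof. intros H; pose proof (Rle_0_sqr b); unfold Rsqr in *; nra. Qed.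

Lemma sqr_le_of_close v w b : Rabs (w - v) <= b -> v * v <= 2 * (w * w) + 2 * (b * b).
Proof.
  intros H; apply Rabs_le_between in H.
  pose proof (Rle_0_sqr (w + (w - v))); unfold Rsqr in *; nra.
Qed.

Lemma quadratic_dx_L2_le A b (v w a : axis -> evol T) t : dom t -> 0 <= A -> 0 <= b ->
  (forall i x y, Rabs (v i t x y) <= 1) -> (forall i x y, Rabs (a i t x y) <= A) ->
  (forall k i x y, Rabs (dx k (a i) t x y) <= A) ->
  (forall i x y, Rabs (w i t x y - v i t x y) <= b) ->
  (forall k i x y, Rabs (dx k (w i) t x y - dx k (v i) t x y) <= b) ->
  forall k i j, L2 (dx k (quadratic v a i j)) t
    <= 8 * ((1 + A) * (1 + A)) * (sum2 (fun i => H1n (w i) t) * 2 + 4 * (b * b)).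
Proof.
  intros Ht HA Hb Hv Ha Hda Hw Hdw k i j.
  set (K := (1 + A) * (1 + A)); assert (HK : 0 <= K) by (unfold K; nra).
  apply Rle_trans with (Int (8 * K *:
     (w i * w i + w j * w j + dx k (w i) * dx k (w i) + dx k (w j) * dx k (w j)
       + ecst (4 * (b * b))))%e t).
  - apply Int_mono; auto; intros x y; unfold quadratic; rewrite !dd_add, !dd_mul; evE.
    pose proof (sqr_le_of_close _ _ _ (Hw i x y)); pose proof (sqr_le_of_close _ _ _ (Hw j x y)).
    pose proof (sqr_le_of_close _ _ _ (Hdw k i x y)); pose proof (sqr_le_of_close _ _ _ (Hdw k j x y)).
    assert (B1 : forall i x y, (v i t x y + a i t x y) * (v i t x y + a i t x y) <= K).
    { intros l x' y'; pose proof (Hv l x' y') as V1; pose proof (Ha l x' y') as A1.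
      apply Rabs_le_between in V1; apply Rabs_le_between in A1; unfold K; nra. }
    assert (B2 : forall i x y, dx k (a i) t x y * dx k (a i) t x y <= K).
    { intros l x' y'; pose proof (Hda k l x' y') as A1.
      apply Rabs_le_between in A1; unfold K; nra. }
    pose proof (mul_sqr_le _ (dx k (v i) t x y) K (B1 j x y)).
    pose proof (mul_sqr_le _ (dx k (v j) t x y) K (B1 i x y)).
    pose proof (mul_sqr_le _ (v i t x y) K (B2 j x y)).
    pose proof (mul_sqr_le _ (v j t x y) K (B2 i x y)).
    pose proof (sqr4_le (dx k (v i) t x y * (v j t x y + a j t x y))
       (dx k (v j) t x y * (v i t x y + a i t x y))
       (v i t x y * dx k (a j) t x y) (v j t x y * dx k (a i) t x y)) as S4.
    set (vi := v i t x y) in *; set (vj := v j t x y) in *.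
    set (wi := w i t x y) in *; set (wj := w j t x y) in *.
    set (ai := a i t x y) in *; set (aj := a j t x y) in *.
    set (dvi := dx k (v i) t x y) in *; set (dvj := dx k (v j) t x y) in *.
    set (dwi := dx k (w i) t x y) in *; set (dwj := dx k (w j) t x y) in *.
    set (dai := dx k (a i) t x y) in *; set (daj := dx k (a j) t x y) in *.
    match goal with |- ?e * ?e <= _ =>
      replace e with (dvi * (vj + aj) + dvj * (vi + ai) + vi * daj + vj * dai) by ring end.
    assert (K * (vi * vi) <= K * (2 * (wi * wi) + 2 * (b * b))) by (apply Rmult_le_compat_l; lra).
    assert (K * (vj * vj) <= K * (2 * (wj * wj) + 2 * (b * b))) by (apply Rmult_le_compat_l; lra).
    assert (K * (dvi * dvi) <= K * (2 * (dwi * dwi) + 2 * (b * b))) by (apply Rmult_le_compat_l; lra).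
    assert (K * (dvj * dvj) <= K * (2 * (dwj * dwj) + 2 * (b * b))) by (apply Rmult_le_compat_l; lra).
    lra.
  - IntE; apply Rmult_le_compat_l; [lra|]; unfold H1n, sum2.
    pose proof (fun i => L2_nonneg T (w i) t Ht) as N0.
    pose proof (fun k i => L2_nonneg T (dx k (w i)) t Ht) as N1.
    pose proof (N0 ax1); pose proof (N0 ax2); pose proof (N1 ax1 ax1); pose proof (N1 ax1 ax2).
    pose proof (N1 ax2 ax1); pose proof (N1 ax2 ax2).
    destruct k, i, j; lra.
Qed.

(** As long as the velocity error [w - eps F] is bounded by one, the quadratic
    term is controlled linearly by the [H^1] norm of [w]; the remaining sources
    are of size [eps + delta], or concentrated in the initial layer. *)
Lemma energy1_growth A eps delta q w V (a F z : axis -> evol T) (Y : axis -> axis -> evol T) t :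
  dom t -> 0 < eps -> 0 < delta -> 1 <= A ->
  (forall i, cbound A 3 (a i)) -> (forall i, cbound A 3 (F i)) ->
  (forall i j, cbound A 3 (Y i j)) ->
  linear_system eps delta q w V
    (fun i => eps *: dd Time (F i) - layer delta * z i)%e
    (fun i j => quadratic (fun i => w i - eps *: F i)%e a i j
                + (eps *: dx i (F j) - delta *: dd Time (Y i j)))%e ->
  (forall i x y, Rabs ((w i - eps *: F i)%e t x y) <= 1) ->
  exists dE, is_derive (energy1 eps delta q w V) t dE /\
    dE <= (1000 * A ^ 4 + exp (- t / delta) / delta) * energy1 eps delta q w V t
      + 1000 * A ^ 4 * ((eps + delta) * (eps + delta))
      + exp (- t / delta) * (delta / 2 * sum2 (fun i => H1n (z i) t)).
Proof.
  intros Ht He Hd HA Ba BF BY HL Hv.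
  set (v := fun i => (w i - eps *: F i)%e) in *.
  set (s := eps + delta); set (b := A * s).
  assert (Hs : 0 < s) by (unfold s; lra).
  assert (Hb : 0 <= b) by (unfold b; nra).
  assert (BF0 : forall i x y, Rabs (F i t x y) <= A) by (intros; exact (cbound0 A _ _ t x y (BF i) Ht)).
  assert (BF1 : forall d i x y, Rabs (dd d (F i) t x y) <= A) by (intros; exact (cbound1 A _ d _ t x y (BF i) Ht)).
  assert (BF2 : forall d d' i x y, Rabs (dd d (dd d' (F i)) t x y) <= A)
    by (intros; exact (cbound2 A _ d d' _ t x y (BF i) Ht)).
  assert (BY1 : forall d i j x y, Rabs (dd d (Y i j) t x y) <= A) by (intros; exact (cbound1 A _ d _ t x y (BY i j) Ht)).
  assert (BY2 : forall d d' i j x y, Rabs (dd d (dd d' (Y i j)) t x y) <= A)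
    by (intros; exact (cbound2 A _ d d' _ t x y (BY i j) Ht)).
  assert (Bs : forall z1, Rabs z1 <= A -> Rabs (eps * z1) <= b).
  { intros z1 Hz; rewrite Rabs_mult, (Rabs_right eps) by lra; unfold b, s.
    pose proof (Rabs_pos z1); nra. }
  assert (Bsd : forall z1 z2, Rabs z1 <= A -> Rabs z2 <= A -> Rabs (eps * z1 - delta * z2) <= b).
  { intros z1 z2 Z1 Z2; apply Rabs_le_between in Z1; apply Rabs_le_between in Z2.
    apply Rabs_le_between; unfold b, s; nra. }
  destruct (energy_step eps delta q w V _ (fun i => eps *: dd Time (F i))%e z _
    (quadratic v a) (fun i j => (eps *: dx i (F j) - delta *: dd Time (Y i j))%e) b t
    Ht He Hd HL) as [dE0 [D0 L0]].
  { intros; evE; now rewrite layerE. }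
  { intros; evE; auto. }
  { intros; now evE. }
  { intros; evE; auto. }
  assert (HD1 : forall k, exists dE, is_derive (Int (energy eps delta (dx k q)
        (fun i => dx k (w i)) (fun i j => dx k (V i j)))) t dE /\
    dE <= (1 + exp (- t / delta) / delta) * Int (energy eps delta (dx k q)
        (fun i => dx k (w i)) (fun i j => dx k (V i j))) t
      + 3 * (b * b) + exp (- t / delta) * (delta / 2 * sum2 (fun i => L2 (dx k (z i)) t))
      + / 2 * sum2 (fun i => sum2 (fun j => L2 (dx k (quadratic v a i j)) t))).
  { intros k.
    apply (energy_step eps delta _ _ _ _ (fun i => eps *: dx k (dd Time (F i)))%e
      (fun i => dx k (z i)) _ (fun i j => dx k (quadratic v a i j))
      (fun i j => (eps *: dx k (dx i (F j)) - delta *: dx k (dd Time (Y i j)))%e) b t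
      Ht He Hd (linear_system_dd T (Space k) _ _ _ _ _ _ _ HL)).
    - intros; rewrite dd_sub, dd_cst_mul, dd_mul, dx_layer; evE; rewrite layerE by auto; ring.
    - intros; evE; auto.
    - intros; rewrite dd_add, dd_sub, !dd_cst_mul; now evE.
    - intros; evE; auto. }
  destruct (HD1 ax1) as [dE1 [D1 L1]]; destruct (HD1 ax2) as [dE2 [D2 L2']]; clear HD1.
  exists (dE0 + (dE1 + dE2)); split.
  { exact (is_derive_plus _ _ _ _ _ D0 (is_derive_plus _ _ _ _ _ D1 D2)). }
  assert (W0 : forall i x y, Rabs (w i t x y - v i t x y) <= b).
  { intros; unfold v; evE.
    replace (w i t x y - (w i t x y - eps * F i t x y)) with (eps * F i t x y) by ring; auto. }
  assert (W1 : forall k i x y, Rabs (dx k (w i) t x y - dx k (v i) t x y) <= b).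
  { intros; unfold v; rewrite dd_sub, dd_cst_mul; evE.
    match goal with |- Rabs ?e <= _ =>
      replace e with (eps * dx k (F i) t x y) by ring end; auto. }
  assert (Ba0 : forall i x y, Rabs (a i t x y) <= A)
    by (intros; exact (cbound0 A _ _ t x y (Ba i) Ht)).
  assert (Ba1 : forall k i x y, Rabs (dx k (a i) t x y) <= A)
    by (intros; exact (cbound1 A _ _ _ t x y (Ba i) Ht)).
  assert (N0 := quadratic_L2_le A b v w a t Ht ltac:(lra) Hb Hv Ba0 W0).
  assert (N1 := quadratic_dx_L2_le A b v w a t Ht ltac:(lra) Hb Hv Ba0 Ba1 W0 W1).
  pose proof (energy1_ge_velocity eps delta q w V t Ht ltac:(lra) ltac:(lra)) as EW.
  set (h := sum2 (fun i => H1n (w i) t)) in *.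
  assert (Hh0 : sum2 (fun i => L2 (w i) t) <= h).
  { unfold h, H1n, sum2.
    pose proof (fun k i => L2_nonneg T (dx k (w i)) t Ht) as P1.
    pose proof (P1 ax1 ax1); pose proof (P1 ax1 ax2).
    pose proof (P1 ax2 ax1); pose proof (P1 ax2 ax2); lra. }
  set (K := (1 + A) * (1 + A)) in *.
  assert (HK : 0 <= K <= 4 * A ^ 2) by (unfold K; simpl; nra).
  set (E1 := energy1 eps delta q w V t) in *.
  assert (HE1 : h <= 2 * E1) by exact EW.
  assert (Hhn : 0 <= h).
  { unfold h, H1n, sum2; repeat apply Rplus_le_le_0_compat; auto using L2_nonneg. }
  assert (N0' : forall i j, L2 (quadratic v a i j) t <= 4 * K * (4 * E1 + 4 * (b * b))).
  { intros i j; eapply Rle_trans; [apply N0|]; apply Rmult_le_compat_l; [lra|]; nra. }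
  assert (N1' : forall k i j, L2 (dx k (quadratic v a i j)) t <= 8 * K * (4 * E1 + 4 * (b * b))).
  { intros k i j; eapply Rle_trans; [apply N1|]; apply Rmult_le_compat_l; lra. }
  pose proof (N0' ax1 ax1); pose proof (N0' ax1 ax2); pose proof (N0' ax2 ax1); pose proof (N0' ax2 ax2).
  pose proof (N1' ax1 ax1 ax1); pose proof (N1' ax1 ax1 ax2);
  pose proof (N1' ax1 ax2 ax1); pose proof (N1' ax1 ax2 ax2).
  pose proof (N1' ax2 ax1 ax1); pose proof (N1' ax2 ax1 ax2);
  pose proof (N1' ax2 ax2 ax1); pose proof (N1' ax2 ax2 ax2).
  clear N0 N1 N0' N1'.
  assert (HE0 : 0 <= E1) by lra.
  assert (Hfin : dE0 + (dE1 + dE2) <= (1 + exp (- t / delta) / delta) * E1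
     + 9 * (b * b) + exp (- t / delta) * (delta / 2 * sum2 (fun i => H1n (z i) t))
     + 40 * K * (4 * E1 + 4 * (b * b))).
  { unfold E1, energy1, H1n, sum2 in *. lra. }
  eapply Rle_trans; [exact Hfin|].
  assert (HA2 : 1 <= A ^ 2) by (simpl; nra).
  replace (A ^ 4) with (A ^ 2 * A ^ 2) by ring.
  set (A2 := A ^ 2) in *.
  assert (Hbb : b * b = A2 * (s * s)) by (unfold b, A2; ring).
  assert (KE : K * E1 <= 4 * A2 * E1) by (apply Rmult_le_compat_r; lra).
  assert (Hss : 0 <= s * s) by nra.
  assert (KB : K * (b * b) <= 4 * A2 * (A2 * (s * s))).
  { rewrite Hbb; apply Rmult_le_compat_r; [nra | lra]. }
  assert (HA4 : A2 <= A2 * A2) by nra.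
  assert (HE4 : A2 * E1 <= A2 * A2 * E1) by (apply Rmult_le_compat_r; lra).
  assert (Hs4 : A2 * (s * s) <= A2 * A2 * (s * s)) by (apply Rmult_le_compat_r; lra).
  assert (HE2 : 1 * E1 <= A2 * E1) by (apply Rmult_le_compat_r; lra).
  assert (0 <= A2 * A2 * E1) by (apply Rmult_le_pos; nra).
  assert (0 <= A2 * A2 * (s * s)) by (apply Rmult_le_pos; nra).
  lra.
Qed.

Definition energy2 eps delta (q : evol T) (w : axis -> evol T) (V : axis -> axis -> evol T) t : R :=
  sum2 (fun k => sum2 (fun l => Int (energy eps delta (dx k (dx l q))
     (fun i => dx k (dx l (w i))) (fun i j => dx k (dx l (V i j)))) t)).

Lemma energy2_ge_velocity eps delta q w V t k l i : dom t -> 0 <= eps -> 0 <= delta ->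
  L2 (dx k (dx l (w i))) t <= 2 * energy2 eps delta q w V t.
Proof.
  intros Ht He Hd.
  pose proof (energy_ge_velocity eps delta (dx k (dx l q))
     (fun i => dx k (dx l (w i))) (fun i j => dx k (dx l (V i j))) t Ht He Hd) as H.
  assert (P := fun k l => energy_nonneg T eps delta (dx k (dx l q))
     (fun i => dx k (dx l (w i))) (fun i j => dx k (dx l (V i j))) t Ht He Hd).
  pose proof (P ax1 ax1); pose proof (P ax1 ax2); pose proof (P ax2 ax1); pose proof (P ax2 ax2).
  pose proof (L2_nonneg T (dx k (dx l (w ax1))) t Ht).
  pose proof (L2_nonneg T (dx k (dx l (w ax2))) t Ht).
  unfold energy2, sum2 in *; destruct k, l, i; lra.
Qed.

(** For the second derivatives of the solution itself, rather than of the error,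
    the quadratic flux is the only source; products of first derivatives are
    handled by [L2_mul_le]. *)
Lemma energy2_growth M h eps delta p u U t :
  dom t -> 0 < eps -> 0 < delta -> 1 <= M -> 1 <= h ->
  linear_system eps delta p u U (fun _ => ecst 0) (fun i j => u i * u j)%e ->
  (forall i x y, Rabs (u i t x y) <= M) ->
  (forall k i, L2 (dx k (u i)) t <= h * h) ->
  exists dE, is_derive (energy2 eps delta p u U) t dE /\
    dE <= 1200 * (M ^ 2 * h ^ 4) * (energy2 eps delta p u U t + 1).
Proof.
  intros Ht He Hd HM Hh HL Hu H1.
  set (E2 := energy2 eps delta p u U t).
  assert (X := fun k l i => energy2_ge_velocity eps delta p u U t k l i Ht ltac:(lra) ltac:(lra)).
  fold E2 in X.
  assert (HE2 : 0 <= E2).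
  { pose proof (X ax1 ax1 ax1); pose proof (L2_nonneg T (dx ax1 (dx ax1 (u ax1))) t Ht); lra. }
  (* The summand one keeps [kk] positive, as [L2_mul_le] requires. *)
  set (kk := sqrt (1 + 2 * E2)).
  assert (Hkk : kk * kk = 1 + 2 * E2) by (apply sqrt_sqrt; lra).
  assert (Hk1 : 1 <= kk) by (rewrite <- sqrt_1; apply sqrt_le_1; lra).
  assert (HP : forall k l i j, L2 (dx k (u i) * dx l (u j))%e t
     <= h * (h + 2 * kk) * (h * (h + 2 * kk))).
  { intros; apply L2_mul_le; auto; try lra; intros; rewrite Hkk;
      eapply Rle_trans; [apply X | lra | apply X | lra]. }
  assert (HS : forall k l i j, L2 (dx k (dx l (u i * u j)%e)) t
     <= 4 * (M * M * (4 * E2)) + 8 * (h * (h + 2 * kk) * (h * (h + 2 * kk)))).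
  { intros k l i j.
    set (g1 := (dx k (u i) * dx l (u j))%e).
    set (g2 := (dx l (u i) * dx k (u j))%e).
    apply Rle_trans with (Int (4 *: (M * M *: (dx k (dx l (u i)) * dx k (dx l (u i))
       + dx k (dx l (u j)) * dx k (dx l (u j))) + g1 * g1 + g2 * g2))%e t).
    - apply Int_mono; auto; intros x y.
      rewrite !dd_mul, dd_add, !dd_mul; evE; unfold g1, g2; evE.
      assert (B : forall i, u i t x y * u i t x y <= M * M).
      { intros l'; pose proof (Hu l' x y) as B; apply Rabs_le_between in B; nra. }
      pose proof (mul_sqr_le _ (dx k (dx l (u i)) t x y) _ (B j)).
      pose proof (mul_sqr_le _ (dx k (dx l (u j)) t x y) _ (B i)).
      pose proof (sqr4_le (dx k (dx l (u i)) t x y * u j t x y)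
        (dx k (dx l (u j)) t x y * u i t x y)
        (dx k (u i) t x y * dx l (u j) t x y) (dx l (u i) t x y * dx k (u j) t x y)) as S4.
      match goal with |- ?e * ?e <= _ => match type of S4 with ?f * ?f <= _ =>
        replace e with f by ring end end.
      lra.
    - IntE.
      pose proof (HP k l i j) as G1; pose proof (HP l k i j) as G2.
      fold g1 in G1; fold g2 in G2.
      pose proof (X k l i); pose proof (X k l j).
      assert (M * M * (L2 (dx k (dx l (u i))) t + L2 (dx k (dx l (u j))) t) <= M * M * (4 * E2))
        by (apply Rmult_le_compat_l; nra).
      lra. }
  assert (HD : forall k l, exists dE, is_derive (Int (energy eps delta (dx k (dx l p))
     (fun i => dx k (dx l (u i))) (fun i j => dx k (dx l (U i j))))) t dE /\
     dE <= 2 * (4 * (M * M * (4 * E2)) + 8 * (h * (h + 2 * kk) * (h * (h + 2 * kk))))).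
  { intros k l; eexists; split.
    - apply (energy_derive T); auto.
      apply (linear_system_dd T (Space k)), (linear_system_dd T (Space l)), HL.
    - rewrite Int_add, !Int_esum; unfold sum2; rewrite !Int_esum; unfold sum2.
      assert (Z : forall i, Int (dx k (dx l (u i)) * dx k (dx l (ecst 0)))%e t = 0).
      { intros i; rewrite !dd_cst.
        replace (dx k (dx l (u i)) * ecst 0)%e with (@ecst T 0); [now rewrite Int_cst|].
        apply evol_eq; intros; evE; ring. }
      rewrite !Z.
      assert (R' := fun i j => Int_relaxation_le (dx k (dx l (U i j)))
         (dx k (dx l (u i * u j)%e)) (dx k (dx l (u i * u j)%e)) (ecst 0) 0 t Ht
         ltac:(intros; evE; ring) ltac:(intros; evE; rewrite Rabs_R0; lra)).
      pose proof (R' ax1 ax1); pose proof (R' ax1 ax2); pose proof (R' ax2 ax1); pose proof (R' ax2 ax2).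
      pose proof (HS k l ax1 ax1); pose proof (HS k l ax1 ax2);
      pose proof (HS k l ax2 ax1); pose proof (HS k l ax2 ax2).
      lra. }
  destruct (HD ax1 ax1) as [d11 [D11 L11]]; destruct (HD ax1 ax2) as [d12 [D12 L12]].
  destruct (HD ax2 ax1) as [d21 [D21 L21]]; destruct (HD ax2 ax2) as [d22 [D22 L22]].
  exists ((d11 + d12) + (d21 + d22)); split.
  { exact (is_derive_plus _ _ _ _ _ (is_derive_plus _ _ _ _ _ D11 D12)
             (is_derive_plus _ _ _ _ _ D21 D22)). }
  fold E2.
  apply Rle_trans with (8 * (4 * (M * M * (4 * E2)) + 8 * (h * (h + 2 * kk) * (h * (h + 2 * kk))))).
  { lra. }
  assert (Q : (h + 2 * kk) * (h + 2 * kk) <= 2 * (h * h) + 8 * (kk * kk)).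
  { pose proof (Rle_0_sqr (h - 2 * kk)); unfold Rsqr in *; lra. }
  rewrite Hkk in Q.
  set (m := M * M); set (g := h * h) in *.
  assert (1 <= m) by (unfold m; nra); assert (1 <= g) by (unfold g; nra).
  replace (M ^ 2 * h ^ 4) with (m * (g * g)) by (unfold m, g; ring).
  assert (Q' : h * (h + 2 * kk) * (h * (h + 2 * kk)) <= g * (2 * g + 8 * (1 + 2 * E2))).
  { replace (h * (h + 2 * kk) * (h * (h + 2 * kk))) with (g * ((h + 2 * kk) * (h + 2 * kk)))
      by (unfold g; ring).
    apply Rmult_le_compat_l; lra. }
  assert (1 <= m * g) by nra.
  assert (m <= m * (g * g)) by nra. assert (g * g <= m * (g * g)) by nra.
  assert (g <= m * (g * g)) by nra.
  set (P := m * (g * g)) in *.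
  assert (m * E2 <= P * E2) by (apply Rmult_le_compat_r; lra).
  assert (g * E2 <= P * E2) by (apply Rmult_le_compat_r; lra).
  assert (0 <= P * E2) by (apply Rmult_le_pos; lra).
  lra.
Qed.

End Growth.

Arguments bounded_by {T}. Arguments cbound {T}. Arguments H1n {T}.
Arguments energy1 {T}. Arguments energy2 {T}. Arguments quadratic {T}.
#[global] Opaque layer.

(** * The corrected error *)

Section Estimate.
Variable T : R.
Local Notation dom := (dom T).

(** The velocity error plus [eps F], where [F] has divergence [dt pi]: this
    removes the source [- eps dt pi] of size [eps] from the pressure equation,
    where it would be weighted by [1 / sqrt eps], in favour of sources of size
    [eps] in the velocity and stress equations. *)
Definition corrected_velocity (eps : R) (u a F : axis -> evol T) (i : axis) : evol T :=
  (u i - a i + eps *: F i)%e.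

(** The stress error minus its initial layer.  It vanishes at time zero, while
    the initial stress error itself is only bounded. *)
Definition corrected_stress (delta : R) (U Y W : axis -> axis -> evol T) (i j : axis) : evol T :=
  (U i j - Y i j - layer T delta * W i j)%e.

Definition stress_NS (a : axis -> evol T) (i j : axis) : evol T :=
  (a i * a j - dx i (a j))%e.

Definition ediv (v : axis -> evol T) : evol T := esum (fun i => dx i (v i)).

(** The equation for the Navier-Stokes solution is used in the form
    [dt a + div (stress_NS a) + grad pi = 0]. *)
Lemma perturbation_system eps delta p u U pi a F W :
  0 < delta ->
  linear_system eps delta p u U (fun _ => ecst 0) (fun i j => u i * u j)%e ->
  ediv a = ecst 0 ->
  (forall j, (dd Time (a j) + ediv (fun i => a i * a j) + dx j pi
               - esum (fun i => dx i (dx i (a j))))%e = ecst 0) ->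
  ediv F = dd Time pi ->
  (forall i j, dd Time (W i j) = ecst 0) ->
  linear_system eps delta (p - pi)%e (corrected_velocity eps u a F)
    (corrected_stress delta U (stress_NS a) W)
    (fun j => eps *: dd Time (F j) - layer T delta * ediv (fun i => W i j))%e
    (fun i j => quadratic (fun i => corrected_velocity eps u a F i - eps *: F i)%e a i j
                + (eps *: dx i (F j) - delta *: dd Time (stress_NS a i j)))%e.
Proof.
  intros Hd (P1 & P2 & P3) Ha HNS HF HW.
  unfold linear_system, corrected_velocity, corrected_stress, ediv, esum in *; repeat split.
  - rewrite !dd_sub, !dd_add, !dd_sub, !dd_cst_mul.
    apply evol_eq; intros t x y Ht.
    apply (f_equal (fun g => val g t x y)) in P1.
    apply (f_equal (fun g => val g t x y)) in Ha.
    apply (f_equal (fun g => val g t x y)) in HF.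
    revert P1 Ha HF; evE; intros E1 E2 E3.
    rewrite <- E3.
    match goal with |- ?e = 0 => match type of E1 with ?l = _ => match type of E2 with ?m = _ =>
      transitivity (l - m); [ring | lra] end end end.
  - intros j.
    rewrite !dd_add, !dd_sub, !dd_cst_mul, !dd_mul, !dx_layer.
    specialize (P2 j); specialize (HNS j).
    unfold stress_NS; rewrite !dd_sub, !dd_mul.
    rewrite !dd_mul in HNS.
    apply evol_eq; intros t x y Ht.
    apply (f_equal (fun g => val g t x y)) in P2.
    apply (f_equal (fun g => val g t x y)) in HNS.
    revert P2 HNS; evE; intros E1 E2.
    match goal with |- ?e = ?r => match type of E1 with ?l = _ => match type of E2 with ?m = _ =>
      transitivity (l - m + r); [ring | lra] end end end.
  - intros i j; specialize (P3 i j).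
    rewrite !dd_sub, dd_add, dd_sub, !dd_cst_mul, dd_mul, dt_layer, HW.
    apply evol_eq; intros t x y Ht.
    apply (f_equal (fun g => val g t x y)) in P3; revert P3.
    unfold quadratic, stress_NS; rewrite dd_sub; evE; intros E1.
    match goal with |- ?e = ?r => match type of E1 with ?l = ?m =>
      transitivity (l - m + r); [field; lra | lra] end end.
Qed.

Lemma L2_add_le (f g : evol T) t : dom t -> L2 (f + g)%e t <= 2 * L2 f t + 2 * L2 g t.
Proof.
  intros Ht; apply Rle_trans with (Int (2 *: (f * f) + 2 *: (g * g))%e t); [|IntE; lra].
  apply Int_mono; auto; intros x y; evE.
  pose proof (Rle_0_sqr (f t x y - g t x y)); unfold Rsqr in *; lra.
Qed.

Lemma L2_sub_le (f g : evol T) t : dom t -> L2 (f - g)%e t <= 2 * L2 f t + 2 * L2 g t.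
Proof.
  intros Ht; apply Rle_trans with (Int (2 *: (f * f) + 2 *: (g * g))%e t); [|IntE; lra].
  apply Int_mono; auto; intros x y; evE.
  pose proof (Rle_0_sqr (f t x y + g t x y)); unfold Rsqr in *; lra.
Qed.

Lemma L2_cst_mul c (f : evol T) t : L2 (c *: f)%e t = c * c * L2 f t.
Proof.
  replace (c *: f * (c *: f))%e with (c * c *: (f * f))%e; [now IntE|].
  apply evol_eq; intros; evE; ring.
Qed.

Lemma L2_bounded b (f : evol T) t : dom t -> (forall x y, Rabs (f t x y) <= b) -> L2 f t <= b * b.
Proof.
  intros Ht H; rewrite <- (Int_cst T (b * b) t Ht); apply Int_mono; auto; intros x y; evE.
  specialize (H x y); apply Rabs_le_between in H; nra.
Qed.

Lemma H1n_nonneg (f : evol T) t : dom t -> 0 <= H1n f t.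
Proof.
  intros; apply Rplus_le_le_0_compat; [|apply sum2_nonneg; intros]; now apply L2_nonneg.
Qed.

Lemma energy1E eps delta (q : evol T) (w : axis -> evol T) (V : axis -> axis -> evol T) t :
  energy1 eps delta q w V t = / 2 * (eps * H1n q t + sum2 (fun i => H1n (w i) t)
    + delta * sum2 (fun i => sum2 (fun j => H1n (V i j) t))).
Proof. unfold energy1, H1n, sum2; rewrite !Int_energy; unfold sum2; field. Qed.

(** An upper bound for the limit at time zero, with a rate that need not be
    uniform in the parameters. *)
Definition nearby (f g : R -> R) : Prop :=
  exists L, 0 <= L /\ forall t, dom t -> f t <= g t + L * t.

Lemma nearby_add f f' g g' : nearby f g -> nearby f' g' ->
  nearby (fun t => f t + f' t) (fun t => g t + g' t).
Proof.
  intros [L [P H]] [L' [P' H']]; exists (L + L'); split; [lra|]; intros t Ht.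
  specialize (H t Ht); specialize (H' t Ht); lra.
Qed.

Lemma nearby_mul c f g : 0 <= c -> nearby f g -> nearby (fun t => c * f t) (fun t => c * g t).
Proof.
  intros Hc [L [P H]]; exists (c * L); split; [nra|]; intros t Ht.
  specialize (H t Ht); nra.
Qed.

Lemma nearby_L2 (f g : evol T) : flat (f - g)%e -> nearby (fun t => L2 f t) (fun t => L2 g t).
Proof. intros H; apply L2_near_initial, flat_small, H. Qed.

Lemma flat_dx_sub i f g : flat (f - g)%e -> @flat T (dx i f - dx i g)%e.
Proof. intros H; rewrite <- dd_sub; now apply flat_dx. Qed.

Lemma nearby_energy eps delta (q : evol T) (w : axis -> evol T) (V : axis -> axis -> evol T)
    (q' : evol T) w' V' : 0 <= eps -> 0 <= delta ->
  flat (q - q')%e -> (forall i, flat (w i - w' i)%e) -> (forall i j, flat (V i j - V' i j)%e) ->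
  nearby (fun t => Int (energy eps delta q w V) t) (fun t => Int (energy eps delta q' w' V') t).
Proof.
  intros He Hd Hq Hw HV.
  assert (N : nearby
    (fun t => / 2 * (eps * L2 q t + sum2 (fun i => L2 (w i) t)
         + delta * sum2 (fun i => sum2 (fun j => L2 (V i j) t))))
    (fun t => / 2 * (eps * L2 q' t + sum2 (fun i => L2 (w' i) t)
         + delta * sum2 (fun i => sum2 (fun j => L2 (V' i j) t))))).
  { apply nearby_mul; [lra|]; unfold sum2.
    repeat apply nearby_add; try apply nearby_mul; auto; unfold sum2;
      repeat apply nearby_add; apply nearby_L2; auto. }
  destruct N as [L [P H]]; exists L; split; auto; intros t Ht.
  rewrite !Int_energy; now apply H.
Qed.

Lemma nearby_energy1 eps delta (q : evol T) (w : axis -> evol T) (V : axis -> axis -> evol T)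
    (q' : evol T) w' V' : 0 <= eps -> 0 <= delta ->
  flat (q - q')%e -> (forall i, flat (w i - w' i)%e) -> (forall i j, flat (V i j - V' i j)%e) ->
  nearby (energy1 eps delta q w V) (energy1 eps delta q' w' V').
Proof.
  intros He Hd Hq Hw HV; unfold energy1, sum2.
  repeat apply nearby_add; apply nearby_energy; auto using flat_dx_sub.
Qed.

Lemma nearby_energy2 eps delta (q : evol T) (w : axis -> evol T) (V : axis -> axis -> evol T)
    (q' : evol T) w' V' : 0 <= eps -> 0 <= delta ->
  flat (q - q')%e -> (forall i, flat (w i - w' i)%e) -> (forall i j, flat (V i j - V' i j)%e) ->
  nearby (energy2 eps delta q w V) (energy2 eps delta q' w' V').
Proof.
  intros He Hd Hq Hw HV; unfold energy2, sum2.
  repeat apply nearby_add; apply nearby_energy; auto using flat_dx_sub.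
Qed.

Lemma energy1_ex_derive eps delta q w V t : dom t -> ex_derive (energy1 (T := T) eps delta q w V) t.
Proof.
  intros Ht; eexists; unfold energy1, sum2.
  exact (is_derive_plus _ _ _ _ _ (Int_derive T _ t Ht)
    (is_derive_plus _ _ _ _ _ (Int_derive T _ t Ht) (Int_derive T _ t Ht))).
Qed.

Lemma energy2_ex_derive eps delta q w V t : dom t -> ex_derive (energy2 (T := T) eps delta q w V) t.
Proof.
  intros Ht; eexists; unfold energy2, sum2.
  exact (is_derive_plus _ _ _ _ _
    (is_derive_plus _ _ _ _ _ (Int_derive T _ t Ht) (Int_derive T _ t Ht))
    (is_derive_plus _ _ _ _ _ (Int_derive T _ t Ht) (Int_derive T _ t Ht))).
Qed.

Lemma energy2_nonneg eps delta q w V t : dom t -> 0 <= eps -> 0 <= delta ->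
  0 <= energy2 (T := T) eps delta q w V t.
Proof.
  intros; unfold energy2, sum2; repeat apply Rplus_le_le_0_compat; apply energy_nonneg; auto.
Qed.

Lemma energy1_nonneg eps delta q w V t : dom t -> 0 <= eps -> 0 <= delta ->
  0 <= energy1 (T := T) eps delta q w V t.
Proof.
  intros; unfold energy1, sum2; repeat apply Rplus_le_le_0_compat; apply energy_nonneg; auto.
Qed.

(** The layer acts on the velocity for a time [delta]; this bounds the resulting
    impulse by [eps + delta] in [H^1].  It is the place where the hypothesis on
    [delta] times the gradient of the divergence of the initial stress enters. *)
Lemma layer_amplitude_le A C eps delta (U0 Y0 : axis -> axis -> evol T) t : dom t ->
  0 < eps -> 0 < delta -> 1 <= A ->
  (forall i j, cbound A 3 (Y0 i j)) ->
  sum2 (fun i => sum2 (fun j => H1n (U0 i j) t)) <= C * C ->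
  delta * delta * sum2 (fun k => sum2 (fun j => L2 (dx k (ediv (fun i => U0 i j))) t))
    <= C * C * ((eps + delta) * (eps + delta)) ->
  delta * delta * sum2 (fun j => H1n (ediv (fun i => U0 i j - Y0 i j)%e) t)
    <= 48 * (C * C + A * A) * ((eps + delta) * (eps + delta)).
Proof.
  intros Ht He Hd HA BY HU HdU.
  set (s := eps + delta) in *.
  assert (E : forall j, ediv (fun i => U0 i j - Y0 i j)%e
    = (ediv (fun i => U0 i j) - ediv (fun i => Y0 i j))%e).
  { intros j; unfold ediv, esum; rewrite !dd_sub; apply evol_eq; intros; evE; ring. }
  assert (B0 : forall j, L2 (ediv (fun i => Y0 i j)) t <= 2 * A * (2 * A)).
  { intros j; apply L2_bounded; auto; intros x y; unfold ediv, esum; evE.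
    eapply Rle_trans; [apply Rabs_triang|].
    pose proof (cbound1 T A _ (Space ax1) _ t x y (BY ax1 j) Ht).
    pose proof (cbound1 T A _ (Space ax2) _ t x y (BY ax2 j) Ht). lra. }
  assert (B1 : forall k j, L2 (dx k (ediv (fun i => Y0 i j))) t <= 2 * A * (2 * A)).
  { intros k j; apply L2_bounded; auto; intros x y; unfold ediv, esum; rewrite dd_add; evE.
    eapply Rle_trans; [apply Rabs_triang|].
    pose proof (cbound2 T A _ (Space k) (Space ax1) _ t x y (BY ax1 j) Ht).
    pose proof (cbound2 T A _ (Space k) (Space ax2) _ t x y (BY ax2 j) Ht). lra. }
  assert (C0 : forall j, L2 (ediv (fun i => U0 i j - Y0 i j)%e) t
     <= 4 * sum2 (fun i => L2 (dx i (U0 i j)) t) + 8 * (A * A)).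
  { intros j; rewrite E; eapply Rle_trans; [apply L2_sub_le; auto|].
    specialize (B0 j); unfold sum2.
    pose proof (L2_add_le (dx ax1 (U0 ax1 j)) (dx ax2 (U0 ax2 j)) t Ht).
    unfold ediv, esum in *; lra. }
  assert (C1 : forall k j, L2 (dx k (ediv (fun i => U0 i j - Y0 i j)%e)) t
     <= 2 * L2 (dx k (ediv (fun i => U0 i j))) t + 8 * (A * A)).
  { intros k j; rewrite E, dd_sub; eapply Rle_trans; [apply L2_sub_le; auto|].
    specialize (B1 k j); lra. }
  pose proof (C0 ax1); pose proof (C0 ax2).
  pose proof (C1 ax1 ax1); pose proof (C1 ax1 ax2); pose proof (C1 ax2 ax1); pose proof (C1 ax2 ax2).
  assert (N0 := fun i j => L2_nonneg T (U0 i j) t Ht).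
  assert (N1 := fun k i j => L2_nonneg T (dx k (U0 i j)) t Ht).
  pose proof (N0 ax1 ax1); pose proof (N0 ax1 ax2); pose proof (N0 ax2 ax1); pose proof (N0 ax2 ax2).
  pose proof (N1 ax1 ax1 ax1); pose proof (N1 ax1 ax1 ax2); pose proof (N1 ax1 ax2 ax1);
  pose proof (N1 ax1 ax2 ax2); pose proof (N1 ax2 ax1 ax1); pose proof (N1 ax2 ax1 ax2);
  pose proof (N1 ax2 ax2 ax1); pose proof (N1 ax2 ax2 ax2).
  set (X := sum2 (fun k => sum2 (fun j => L2 (dx k (ediv (fun i => U0 i j))) t))) in *.
  assert (Z : sum2 (fun j => H1n (ediv (fun i => U0 i j - Y0 i j)%e) t)
     <= 4 * (C * C) + 2 * X + 48 * (A * A)).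
  { unfold X, H1n, sum2 in *; lra. }
  assert (Hds : delta * delta <= s * s) by (unfold s; nra).
  assert (Hdp : 0 < delta * delta) by nra.
  assert (P : 0 <= C * C) by nra. assert (P' : 0 <= A * A) by nra.
  apply Rle_trans with (delta * delta * (4 * (C * C) + 2 * X + 48 * (A * A))).
  - apply Rmult_le_compat_l; lra.
  - assert (delta * delta * (C * C) <= s * s * (C * C)) by (apply Rmult_le_compat_r; lra).
    assert (delta * delta * (A * A) <= s * s * (A * A)) by (apply Rmult_le_compat_r; lra).
    assert (0 <= s * s * (C * C)) by (apply Rmult_le_pos; lra).
    lra.
Qed.

End Estimate.

(** * The pressure estimate *)

Section PressureEstimate.
Variable T : R.
Local Notation dom := (dom T).

Lemma flat_eq (f g : evol T) : flat f -> f = g -> flat g.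
Proof. intros H <-; exact H. Qed.

Lemma flat_stress (a a0 : axis -> evol T) i j :
  (forall i, flat (a i - a0 i)%e) -> flat (stress_NS T a i j - stress_NS T a0 i j)%e.
Proof.
  intros H; eapply flat_eq.
  - apply flat_sub; [apply flat_add; [apply (flat_mul T (a j)), (H i)
      | apply (flat_mul T (a0 i)), (H j)] | apply (flat_dx T i), (H j)].
  - unfold stress_NS; rewrite dd_sub; apply evol_eq; intros; evE; ring.
Qed.

Lemma flat_corrected_stress delta (U U0 : axis -> axis -> evol T) a a0 i j : 0 < delta ->
  (forall i, flat (a i - a0 i)%e) -> (forall i j, flat (U i j - U0 i j)%e) ->
  flat (corrected_stress T delta U (stress_NS T a)
          (fun i j => U0 i j - stress_NS T a0 i j)%e i j - ecst 0)%e.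
Proof.
  intros Hd Ha HU; eapply flat_eq.
  - apply flat_sub; [apply flat_sub; [apply (HU i j) | apply (flat_stress a a0 i j Ha)]|].
    apply (flat_mul T (U0 i j - stress_NS T a0 i j)%e), (layer_flat T delta Hd).
  - unfold corrected_stress; apply evol_eq; intros; evE; ring.
Qed.

Lemma H1n_zero t : dom t -> H1n (@ecst T 0) t = 0.
Proof.
  intros Ht; unfold H1n, sum2; rewrite !dd_cst.
  assert (E : L2 (@ecst T 0) t = 0).
  { replace (ecst 0 * ecst 0)%e with (@ecst T 0); [now apply Int_cst|].
    apply evol_eq; intros; evE; ring. }
  rewrite E; ring.
Qed.

Lemma H1n_add_bounded_le b (f g : evol T) t : dom t ->
  cbound b 3 g -> forall eps, 0 <= eps ->
  H1n (f + eps *: g)%e t <= 2 * H1n f t + 6 * (b * b) * (eps * eps).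
Proof.
  intros Ht Hg eps He; unfold H1n, sum2; rewrite !dd_add, !dd_cst_mul.
  assert (A0 : forall f g : evol T, (forall x y, Rabs (g t x y) <= b) ->
    L2 (f + eps *: g)%e t <= 2 * L2 f t + 2 * (b * b) * (eps * eps)).
  { intros f' g' H; eapply Rle_trans; [apply L2_add_le; auto|].
    rewrite L2_cst_mul.
    pose proof (L2_bounded T b g' t Ht H).
    assert (eps * eps * L2 g' t <= eps * eps * (b * b)) by (apply Rmult_le_compat_l; nra).
    lra. }
  pose proof (A0 f g ltac:(intros; exact (cbound0 T b _ _ t x y Hg Ht))).
  pose proof (A0 (dx ax1 f) (dx ax1 g) ltac:(intros; exact (cbound1 T b _ _ _ t x y Hg Ht))).
  pose proof (A0 (dx ax2 f) (dx ax2 g) ltac:(intros; exact (cbound1 T b _ _ _ t x y Hg Ht))).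
  lra.
Qed.

Lemma sqrt_bound x : 0 <= x -> x <= sqrt (x + 1) * sqrt (x + 1) /\ 0 < sqrt (x + 1) /\ 1 <= sqrt (x + 1).
Proof.
  intros Hx; rewrite sqrt_sqrt by lra.
  assert (1 <= sqrt (x + 1)) by (rewrite <- sqrt_1 at 1; apply sqrt_le_1; lra). lra.
Qed.

Lemma pow_le_one_of_root m z : 0 <= z -> z ^ S m <= 1 -> z <= 1.
Proof.
  intros Hz H; apply Rnot_lt_le; intros Hlt.
  assert (1 < z ^ S m); [|lra].
  apply Rlt_pow_R1; [auto | lia].
Qed.

(** This closes the continuity argument.  With [s = eps + delta], the [H^1] norm of
    the velocity error is of size [s] and its [H^2] norm of size [B], where [B]
    stands for a negative power of [s].  By [sup_interpolation] a power of the
    supremum is at most a constant times [s ^ (2 + j) * B], hence at most a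
    constant times [s]. *)
Lemma velocity_error_le_one A K1 K2 j : 1 <= A -> 0 <= K1 -> 0 <= K2 ->
  exists eta, 0 < eta /\ eta <= 1 /\
  forall eps delta B q w V p u U (a F : axis -> evol T) t, dom t ->
    0 < eps -> 0 < delta -> eps + delta <= eta -> 1 <= B -> (eps + delta) ^ j * B <= 1 ->
    (forall i, cbound A 3 (a i)) -> (forall i, cbound A 3 (F i)) ->
    (forall i, w i = corrected_velocity T eps u a F i) ->
    energy1 eps delta q w V t <= K1 * ((eps + delta) * (eps + delta)) ->
    energy2 eps delta p u U t <= K2 * (B * B) ->
    (forall k i, L2 (dx k (u i - a i)%e) t <= 4 * K1 + 2 * (A * A)) /\
    forall i x y, Rabs ((u i - a i)%e t x y) <= 1.
Proof.
  intros HA HK1 HK2.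
  destruct (sup_interpolation T j) as [c [Hc Hsup]].
  assert (HAA : 0 <= A * A) by nra.
  destruct (sqrt_bound (4 * K1 + 2 * (A * A)) ltac:(lra)) as [Hh [Hh0 Hh1]].
  set (h := sqrt (4 * K1 + 2 * (A * A) + 1)) in *.
  destruct (sqrt_bound (4 * K2 + 2 * (A * A)) ltac:(lra)) as [Hk [Hk0 Hk1]].
  set (k := sqrt (4 * K2 + 2 * (A * A) + 1)) in *.
  set (D := c * h ^ (2 + j) * (h + k)).
  assert (HD : 0 < D).
  { apply Rmult_lt_0_compat; [apply Rmult_lt_0_compat; auto; now apply pow_lt | lra]. }
  exists (Rmin 1 (/ D)); split; [apply Rmin_pos; [lra | now apply Rinv_0_lt_compat]|].
  split; [apply Rmin_l|].
  intros eps delta B q w V p u U a F t Ht He Hd Heta HB HsB Ba BF Hw HE1 HE2.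
  set (s := eps + delta) in *.
  assert (Hs : 0 < s) by (unfold s; lra).
  assert (Hs1 : s <= 1) by (eapply Rle_trans; [exact Heta | apply Rmin_l]).
  assert (HsD : D * s <= 1).
  { apply Rle_trans with (D * / D); [|rewrite Rinv_r; lra].
    apply Rmult_le_compat_l; [lra|]; eapply Rle_trans; [exact Heta | apply Rmin_r]. }
  assert (Hes : eps * eps <= s * s) by (unfold s; nra).
  assert (Hss : 0 < s * s <= 1) by nra.
  assert (HBB : 1 <= B * B) by nra.
  assert (Ev : forall i, (u i - a i)%e = (w i + - eps *: F i)%e).
  { intros i; rewrite Hw; unfold corrected_velocity; apply evol_eq; intros; evE; ring. }
  pose proof (energy1_ge_velocity T eps delta q w V t Ht ltac:(lra) ltac:(lra)) as EW.
  assert (W0 : forall i, L2 (w i) t <= 2 * K1 * (s * s) /\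
                forall m, L2 (dx m (w i)) t <= 2 * K1 * (s * s)).
  { unfold H1n, sum2 in EW.
    assert (N0 := fun i => L2_nonneg T (w i) t Ht).
    assert (N1 := fun m i => L2_nonneg T (dx m (w i)) t Ht).
    pose proof (N0 ax1); pose proof (N0 ax2).
    pose proof (N1 ax1 ax1); pose proof (N1 ax1 ax2);
    pose proof (N1 ax2 ax1); pose proof (N1 ax2 ax2).
    intros i; split; [|intros m; destruct m]; destruct i; lra. }
  assert (C0 : forall f g : evol T, (forall x y, Rabs (g t x y) <= A) ->
     L2 f t <= 2 * K1 * (s * s) -> L2 (f + - eps *: g)%e t <= (4 * K1 + 2 * (A * A)) * (s * s)).
  { intros f g Hg Hf; eapply Rle_trans; [apply L2_add_le; auto|].
    rewrite L2_cst_mul; pose proof (L2_bounded T A g t Ht Hg).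
    assert (- eps * - eps * L2 g t <= s * s * (A * A)).
    { replace (- eps * - eps) with (eps * eps) by ring.
      apply Rmult_le_compat; auto; [nra | now apply L2_nonneg]. }
    lra. }
  assert (V0 : forall i, L2 (u i - a i)%e t <= (4 * K1 + 2 * (A * A)) * (s * s)).
  { intros i; rewrite Ev; apply C0; [|apply W0].
    intros; exact (cbound0 T A _ _ t x y (BF i) Ht). }
  assert (V1 : forall m i, L2 (dx m (u i - a i)%e) t <= (4 * K1 + 2 * (A * A)) * (s * s)).
  { intros m i; rewrite Ev, dd_add, dd_cst_mul; apply C0; [|apply W0].
    intros; exact (cbound1 T A _ _ _ t x y (BF i) Ht). }
  split.
  { intros m i; eapply Rle_trans; [apply V1|].
    rewrite <- (Rmult_1_r (4 * K1 + 2 * (A * A))) at 2; apply Rmult_le_compat_l; lra. }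
  intros i x y.
  assert (V2 : forall m n, L2 (dx m (dx n (u i - a i)%e)) t <= k * B * (k * B)).
  { intros m n; rewrite !dd_sub; eapply Rle_trans; [apply L2_sub_le; auto|].
    pose proof (energy2_ge_velocity T eps delta p u U t m n i Ht ltac:(lra) ltac:(lra)).
    pose proof (L2_bounded T A (dx m (dx n (a i))) t Ht
      ltac:(intros; exact (cbound2 T A _ _ _ _ t _ _ (Ba i) Ht))).
    assert ((4 * K2 + 2 * (A * A)) * (B * B) <= k * k * (B * B)) by (apply Rmult_le_compat_r; lra).
    assert (A * A * 1 <= A * A * (B * B)) by (apply Rmult_le_compat_l; lra).
    lra. }
  assert (Hhs : (4 * K1 + 2 * (A * A)) * (s * s) <= h * s * (h * s)).
  { replace (h * s * (h * s)) with (h * h * (s * s)) by ring.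
    apply Rmult_le_compat_r; lra. }
  apply (pow_le_one_of_root (2 + j)); [apply Rabs_pos|].
  eapply Rle_trans.
  - apply (Hsup (u i - a i)%e (h * s) (k * B) t Ht).
    + now apply Rmult_lt_0_compat.
    + apply Rmult_lt_0_compat; lra.
    + eapply Rle_trans; [apply V0 | exact Hhs].
    + intros m; eapply Rle_trans; [apply V1 | exact Hhs].
    + exact V2.
  - rewrite Rpow_mult_distr.
    assert (Hhk : h * s + k * B <= (h + k) * B) by nra.
    assert (Hp : 0 < h ^ (2 + j)) by now apply pow_lt.
    assert (Hps : 0 < s ^ (2 + j)) by now apply pow_lt.
    apply Rle_trans with (c * (h ^ (2 + j) * s ^ (2 + j)) * ((h + k) * B)).
    { apply Rmult_le_compat_l; auto; left; apply Rmult_lt_0_compat; auto.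
      now apply Rmult_lt_0_compat. }
    replace (c * (h ^ (2 + j) * s ^ (2 + j)) * ((h + k) * B)) with (D * (s ^ (2 + j) * B))
      by (unfold D; ring).
    replace (s ^ (2 + j) * B) with (s * s * (s ^ j * B)) by (simpl; ring).
    assert (s * s * (s ^ j * B) <= s * s * 1) by (apply Rmult_le_compat_l; lra).
    assert (s * s <= s * 1) by (apply Rmult_le_compat_l; lra).
    apply Rle_trans with (D * s); [apply Rmult_le_compat_l; lra | exact HsD].
Qed.

Definition hessian_sum (f : evol T) t : R := sum2 (fun k => sum2 (fun l => L2 (dx k (dx l f)) t)).

Lemma energy2E eps delta (q : evol T) w V t :
  energy2 eps delta q w V t = / 2 * (eps * hessian_sum q t + sum2 (fun i => hessian_sum (w i) t)
    + delta * sum2 (fun i => sum2 (fun j => hessian_sum (V i j) t))).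
Proof. unfold energy2, hessian_sum, sum2; rewrite !Int_energy; unfold sum2; field. Qed.

Lemma hessian_sum_nonneg (f : evol T) t : dom t -> 0 <= hessian_sum f t.
Proof.
  intros; apply sum2_nonneg; intros; apply sum2_nonneg; intros; now apply L2_nonneg.
Qed.

(** The bootstrap runs on the sum of the two energies, each divided by four times
    the bound that is to be proved for it: if the sum is at most one, the velocity
    error is at most one, the Gronwall estimates apply, and each summand is at most
    one quarter. *)
Lemma pressure_estimate A C j (a F a0 : axis -> evol T) (pi pi0 : evol T) :
  0 < T -> 1 <= A -> 0 < C ->
  (forall i, cbound A 3 (a i)) -> (forall i, cbound A 3 (F i)) ->
  (forall i k, cbound A 3 (stress_NS T a i k)) ->
  (forall i k, cbound A 3 (stress_NS T a0 i k)) ->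
  (forall i k, dd Time (stress_NS T a0 i k) = ecst 0) ->
  ediv T a = ecst 0 ->
  (forall j, (dd Time (a j) + ediv T (fun i => a i * a j) + dx j pi
               - esum (fun i => dx i (dx i (a j))))%e = ecst 0) ->
  ediv T F = dd Time pi ->
  (forall i, flat (a i - a0 i)%e) -> flat (pi - pi0)%e ->
  exists CT eta, 0 < CT /\ 0 < eta /\
  forall eps delta B p u U p0 u0 U0,
    0 < eps -> 0 < delta -> eps + delta <= eta -> 1 <= B -> (eps + delta) ^ j * B <= 1 ->
    linear_system eps delta p u U (fun _ => ecst 0) (fun i j => u i * u j)%e ->
    flat (p - p0)%e -> (forall i, flat (u i - u0 i)%e) -> (forall i k, flat (U i k - U0 i k)%e) ->
    (forall i k, dd Time (U0 i k) = ecst 0) ->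
    (forall t, dom t -> sum2 (fun i => H1n (u0 i - a0 i)%e t)
        <= C * C * ((eps + delta) * (eps + delta))) ->
    (forall t, dom t -> eps * H1n (p0 - pi0)%e t <= C * C * ((eps + delta) * (eps + delta))) ->
    (forall t, dom t -> sum2 (fun i => sum2 (fun k => H1n (U0 i k) t)) <= C * C) ->
    (forall t, dom t ->
       delta * delta * sum2 (fun k => sum2 (fun l => L2 (dx k (ediv T (fun i => U0 i l))) t))
       <= C * C * ((eps + delta) * (eps + delta))) ->
    (forall t, dom t -> hessian_sum p0 t + sum2 (fun i => hessian_sum (u0 i) t)
       + sum2 (fun i => sum2 (fun k => hessian_sum (U0 i k) t)) <= C * C * (B * B)) ->
    forall t, dom t -> eps * H1n (p - pi)%e t <= CT * ((eps + delta) * (eps + delta)).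
Proof.
  intros HT HA HC Ba BF BY BY0 HY0 Hdiv HNS HF Fa Fpi.
  assert (HAA : 1 <= A * A) by nra.
  assert (HCC : 0 < C * C) by nra.
  (* [k1 * s ^ 2] and [k2 * B ^ 2] are the bounds that Gronwall's lemma gives for
     the two energies; [k2] depends on [k1] through the bound [h] for the gradient
     of the velocity. *)
  set (K := 1000 * A ^ 4).
  assert (HK : 0 < K).
  { unfold K; apply Rmult_lt_0_compat; [lra | apply pow_lt; lra]. }
  set (e1 := exp (K * T + 1)).
  assert (He1 : 1 <= e1).
  { unfold e1; rewrite <- exp_0 at 1; left; apply exp_increasing; nra. }
  set (k1 := e1 * (30 * (C * C + A * A) + K * T)).
  assert (Hk1 : 30 * (C * C + A * A) <= k1).
  { unfold k1; assert (0 <= K * T) by nra.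
    assert (1 * (30 * (C * C + A * A) + K * T) <= e1 * (30 * (C * C + A * A) + K * T))
      by (apply Rmult_le_compat_r; lra). lra. }
  set (M := 1 + A).
  destruct (sqrt_bound (2 * (4 * (4 * k1) + 2 * (A * A)) + 2 * (A * A)) ltac:(lra)) as [Hh [_ Hh1]].
  set (h := sqrt (2 * (4 * (4 * k1) + 2 * (A * A)) + 2 * (A * A) + 1)) in *.
  set (K3 := 1200 * (M ^ 2 * h ^ 4)).
  assert (HK3 : 0 < K3).
  { unfold K3; apply Rmult_lt_0_compat; [lra|].
    apply Rmult_lt_0_compat; apply pow_lt; unfold M; lra. }
  set (e2 := exp (K3 * T + 1)).
  assert (He2 : 1 <= e2).
  { unfold e2; rewrite <- exp_0 at 1; left; apply exp_increasing; nra. }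
  set (k2 := e2 * (C * C + K3 * T)).
  assert (Hk2 : C * C <= k2).
  { unfold k2; assert (0 <= K3 * T) by nra.
    assert (1 * (C * C + K3 * T) <= e2 * (C * C + K3 * T))
      by (apply Rmult_le_compat_r; lra). lra. }
  destruct (velocity_error_le_one A (4 * k1) (4 * k2) j HA ltac:(lra) ltac:(lra))
    as [eta [Heta [Heta1 Hvel]]].
  exists (8 * k1), eta; split; [lra|]; split; auto.
  intros eps delta B p u U p0 u0 U0 He Hd Hs HB HsB HL Fp Fu FU HU0 I0 I1 I2 I3 I4.
  set (s := eps + delta) in *.
  assert (Hsp : 0 < s) by (unfold s; lra).
  assert (Hs1 : s <= 1) by lra.
  assert (Hss : 0 < s * s) by nra.
  assert (HBB : 1 <= B * B) by nra.
  pose (w := corrected_velocity T eps u a F).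
  pose (W := fun i k => (U0 i k - stress_NS T a0 i k)%e).
  pose (V := corrected_stress T delta U (stress_NS T a) W).
  pose (z := fun l => ediv T (fun i => W i l)).
  pose (E1 := energy1 eps delta (p - pi)%e w V).
  pose (E2 := energy2 eps delta p u U).
  assert (HW : forall i k, dd Time (W i k) = ecst 0).
  { intros i k; unfold W; rewrite dd_sub, HU0, HY0; apply evol_eq; intros; evE; ring. }
  pose proof (perturbation_system T eps delta p u U pi a F W Hd HL Hdiv HNS HF HW) as HP.
  change (corrected_stress T delta U (stress_NS T a) W) with V in HP.
  change (corrected_velocity T eps u a F) with w in HP.
  assert (Hvw : forall i, (w i - eps *: F i)%e = (u i - a i)%e).
  { intros i; unfold w, corrected_velocity; apply evol_eq; intros; evE; ring. }
  assert (Hin1 : exists L, 0 <= L /\ forall t, dom t ->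
      E1 t <= 6 * (C * C + A * A) * (s * s) + L * t).
  { destruct (nearby_energy1 T eps delta (p - pi)%e w V (p0 - pi0)%e
       (corrected_velocity T eps u0 a0 F) (fun _ _ => ecst 0)) as [L [PL HNL]]; try lra.
    - eapply flat_eq; [apply (flat_sub T _ _ Fp Fpi)|].
      apply evol_eq; intros; evE; ring.
    - intros i; eapply flat_eq; [apply (flat_sub T _ _ (Fu i) (Fa i))|].
      unfold w, corrected_velocity; apply evol_eq; intros; evE; ring.
    - intros i k; now apply flat_corrected_stress.
    - exists L; split; auto; intros t Ht.
      eapply Rle_trans; [apply HNL, Ht|]; apply Rplus_le_compat_r.
      rewrite energy1E.
      assert (Z : sum2 (fun i => sum2 (fun k => H1n (@ecst T 0) t)) = 0)
        by (unfold sum2; rewrite (H1n_zero t Ht); ring).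
      rewrite Z.
      specialize (I0 t Ht); specialize (I1 t Ht).
      assert (Hes : eps * eps <= s * s) by (unfold s; nra).
      assert (X := fun i => H1n_add_bounded_le A (u0 i - a0 i)%e (F i) t Ht (BF i) eps ltac:(lra)).
      pose proof (X ax1); pose proof (X ax2).
      assert (A * A * (eps * eps) <= A * A * (s * s)) by (apply Rmult_le_compat_l; lra).
      assert (0 <= C * C * (s * s)) by (apply Rmult_le_pos; lra).
      unfold corrected_velocity, sum2 in *; lra. }
  assert (Hin2 : exists L, 0 <= L /\ forall t, dom t -> E2 t <= C * C * (B * B) + L * t).
  { destruct (nearby_energy2 T eps delta p u U p0 u0 U0) as [L [PL HNL]]; auto; try lra.
    exists L; split; auto; intros t Ht.
    eapply Rle_trans; [apply HNL, Ht|]; apply Rplus_le_compat_r.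
    rewrite energy2E; specialize (I4 t Ht).
    pose proof (hessian_sum_nonneg p0 t Ht) as N0.
    assert (N1 := fun i => hessian_sum_nonneg (u0 i) t Ht).
    assert (N2 := fun i k => hessian_sum_nonneg (U0 i k) t Ht).
    assert (0 <= sum2 (fun i => hessian_sum (u0 i) t)) by (apply sum2_nonneg; exact N1).
    assert (0 <= sum2 (fun i => sum2 (fun k => hessian_sum (U0 i k) t)))
      by (apply sum2_nonneg; intros i; apply sum2_nonneg; exact (N2 i)).
    assert (eps * hessian_sum p0 t <= 1 * hessian_sum p0 t)
      by (apply Rmult_le_compat_r; unfold s in *; lra).
    assert (delta * sum2 (fun i => sum2 (fun k => hessian_sum (U0 i k) t))
       <= 1 * sum2 (fun i => sum2 (fun k => hessian_sum (U0 i k) t)))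
      by (apply Rmult_le_compat_r; unfold s in *; lra).
    lra. }
  destruct Hin1 as [L1 [PL1 HL1]]; destruct Hin2 as [L2' [PL2 HL2]].
  pose (phi := fun t => / (4 * k1 * (s * s)) * E1 t + / (4 * k2 * (B * B)) * E2 t).
  assert (Hc1 : 0 < 4 * k1 * (s * s)) by (apply Rmult_lt_0_compat; lra).
  assert (Hc2 : 0 < 4 * k2 * (B * B)) by (apply Rmult_lt_0_compat; lra).
  assert (Hi1 := Rinv_0_lt_compat _ Hc1); assert (Hi2 := Rinv_0_lt_compat _ Hc2).
  assert (E1n : forall t, dom t -> 0 <= E1 t) by (intros; apply energy1_nonneg; auto; lra).
  assert (E2n : forall t, dom t -> 0 <= E2 t) by (intros; apply energy2_nonneg; auto; lra).
  assert (Hphi : forall t, dom t -> phi t <= 1 ->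
     E1 t <= 4 * k1 * (s * s) /\ E2 t <= 4 * k2 * (B * B)).
  { intros t Ht Hp; unfold phi in Hp.
    specialize (E1n t Ht); specialize (E2n t Ht).
    assert (0 <= / (4 * k1 * (s * s)) * E1 t) by (apply Rmult_le_pos; lra).
    assert (0 <= / (4 * k2 * (B * B)) * E2 t) by (apply Rmult_le_pos; lra).
    split.
    - apply (Rmult_le_reg_l (/ (4 * k1 * (s * s)))); auto; rewrite Rinv_l; lra.
    - apply (Rmult_le_reg_l (/ (4 * k2 * (B * B)))); auto; rewrite Rinv_l; lra. }
  assert (Hphi' : forall t l1 l2, E1 t <= k1 * (s * s) + l1 -> E2 t <= k2 * (B * B) + l2 ->
     phi t <= / 2 + (/ (4 * k1 * (s * s)) * l1 + / (4 * k2 * (B * B)) * l2)).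
  { intros t l1 l2 X1 X2; unfold phi.
    apply (Rmult_le_compat_l (/ (4 * k1 * (s * s)))) in X1; [|lra].
    apply (Rmult_le_compat_l (/ (4 * k2 * (B * B)))) in X2; [|lra].
    rewrite Rmult_plus_distr_l in X1, X2.
    replace (/ (4 * k1 * (s * s)) * (k1 * (s * s))) with (/ 4) in X1 by (field; lra).
    replace (/ (4 * k2 * (B * B)) * (k2 * (B * B))) with (/ 4) in X2 by (field; lra).
    lra. }
  assert (Hall : forall t, dom t -> phi t <= 1).
  { apply (bootstrap phi T (/ (4 * k1 * (s * s)) * L1 + / (4 * k2 * (B * B)) * L2')).
    - apply Rplus_le_le_0_compat; apply Rmult_le_pos; lra.
    - intros t Ht; apply @ex_derive_continuous; unfold phi.
      apply @ex_derive_plus; apply @ex_derive_scal;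
        [apply energy1_ex_derive | apply energy2_ex_derive]; exact Ht.
    - intros t Ht.
      eapply Rle_trans; [apply (Hphi' t (L1 * t) (L2' * t))|right; ring].
      + eapply Rle_trans; [apply HL1, Ht|]; apply Rplus_le_compat_r, Rmult_le_compat_r; lra.
      + eapply Rle_trans; [apply HL2, Ht|]; apply Rplus_le_compat_r, Rmult_le_compat_r; lra.
    - intros tau Htau Hb t Ht.
      assert (Hdom : forall r, 0 < r < tau -> dom r) by (intros r Hr; split; lra).
      assert (Hv : forall r, 0 < r < tau ->
        (forall k i, L2 (dx k (u i - a i)%e) r <= 4 * (4 * k1) + 2 * (A * A)) /\
        forall i x y, Rabs ((u i - a i)%e r x y) <= 1).
      { intros r Hr; destruct (Hphi r (Hdom r Hr) (Hb r Hr)) as [X1 X2].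
        apply (Hvel eps delta B (p - pi)%e w V p u U a F r (Hdom r Hr)); auto. }
      assert (G1 : E1 t <= k1 * (s * s)).
      { eapply Rle_trans.
        - refine (gronwall_layer E1 tau delta K (K * (s * s))
             (24 * (C * C + A * A) * (s * s) / delta)
             (6 * (C * C + A * A) * (s * s)) L1 _ _ _ _ _ _ _ _ t Ht);
            [lra | lra | apply Rmult_le_pos; lra | | apply Rmult_le_pos; lra | exact PL1 | |].
          + unfold Rdiv; apply Rmult_le_pos; [apply Rmult_le_pos; lra|].
            left; now apply Rinv_0_lt_compat.
          + intros r Hr.
            destruct (energy1_growth T A eps delta (p - pi)%e w V a F z (stress_NS T a) r
              (Hdom r Hr) He Hd HA Ba BF BY HP) as [dE [D1 D2]].
            { intros i x y; rewrite Hvw; apply Hv, Hr. }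
            exists dE; split; auto; eapply Rle_trans; [exact D2|].
            apply Rplus_le_compat_l, Rmult_le_compat_l; [left; apply exp_pos|].
            pose proof (layer_amplitude_le T A C eps delta U0 (stress_NS T a0) r (Hdom r Hr)
               He Hd HA BY0 (I2 r (Hdom r Hr)) (I3 r (Hdom r Hr))) as HZ.
            apply (Rmult_le_reg_l (2 * delta)); [lra|].
            replace (2 * delta * (24 * (C * C + A * A) * (s * s) / delta))
              with (48 * (C * C + A * A) * (s * s)) by (field; lra).
            eapply Rle_trans; [right|exact HZ]; unfold z, W; field.
          + intros r Hr; apply HL1, Hdom, Hr.
        - replace (24 * (C * C + A * A) * (s * s) / delta * delta)
            with (24 * (C * C + A * A) * (s * s)) by (field; lra).
          unfold k1; rewrite (Rmult_assoc e1); apply Rmult_le_compat.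
          + left; apply exp_pos.
          + assert (0 <= K * (s * s) * t) by (apply Rmult_le_pos; [apply Rmult_le_pos; lra | lra]).
            assert (0 <= (C * C + A * A) * (s * s)) by (apply Rmult_le_pos; lra).
            lra.
          + unfold e1; destruct (Req_dec t T) as [->|]; [lra|].
            left; apply exp_increasing.
            apply Rplus_lt_compat_r, Rmult_lt_compat_l; lra.
          + assert (K * (s * s) * t <= K * (s * s) * T)
              by (apply Rmult_le_compat_l; [apply Rmult_le_pos; lra | lra]).
            lra. }
      assert (G2 : E2 t <= k2 * (B * B)).
      { eapply Rle_trans.
        - refine (gronwall_layer E2 tau 1 K3 K3 0 (C * C * (B * B)) L2'
            _ _ _ _ _ _ _ _ t Ht); [lra | lra | lra | lra | apply Rmult_le_pos; lra | exact PL2 | |].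
          + intros r Hr; destruct (Hv r Hr) as [V1 V0].
            destruct (energy2_growth T M h eps delta p u U r (Hdom r Hr) He Hd) as [dE [D1 D2]];
              auto; [unfold M; lra | | |].
            * intros i x y; specialize (V0 i x y); rewrite esubE in V0.
              pose proof (cbound0 T A _ _ r x y (Ba i) (Hdom r Hr)) as V2.
              replace (u i r x y) with ((u i r x y - a i r x y) + a i r x y) by ring.
              eapply Rle_trans; [apply Rabs_triang|]; unfold M; lra.
            * intros k i.
              replace (u i) with ((u i - a i) + a i)%e by (apply evol_eq; intros; evE; ring).
              rewrite dd_add; eapply Rle_trans; [apply L2_add_le, Hdom, Hr|].
              specialize (V1 k i).
              pose proof (L2_bounded T A (dx k (a i)) r (Hdom r Hr)
                ltac:(intros; exact (cbound1 T A _ _ _ r _ _ (Ba i) (Hdom r Hr)))).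
              lra.
            * exists dE; split; auto; eapply Rle_trans; [exact D2|]; fold K3.
              assert (0 <= exp (- r / 1) / 1 * E2 r).
              { apply Rmult_le_pos; [|apply E2n, Hdom, Hr].
                unfold Rdiv; rewrite Rinv_1, Rmult_1_r; left; apply exp_pos. }
              fold E2; lra.
          + intros r Hr; apply HL2, Hdom, Hr.
        - unfold k2; rewrite (Rmult_assoc e2); apply Rmult_le_compat.
          + left; apply exp_pos.
          + assert (0 <= K3 * t) by (apply Rmult_le_pos; lra).
            assert (0 <= C * C * (B * B)) by (apply Rmult_le_pos; lra). lra.
          + unfold e2; left; apply exp_increasing.
            apply Rplus_lt_compat_r, Rmult_lt_compat_l; lra.
          + assert (K3 * t <= K3 * T) by (apply Rmult_le_compat_l; lra).
            assert (0 <= K3 * T) by (apply Rmult_le_pos; lra).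
            assert (K3 * T * 1 <= K3 * T * (B * B)) by (apply Rmult_le_compat_l; lra).
            lra. }
      pose proof (Hphi' t 0 0 ltac:(lra) ltac:(lra)); lra. }
  intros t Ht; destruct (Hphi t Ht (Hall t Ht)) as [X1 _].
  unfold E1 in X1; rewrite energy1E in X1.
  assert (0 <= sum2 (fun i => H1n (w i) t)) by (apply sum2_nonneg; intros; now apply H1n_nonneg).
  assert (0 <= delta * sum2 (fun i => sum2 (fun k => H1n (V i k) t))).
  { apply Rmult_le_pos; [lra|].
    apply sum2_nonneg; intros; apply sum2_nonneg; intros; now apply H1n_nonneg. }
  lra.
Qed.

End PressureEstimate.

(** * The equations in terms of evolutions *)

Section Fields.
Variable T : R.
Local Notation dom := (dom T).

Lemma slice_of_smooth f H t : dom t -> slice (of_smooth (T := T) f H) t (f t).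
Proof. intros Ht x y; now apply of_smoothE. Qed.

Lemma slice_static f H t : dom t -> slice (static (T := T) f H) t f.
Proof. intros Ht x y; now apply staticE. Qed.

Lemma slice_sub (f g : evol T) t f' g' : slice f t f' -> slice g t g' ->
  slice (f - g)%e t (fsub f' g').
Proof. intros H H' x y; evE; now rewrite (H x y), (H' x y). Qed.

Lemma slice_ediv (v : axis -> evol T) t v' : dom t ->
  (forall i, slice (v i) t (v' i)) -> slice (ediv T v) t (div v').
Proof.
  intros Ht H x y; unfold ediv, div; rewrite esumE; unfold sum2.
  now rewrite !(slice_dx T _ (v _) t (v' _) Ht (H _) x y).
Qed.

Lemma slice_lap (f : evol T) t f' : dom t -> slice f t f' ->
  slice (esum (fun i => dx i (dx i f))) t (lap f').
Proof.
  intros Ht H; apply (slice_ediv (fun i => dx i f)); auto.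
  intros i; now apply slice_dx.
Qed.

Lemma dt_of_smooth f H t x y : dom t -> dd Time (of_smooth (T := T) f H) t x y = dt f t x y.
Proof. intros Ht; rewrite dd_of_smooth, of_smoothE; auto. Qed.

Lemma dt_static f H : dd Time (static (T := T) f H) = ecst 0.
Proof.
  apply evol_eq; intros t x y Ht; rewrite <- Der_dd by auto; evE.
  apply is_derive_unique, (is_derive_ext_loc (fun _ => f x y)).
  - eapply filter_imp; [|apply (dom_open T t Ht)].
    intros s Hs; cbn [line]; now rewrite staticE.
  - apply @is_derive_const.
Qed.

Lemma dt_stress_static (a : axis -> evol T) i k :
  (forall i, dd Time (a i) = ecst 0) -> dd Time (stress_NS T a i k) = ecst 0.
Proof.
  intros H; unfold stress_NS; rewrite dd_sub, dd_mul, (dd_comm T Time), !H, dd_cst.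
  apply evol_eq; intros; evE; ring.
Qed.

(** Integrating in one variable at a time avoids the Poisson equation:
    [g - avg ax2 g] is an [x2]-derivative and [avg ax2 g], of zero mean in [x1],
    is an [x1]-derivative. *)
Lemma divergence_potential (g : evol T) : (forall t, dom t -> Int g t = 0) ->
  exists F, ediv T F = g.
Proof.
  intros Hg.
  exists (fun i => match i with ax1 => prim ax1 (avg ax2 g) | ax2 => prim ax2 g end).
  unfold ediv, esum; rewrite !prim_along.
  apply evol_eq; intros t x y Ht; evE.
  rewrite (Int_const_field T g t x y), (Hg t Ht); ring.
Qed.

Lemma dt_mean_zero (g : evol T) : (forall t, dom t -> Int g t = 0) ->
  forall t, dom t -> Int (dd Time g) t = 0.
Proof.
  intros H t Ht; rewrite <- (is_derive_unique _ _ _ (Int_derive T g t Ht)).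
  apply is_derive_unique, (is_derive_ext_loc (fun _ => 0)).
  - eapply filter_imp; [|apply (dom_open T t Ht)].
    intros s Hs; symmetry; now apply H.
  - apply @is_derive_const.
Qed.

Lemma NS_equations u0 u p (Hu : forall i, smooth_upto T (fun t => u t i)) (Hp : smooth_upto T p) :
  NS_solution u0 u p ->
  let a := fun i => of_smooth _ (Hu i) in
  ediv T a = ecst 0 /\
  (forall j, (dd Time (a j) + ediv T (fun i => a i * a j) + dx j (of_smooth p Hp)
               - esum (fun i => dx i (dx i (a j))))%e = ecst 0).
Proof.
  intros (_ & _ & Heq & _) a; split.
  - apply evol_eq; intros t x y Ht; evE.
    destruct (Heq t x y ltac:(destruct Ht; lra)) as [E _]; rewrite <- E.
    apply (slice_ediv a t (u t)); auto; intros i; now apply slice_of_smooth.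
  - intros j; apply evol_eq; intros t x y Ht; evE.
    destruct (Heq t x y ltac:(destruct Ht; lra)) as [_ E]; specialize (E j).
    assert (Sa : forall i, slice (a i) t (u t i)) by (intros i; now apply slice_of_smooth).
    rewrite (slice_ediv (fun i => a i * a j)%e t (fun i => tensor (u t) (u t) i j) Ht).
    + rewrite (slice_lap (a j) t (u t j) Ht (Sa j) x y).
      rewrite (slice_dx T j (of_smooth p Hp) t (p t) Ht (slice_of_smooth p Hp t Ht) x y).
      unfold a at 1; rewrite dt_of_smooth by auto.
      unfold mdiv, grad in E; lra.
    + intros i x' y'; evE; now rewrite (Sa i x' y'), (Sa j x' y').
Qed.

Lemma relaxation_equations eps delta u0 p0 U0 Tm u p U
    (Hu : forall i, smooth_upto T (fun t => u t i)) (Hp : smooth_upto T p)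
    (HU : forall i j, smooth_upto T (fun t => U t i j)) :
  Rbar_lt T Tm -> relax_solution eps delta u0 p0 U0 Tm u p U ->
  let v := fun i => of_smooth _ (Hu i) in
  linear_system eps delta (of_smooth p Hp) v (fun i j => of_smooth _ (HU i j))
    (fun _ => ecst 0) (fun i j => v i * v j)%e.
Proof.
  intros HT (_ & _ & _ & Heq & _) v.
  assert (Sv : forall t i, dom t -> slice (v i) t (u t i)) by (intros; now apply slice_of_smooth).
  assert (Heq' : forall t x y, dom t -> _)
    by (intros t x y Ht; refine (Heq t x y _ _);
        [destruct Ht; lra | eapply Rbar_lt_trans; [|exact HT]; apply Ht]).
  cbv beta in Heq'.
  repeat split.
  - apply evol_eq; intros t x y Ht; evE.
    destruct (Heq' t x y Ht) as [E _]; rewrite <- E, dt_of_smooth by auto.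
    f_equal; apply (slice_ediv v t (u t)); auto.
  - intros j; apply evol_eq; intros t x y Ht; evE.
    destruct (Heq' t x y Ht) as [_ [E _]]; specialize (E j); rewrite <- E.
    unfold v at 1; rewrite dt_of_smooth by auto.
    rewrite (slice_dx T j (of_smooth p Hp) t (p t) Ht (slice_of_smooth p Hp t Ht) x y).
    rewrite (slice_ediv (fun i => of_smooth _ (HU i j)) t (fun i => U t i j) Ht); auto.
    intros i; exact (slice_of_smooth _ (HU i j) t Ht).
  - intros i j; apply evol_eq; intros t x y Ht; evE.
    destruct (Heq' t x y Ht) as [_ [_ E]]; specialize (E i j).
    rewrite dt_of_smooth by auto.
    rewrite (slice_dx T i (v j) t (u t j) Ht (Sv t j Ht) x y).
    rewrite (of_smoothE T _ (HU i j)) by auto.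
    rewrite (Sv t i Ht x y), (Sv t j Ht x y).
    unfold vgrad, tensor in E; lra.
Qed.

End Fields.

Lemma sqr_le_of_sqrt_le x c : 0 <= x -> sqrt x <= c -> x <= c * c.
Proof.
  intros Hx H; rewrite <- (sqrt_sqrt x Hx); pose proof (sqrt_pos x).
  apply Rmult_le_compat; auto.
Qed.

Lemma Rpower_neg_ge_one s a : 0 < s <= 1 -> 0 < a -> 1 <= Rpower s (- a).
Proof.
  intros Hs Ha; unfold Rpower; rewrite <- exp_0 at 1.
  assert (ln s <= 0) by (rewrite <- ln_1; apply ln_le; lra).
  destruct (Req_dec (ln s) 0) as [->|Hz]; [right; f_equal; ring|].
  left; apply exp_increasing; nra.
Qed.

Lemma pow_mul_Rpower_le_one s a j : 0 < s <= 1 -> a <= INR j -> s ^ j * Rpower s (- a) <= 1.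
Proof.
  intros Hs Ha; rewrite <- (Rpower_pow j s) by lra; rewrite <- Rpower_plus.
  unfold Rpower; rewrite <- exp_0.
  assert (ln s <= 0) by (rewrite <- ln_1; apply ln_le; lra).
  assert (H1 : (INR j + - a) * ln s <= 0) by nra.
  destruct H1 as [H1|H1]; [left; now apply exp_increasing | rewrite H1; lra].
Qed.

(** * The data, and the conclusion *)

Section Data.
Variable T : R.
Local Notation dom := (dom T).

(** The hypotheses on the initial data, squared and expressed with evolutions
    that are constant in time. *)
Lemma data_bounds C eps delta B (u0 a0 : vfield) (p0 pi0 : sfield) (U0 : mfield)
    (Hu : forall i, smooth_T2 (u0 i)) (Ha : forall i, smooth_T2 (a0 i))
    (Hp : smooth_T2 p0) (Hpi : smooth_T2 pi0) (HU : forall i j, smooth_T2 (U0 i j)) :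
  0 < eps -> 0 < delta ->
  normH1 (vcomp (vsub u0 a0)) + sqrt eps * normH1 [fsub p0 pi0]
    + (eps + delta) * normH1 (mcomp U0) <= C * (eps + delta) ->
  normL2 (vcomp (grad (div u0)))
    + delta * (normL2 [lap p0] + normL2 (mcomp (vgrad (mdiv U0)))) <= C * (eps + delta) ->
  normL2 (map lap (vcomp u0 ++ [p0] ++ mcomp U0)) <= C * B ->
  let su := fun i => static (T := T) (u0 i) (Hu i) in
  let sa := fun i => static (T := T) (a0 i) (Ha i) in
  let sU := fun i j => static (T := T) (U0 i j) (HU i j) in
  forall t, dom t ->
  sum2 (fun i => H1n (su i - sa i)%e t) <= C * C * ((eps + delta) * (eps + delta)) /\
  eps * H1n (static (T := T) p0 Hp - static pi0 Hpi)%e t <= C * C * ((eps + delta) * (eps + delta)) /\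
  sum2 (fun i => sum2 (fun k => H1n (sU i k) t)) <= C * C /\
  delta * delta * sum2 (fun k => sum2 (fun l => L2 (dx k (ediv T (fun i => sU i l))) t))
    <= C * C * ((eps + delta) * (eps + delta)) /\
  hessian_sum T (static p0 Hp) t + sum2 (fun i => hessian_sum T (su i) t)
    + sum2 (fun i => sum2 (fun k => hessian_sum T (sU i k) t)) <= C * C * (B * B).
Proof.
  intros He Hd H1 H2 H3 su sa sU t Ht.
  set (s := eps + delta) in *; assert (Hs : 0 < s) by (unfold s; lra).
  assert (Su : forall i, slice (su i) t (u0 i)) by (intros; now apply slice_static).
  assert (Sa : forall i, slice (sa i) t (a0 i)) by (intros; now apply slice_static).
  assert (SU : forall i j, slice (sU i j) t (U0 i j)) by (intros; now apply slice_static).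
  pose proof (slice_static T p0 Hp t Ht) as Sp.
  pose proof (slice_static T pi0 Hpi t Ht) as Spi.
  assert (Hh : forall f f', slice f t f' -> L2sq (lap f') = hessian_sum T f t).
  { intros f f' Hf; unfold hessian_sum; rewrite hessian_identity by auto.
    symmetry; apply slice_L2; auto; now apply slice_lap. }
  set (n1 := normH1 (vcomp (vsub u0 a0))) in *.
  set (n2 := normH1 [fsub p0 pi0]) in *.
  set (n3 := normH1 (mcomp U0)) in *.
  set (n4 := normL2 (vcomp (grad (div u0)))) in *.
  set (n5 := normL2 [lap p0]) in *.
  set (n6 := normL2 (mcomp (vgrad (mdiv U0)))) in *.
  assert (P1 : 0 <= n1) by apply sqrt_pos. assert (P2 : 0 <= n2) by apply sqrt_pos.
  assert (P3 : 0 <= n3) by apply sqrt_pos. assert (P4 : 0 <= n4) by apply sqrt_pos.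
  assert (P5 : 0 <= n5) by apply sqrt_pos. assert (P6 : 0 <= n6) by apply sqrt_pos.
  assert (Pe : 0 < sqrt eps) by now apply sqrt_lt_R0.
  assert (Q2 : 0 <= sqrt eps * n2) by (apply Rmult_le_pos; lra).
  assert (Q3 : 0 <= s * n3) by (apply Rmult_le_pos; lra).
  assert (Q5 : 0 <= delta * n5) by (apply Rmult_le_pos; lra).
  assert (Q6 : 0 <= delta * n6) by (apply Rmult_le_pos; lra).
  assert (N : forall f : evol T, 0 <= H1n f t) by (intros; now apply H1n_nonneg).
  assert (sq : forall a b, 0 <= a -> a <= b -> a * a <= b * b) by (intros; nra).
  repeat split.
  - assert (E : n1 = sqrt (sum2 (fun i => H1n (su i - sa i)%e t))).
    { unfold n1, normH1, vcomp, vsub, sumR, sum2; simpl; f_equal.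
      rewrite <- !(slice_H1 T (su _ - sa _)%e t _ Ht (slice_sub T _ _ t _ _ (Su _) (Sa _))).
      unfold H1n; ring. }
    replace (C * C * (s * s)) with (C * s * (C * s)) by ring.
    apply sqr_le_of_sqrt_le; [now apply sum2_nonneg | rewrite <- E; lra].
  - assert (E : n2 = sqrt (H1n (static (T := T) p0 Hp - static pi0 Hpi)%e t)).
    { unfold n2, normH1, sumR; simpl; f_equal.
      rewrite <- (slice_H1 T _ t _ Ht (slice_sub T _ _ t _ _ Sp Spi)); unfold H1n; ring. }
    assert (E' : eps * H1n (static (T := T) p0 Hp - static pi0 Hpi)%e t = sqrt eps * n2 * (sqrt eps * n2)).
    { rewrite E; set (X := H1n _ t).
      replace (sqrt eps * sqrt X * (sqrt eps * sqrt X))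
        with (sqrt eps * sqrt eps * (sqrt X * sqrt X)) by ring.
      rewrite !sqrt_sqrt; auto; [apply N | lra]. }
    rewrite E'; replace (C * C * (s * s)) with (C * s * (C * s)) by ring.
    apply sq; lra.
  - assert (E : n3 = sqrt (sum2 (fun i => sum2 (fun k => H1n (sU i k) t)))).
    { unfold n3, normH1, mcomp, sumR, sum2; simpl; f_equal.
      rewrite <- !(slice_H1 T (sU _ _) t _ Ht (SU _ _)).
      unfold H1n; ring. }
    apply sqr_le_of_sqrt_le.
    + apply sum2_nonneg; intros; now apply sum2_nonneg.
    + rewrite <- E; apply (Rmult_le_reg_l s); lra.
  - assert (Sd : forall k l, slice (dx k (ediv T (fun i => sU i l))) t (vgrad (mdiv U0) k l)).
    { intros k l; apply slice_dx; auto; apply slice_ediv; auto. }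
    assert (E : n6 = sqrt (sum2 (fun k => sum2 (fun l => L2 (dx k (ediv T (fun i => sU i l))) t)))).
    { unfold n6, normL2, mcomp, sumR, sum2; simpl; f_equal.
      rewrite !(slice_L2 T _ t _ Ht (Sd _ _)); ring. }
    set (X := sum2 _) in E |- *.
    assert (HX : 0 <= X).
    { apply sum2_nonneg; intros; apply sum2_nonneg; intros; now apply L2_nonneg. }
    replace (delta * delta * X) with (delta * n6 * (delta * n6)).
    + replace (C * C * (s * s)) with (C * s * (C * s)) by ring; apply sq; lra.
    + rewrite E.
      replace (delta * sqrt X * (delta * sqrt X)) with (delta * delta * (sqrt X * sqrt X)) by ring.
      now rewrite sqrt_sqrt.
  - replace (C * C * (B * B)) with (C * B * (C * B)) by ring.
    apply sqr_le_of_sqrt_le.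
    + assert (Hn := fun f => hessian_sum_nonneg T f t Ht).
      apply Rplus_le_le_0_compat; [apply Rplus_le_le_0_compat|]; auto using sum2_nonneg.
    + eapply Rle_trans; [right|exact H3].
      unfold normL2, vcomp, mcomp, sumR, sum2; simpl; f_equal.
      assert (Hhu := fun i => Hh (su i) _ (Su i)); assert (HhU := fun i j => Hh (sU i j) _ (SU i j)).
      rewrite (Hh _ _ Sp), (Hhu ax1), (Hhu ax2), (HhU ax1 ax1), (HhU ax1 ax2),
        (HhU ax2 ax1), (HhU ax2 ax2); ring.
Qed.

End Data.

Lemma vanishes_along_rate (Lam : R -> R -> Prop) CT : 0 < CT ->
  (forall eps delta, Lam eps delta -> 0 < eps /\ 0 < delta) ->
  vanishes_along Lam (fun eps delta => delta / sqrt eps) ->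
  vanishes_along Lam (fun eps delta => CT * (sqrt eps + delta / sqrt eps)).
Proof.
  intros HC HL Hv r Hr.
  set (r' := r / (2 * CT)).
  assert (Hr' : 0 < r') by (apply Rdiv_lt_0_compat; lra).
  destruct (Hv r' Hr') as [eta [He H]].
  exists (Rmin eta (r' * r')); split; [apply Rmin_pos; auto; nra|].
  intros eps delta Hl Hlt; destruct (HL eps delta Hl) as [He' Hd].
  assert (eps < eta) by (eapply Rlt_le_trans; [exact Hlt | apply Rmin_l]).
  assert (eps < r' * r') by (eapply Rlt_le_trans; [exact Hlt | apply Rmin_r]).
  specialize (H eps delta Hl ltac:(lra)).
  assert (Hs : sqrt eps < r') by (rewrite <- (sqrt_square r') by lra; apply sqrt_lt_1; lra).
  pose proof (sqrt_lt_R0 eps He').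
  assert (0 < delta / sqrt eps) by (apply Rdiv_lt_0_compat; auto).
  rewrite Rabs_right in H by lra.
  rewrite Rabs_right by (apply Rle_ge, Rmult_le_pos; lra).
  replace r with (CT * (r' + r')) by (unfold r'; field; lra).
  apply Rmult_lt_compat_l; lra.
Qed.

Theorem corollary2p5
  (u0NS : vfield) (uNS : R -> vfield) (pNS : R -> sfield)
  (hu0NS : forall i, smooth_T2 (u0NS i))
  (hNS : NS_solution u0NS uNS pNS)
  (Lam : R -> R -> Prop)
  (hLam : forall eps delta, Lam eps delta -> 0 < eps /\ 0 < delta)
  (hlittleo : vanishes_along Lam (fun eps delta => delta / sqrt eps))
  (C a : R) (hC : 0 < C) (ha : 0 < a)
  (hbound : forall eps delta, Lam eps delta -> delta <= C * sqrt eps)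
  (T : R) (hT : 0 < T) :
  exists CT etaT : R, 0 < CT /\ 0 < etaT /\
    (forall (u0 : R -> R -> vfield) (p0 : R -> R -> sfield) (U0 : R -> R -> mfield)
            (Tmax : R -> R -> Rbar)
            (u : R -> R -> R -> vfield) (p : R -> R -> R -> sfield)
            (U : R -> R -> R -> mfield),
       (forall eps delta, Lam eps delta ->
          (forall i, smooth_T2 (u0 eps delta i)) /\
          smooth_T2 (p0 eps delta) /\
          (forall i j, smooth_T2 (U0 eps delta i j))) ->
       (forall eps delta, Lam eps delta ->
          maximal_relax_solution eps delta
            (u0 eps delta) (p0 eps delta) (U0 eps delta)
            (Tmax eps delta) (u eps delta) (p eps delta) (U eps delta)) ->
       (forall eps delta, Lam eps delta ->
          normH1 (vcomp (vsub (u0 eps delta) u0NS))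
          + sqrt eps * normH1 [fsub (p0 eps delta) (pNS 0)]
          + (eps + delta) * normH1 (mcomp (U0 eps delta))
          <= C * (eps + delta)) ->
       (forall eps delta, Lam eps delta ->
          normL2 (vcomp (grad (div (u0 eps delta))))
          + delta * (normL2 [lap (p0 eps delta)]
                     + normL2 (mcomp (vgrad (mdiv (U0 eps delta)))))
          <= C * (eps + delta)) ->
       (forall eps delta, Lam eps delta ->
          normL2 (map lap (vcomp (u0 eps delta) ++ [p0 eps delta]
                           ++ mcomp (U0 eps delta)))
          <= C * Rpower (eps + delta) (- a)) ->
       forall eps delta, Lam eps delta ->
         eps + delta <= etaT -> Rbar_lt T (Tmax eps delta) ->
         Rbar_le
           (Lub_Rbar (fun r => exists t, 0 < t < T /\
                        r = normH1 [fsub (p eps delta t) (pNS t)]))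
           (CT * (sqrt eps + delta / sqrt eps))) /\
    vanishes_along Lam (fun eps delta => CT * (sqrt eps + delta / sqrt eps)).
Proof.
  pose proof hNS as (SuNS & SpNS & _ & HuNS0 & Hmean).
  assert (Ha : forall i, smooth_upto T (fun t => uNS t i))
    by (intros i; apply (smooth_evol_upto T p_infty); [exact I | apply SuNS]).
  assert (Hpi : smooth_upto T pNS) by (apply (smooth_evol_upto T p_infty); [exact I | exact SpNS]).
  assert (Hpi0 : smooth_T2 (pNS 0)) by (apply (smooth_T2_initial p_infty); [exact I | exact SpNS]).
  destruct (NS_equations T u0NS uNS pNS Ha Hpi hNS) as [Hdiv HNS].
  pose (aa := fun i => of_smooth _ (Ha i)).
  pose (pi := of_smooth pNS Hpi).
  pose (a0 := fun i => static (T := T) (u0NS i) (hu0NS i)).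
  assert (Hmean' : forall t, dom T t -> Int pi t = 0).
  { intros t Ht; rewrite <- (Hmean t ltac:(destruct Ht; lra)), Int_int_T2 by auto.
    apply RInt_ext; intros x _; apply RInt_ext; intros y _; now apply of_smoothE. }
  destruct (divergence_potential T (dd Time pi) (dt_mean_zero T pi Hmean')) as [F HF].
  destruct (cbound_family T 3 aa) as [A1 HA1].
  destruct (cbound_family T 3 F) as [A2 HA2].
  assert (HS : forall b : axis -> evol T, exists A, forall i k, cbound A 3 (stress_NS T b i k)).
  { intros b; destruct (cbound_family T 3 (stress_NS T b ax1)) as [X1 HX1].
    destruct (cbound_family T 3 (stress_NS T b ax2)) as [X2 HX2].
    exists (Rmax X1 X2); intros [|] k; (eapply cbound_mono; [|eauto]);
      [apply Rmax_l | apply Rmax_r]. }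
  destruct (HS aa) as [A3 HA3]; destruct (HS a0) as [A4 HA4].
  pose (A := Rmax 1 (Rmax (Rmax A1 A2) (Rmax A3 A4))).
  assert (LA : 1 <= A /\ A1 <= A /\ A2 <= A /\ A3 <= A /\ A4 <= A).
  { unfold A.
    pose proof (Rmax_l 1 (Rmax (Rmax A1 A2) (Rmax A3 A4))).
    pose proof (Rmax_r 1 (Rmax (Rmax A1 A2) (Rmax A3 A4))).
    pose proof (Rmax_l (Rmax A1 A2) (Rmax A3 A4)); pose proof (Rmax_r (Rmax A1 A2) (Rmax A3 A4)).
    pose proof (Rmax_l A1 A2); pose proof (Rmax_r A1 A2).
    pose proof (Rmax_l A3 A4); pose proof (Rmax_r A3 A4); lra. }
  destruct LA as (LA0 & LA1 & LA2 & LA3 & LA4).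
  (* With [j > a] the factor [s ^ j] outweighs the growth [s ^ (- a)] of the data. *)
  destruct (INR_unbounded a) as [j Hj].
  destruct (pressure_estimate T A C j aa F a0 pi (static (pNS 0) Hpi0)) as
    [K [eta [HK [Heta Hmain]]]]; auto.
  { intros i; now apply (cbound_mono T A1 A). }
  { intros i; now apply (cbound_mono T A2 A). }
  { intros i k; now apply (cbound_mono T A3 A). }
  { intros i k; now apply (cbound_mono T A4 A). }
  { intros i k; apply dt_stress_static; intros; apply dt_static. }
  { intros i; apply flat_initial; auto. }
  { apply flat_initial; auto. }
  exists (sqrt K), (Rmin 1 eta); split; [now apply sqrt_lt_R0|].
  split; [apply Rmin_pos; lra|].
  split; [|apply vanishes_along_rate; auto; now apply sqrt_lt_R0].
  intros u0 p0 U0 Tmax u p U Hsm Hmax I1 I2 I3 eps delta Hl Hs HT.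
  destruct (hLam eps delta Hl) as [He Hd].
  destruct (Hsm eps delta Hl) as (Hu0 & Hp0 & HU0).
  destruct (Hmax eps delta Hl) as (_ & Hsol & _).
  specialize (I1 eps delta Hl); specialize (I2 eps delta Hl); specialize (I3 eps delta Hl).
  assert (Hs1 : eps + delta <= 1) by (eapply Rle_trans; [exact Hs | apply Rmin_l]).
  assert (Hse : eps + delta <= eta) by (eapply Rle_trans; [exact Hs | apply Rmin_r]).
  pose proof Hsol as (Su & Sp & SU & _ & E1 & E2 & E3).
  assert (Hu : forall i, smooth_upto T (fun t => u eps delta t i))
    by (intros i; apply (smooth_evol_upto T (Tmax eps delta)); auto).
  assert (Hp : smooth_upto T (p eps delta))
    by (apply (smooth_evol_upto T (Tmax eps delta)); auto).
  assert (HU : forall i k, smooth_upto T (fun t => U eps delta t i k))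
    by (intros i k; apply (smooth_evol_upto T (Tmax eps delta)); auto).
  pose proof (relaxation_equations T eps delta _ _ _ _ _ _ _ Hu Hp HU HT Hsol) as HL.
  assert (HI := data_bounds T C eps delta (Rpower (eps + delta) (- a)) (u0 eps delta) u0NS
    (p0 eps delta) (pNS 0) (U0 eps delta) Hu0 hu0NS Hp0 Hpi0 HU0 He Hd I1 I2 I3).
  cbv zeta in HL, HI.
  assert (Hest : forall t, dom T t ->
    eps * H1n (of_smooth (p eps delta) Hp - pi)%e t <= K * ((eps + delta) * (eps + delta))).
  { apply (Hmain eps delta (Rpower (eps + delta) (- a)) (of_smooth (p eps delta) Hp)
      (fun i => of_smooth _ (Hu i)) (fun i k => of_smooth _ (HU i k))
      (static (p0 eps delta) Hp0) (fun i => static (u0 eps delta i) (Hu0 i))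
      (fun i k => static (U0 eps delta i k) (HU0 i k))); auto.
    - apply Rpower_neg_ge_one; lra.
    - apply pow_mul_Rpower_le_one; lra.
    - apply flat_initial; auto.
    - intros i; apply flat_initial; auto; intros x y; apply E1.
    - intros i k; apply flat_initial; auto; intros x y; apply E3.
    - intros i k; apply dt_static.
    - intros t Ht; apply (HI t Ht).
    - intros t Ht; apply (HI t Ht).
    - intros t Ht; apply (HI t Ht).
    - intros t Ht; apply (HI t Ht).
    - intros t Ht; apply (HI t Ht). }
  apply (proj2 (Lub_Rbar_correct _)).
  intros r [t [Ht ->]].
  specialize (Hest t Ht).
  assert (E : normH1 [fsub (p eps delta t) (pNS t)]
     = sqrt (H1n (of_smooth (p eps delta) Hp - pi)%e t)).
  { unfold normH1, sumR; simpl; f_equal.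
    rewrite <- (slice_H1 T _ t _ Ht (slice_sub T _ _ t _ _
       (slice_of_smooth T _ Hp t Ht) (slice_of_smooth T _ Hpi t Ht))).
    unfold H1n; fold pi; ring. }
  simpl; rewrite E.
  set (X := H1n _ t) in *.
  assert (HX : 0 <= X) by now apply H1n_nonneg.
  pose proof (sqrt_lt_R0 eps He) as Pe; pose proof (sqrt_lt_R0 K HK) as PK.
  apply (Rmult_le_reg_l (sqrt eps)); auto.
  replace (sqrt eps * (sqrt K * (sqrt eps + delta / sqrt eps)))
    with (sqrt K * (sqrt eps * sqrt eps + delta)) by (field; lra).
  rewrite sqrt_sqrt, <- sqrt_mult by lra.
  rewrite <- (sqrt_square (eps + delta)), <- sqrt_mult by nra.
  now apply sqrt_le_1_alt.
Qed.
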